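(* Let $\theta$ be a twisted-periodic $1$-form with twist function $f$ on an open set $\mathfrak Q\subset\mathbb C$ containing $0$, let $\mathcal B\colon\bar{\mathcal L}^\times\mathfrak Z\to\mathbb R$ be the associated non-local Lagrangian action functional, and let $\mathrm{Coll}\,\mathcal S$ be the space of classical periodic collision orbits (all defined in the context). Then the rescale-square map $$\mathcal Q\colon \mathrm{Crit}\,\mathcal B\to \mathrm{Coll}\,\mathcal S,\qquad z\mapsto q_z:=z^2\circ\tau_z,$$ is (well defined and) a bijection between the set $\mathrm{Crit}\,\mathcal B$ of critical points of $\mathcal B$ and $\mathrm{Coll}\,\mathcal S$.
   Context: Identify $\mathbb C\cong\mathbb R^2$; $\langle\cdot,\cdot\rangle_0$, $|\cdot|$ are the Euclidean inner product and norm; $\mathbb S^1=\mathbb R/\mathbb Z$; $\mathbb S^1_{\mathbb C}\subset\mathbb C$ is the unit circle; $\|\cdot\|$, $\langle\cdot,\cdot\rangle$ are the norm and inner product of $L^2([0,1],\mathbb R^2)$. Data. $\mathfrak Q\subset\mathbb C$ is open with $0\in\mathfrak Q$; $\varsigma(z)=z^2$ and $\mathfrak Z:=\varsigma^{-1}(\mathfrak Q)$. A twisted-periodic $1$-form on $\mathfrak Q$ is a smooth family $\theta=(\theta_t)_{t\in\mathbb R}$ of $1$-forms $\theta_t=A^1_t\,dq_1+A^2_t\,dq_2$ on $\mathfrak Q$ with $\dot\theta_{t+1}=\dot\theta_t$ and $\theta_{t+1}=\theta_t+df$ for a smooth function $f\colon\mathfrak Q\to\mathbb R$ (twist function); the dot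 is the $t$-derivative. Put $\mathbf A_t=(A_t^1,A_t^2)$ and $B_t=\partial_1A^2_t-\partial_2A^1_t$. Loop space. $\mathcal L_\pm\mathfrak Z=\{z\in C^\infty(\mathbb R,\mathfrak Z): z(\tau+1)=\pm z(\tau)\ \forall\tau\}$, $\mathcal L_\pm^\times\mathfrak Z=\mathcal L_\pm\mathfrak Z\setminus\{0\}$ (remove the zero loop). $\bar{\mathcal L}^\times\mathfrak Z$ is the quotient of $\mathcal L_+^\times\mathfrak Z\cup\mathcal L_-^\times\mathfrak Z$ by $z\sim -z$; elements are denoted by a representative $z$. For $z\in\mathcal L^\times_\pm\mathfrak Z$ tangent vectors are $\xi\in\mathcal L_\pm\mathbb C=\{\xi\in C^\infty(\mathbb R,\mathbb C):\xi(\tau+1)=\pm\xi(\tau)\}$. Reparametrization: $t_z(\tau)=\|z\|^{-2}\int_0^\tau|z(s)|^2ds$; it satisfies $t_z(\tau+1)=t_z(\tau)+1$. For $z\in\mathrm{Crit}\,\mathcal B$ it induces a homeomorphism of $\mathbb S^1$, with inverse $\tau_z$. Functional: $$\mathcal B(z)=2\|z\|^2\|z'\|^2+\frac1{\|z\|^2}+\int_0^1(\varsigma^*\theta_{t_z(\tau)})|_{z(\tau)}z'(\tau)\,d\tau-f(z(0)^2),\qquad z\in\bar{\mathcal L}^\times\mathfrak Z.$$ $\mathrm{Crit}\,\mathcal B$ is the set of $z$ with $d\mathcal B|_z\xi=0$ for all tangent vectors $\xi$ at $z$. Classical collision loops. $\Lambda^\times_{\rm coll}\mathfrak Q$ is the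 set of loops $q\in W^{1,2}(\mathbb S^1,\mathfrak Q)$ such that (i) $T_q:=q^{-1}(0)$ is finite (possibly empty); (ii) there exist continuous maps $\alpha_q\colon\mathbb S^1\to\mathbb S^1_{\mathbb C}$, $e_q\colon\mathbb S^1\to\mathbb R$, $\beta_q\colon\mathbb S^1\to\mathbb C$ with $\beta_q|_{T_q}=0$ and, on $\mathbb S^1\setminus T_q$, $\alpha_q=\frac{q}{|q|}$, $e_q=\frac12|\dot q|^2-\frac1{|q|}$, $\beta_q=\dot\alpha_q|q|$. $\mathrm{Coll}\,\mathcal S$ is the set of $q\in\Lambda^\times_{\rm coll}\mathfrak Q$ such that on $\mathbb S^1\setminus T_q$ the map $q$ solves $$\ddot q=-B_t(q)\,i\dot q-\dot{\mathbf A}_t(q)-\frac{q}{|q|^3}.$$ *)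

(* Defs.v *)
From HB Require Import structures.
From mathcomp Require Import all_boot all_order all_algebra.
From mathcomp Require Import all_classical all_reals all_analysis.

Set Implicit Arguments.
Unset Strict Implicit.
Unset Printing Implicit Defensive.

Import Order.TTheory GRing.Theory Num.Theory.
Import numFieldNormedType.Exports.

Local Open Scope ring_scope.
Local Open Scope classical_set_scope.

(* The complex plane, as the normed R-space R * R.  Its library norm `|.| is
   the max norm; it only provides the topology, and the Euclidean norm is
   [enorm]. *)
Notation plane R := (R * R)%type.

Section plane.
Context {R : realType}.
Implicit Types z w : plane R.

Definition edot z w : R := z.1 * w.1 + z.2 * w.2.

Definition enorm z : R := Num.sqrt (edot z z).

Definition imul z : plane R := (- z.2, z.1).

Definition csqr z : plane R := (z.1 * z.1 - z.2 * z.2, z.1 * z.2 + z.2 * z.1).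

End plane.

Section smoothness.
Context {R : realType}.

(* All iterated directional derivatives of order at most k exist and are
   continuous on U.  For U open this is the usual notion, and it depends only
   on the restriction of g to U. *)
Fixpoint Ck_on {V W : normedModType R} (k : nat) (U : set V) (g : V -> W)
    : Prop :=
  (forall x, U x -> {for x, continuous g}) /\
  if k is k'.+1 then
    forall v : V, (forall x, U x -> derivable g x v) /\
                  Ck_on k' U (fun x => 'D_v g x)
  else True.

Definition smooth_on {V W : normedModType R} (U : set V) (g : V -> W) : Prop :=
  forall k, Ck_on k U g.

Definition smooth_curve {W : normedModType R} (z : R -> W) : Prop :=
  forall n t, derivable z^`(n) t 1.

End smoothness.

Section forms.
Context {R : realType}.
Implicit Types (A : R -> plane R -> plane R) (f : plane R -> R).

(* A family of 1-forms theta_t = A^1_t dq_1 + A^2_t dq_2 is given by its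
   coefficients A t q = (A^1_t(q), A^2_t(q)); values of A t and f outside Q
   are irrelevant. *)

Definition dotA A (t : R) (q : plane R) : plane R := (fun s => A s q)^`() t.

Definition magnetic A (t : R) (q : plane R) : R :=
  'D_((1, 0) : plane R) (fun x : plane R => (A t x).2) q -
  'D_((0, 1) : plane R) (fun x : plane R => (A t x).1) q.

Definition gradient f (q : plane R) : plane R :=
  ('D_((1, 0) : plane R) f q, 'D_((0, 1) : plane R) f q).

Definition twisted_periodic (Q : set (plane R)) A f : Prop :=
  [/\ smooth_on ([set: R] `*` Q) (fun p : R * plane R => A p.1 p.2),
      smooth_on Q f,
      (forall t q, Q q -> dotA A (t + 1) q = dotA A t q) &
      (forall t q, Q q -> A (t + 1) q = A t q + gradient f q)].

(* The value on the tangent vector w at z of the pullback by csqr of the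
   1-form theta_t. *)
Definition sq_pullback A (t : R) (z w : plane R) : R :=
  edot (A t (csqr z)) ('D_w csqr z).

End forms.

Section loops.
Context {R : realType}.
Notation mu := (@lebesgue_measure R).
Implicit Types (z q v : R -> plane R) (Q Z : set (plane R)).

Definition L2dot z v : R := \int[mu]_(x in `[0, 1]) edot (z x) (v x).

Definition L2norm z : R := Num.sqrt (L2dot z z).

(* The integral from a to b of a real function, also for b < a. *)
Definition oriented_int (a b : R) (g : R -> R) : R :=
  if a <= b then \int[mu]_(x in `[a, b]) g x
  else - \int[mu]_(x in `[b, a]) g x.

(* s = false gives the periodic loops, s = true the anti-periodic ones. *)
Definition twisted_loop (s : bool) Z : set (R -> plane R) :=
  [set z | [/\ smooth_curve z, (forall t, Z (z t)) &
               forall t, z (t + 1) = (-1) ^+ s *: z t]].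

Definition punctured_twisted_loop (s : bool) Z : set (R -> plane R) :=
  twisted_loop s Z `\ cst 0.

Definition sign_class z : set (R -> plane R) := [set z; \- z].

Definition time_repar z (tau : R) : R :=
  (L2norm z ^+ 2)^-1 * oriented_int 0 tau (fun s => enorm (z s) ^+ 2).

Definition time_repar_inv z : R -> R :=
  'pinv_(fun=> 0) [set: R] (time_repar z).

(* h is the lift to R of a homeomorphism of R/Z of degree one. *)
Definition circle_homeo_lift (h : R -> R) : Prop :=
  [/\ continuous h,
      forall t, h (t + 1) = h t + 1,
      set_bij [set: R] [set: R] h &
      continuous ('pinv_(fun=> 0) [set: R] h)].

Definition rescale_square z : R -> plane R :=
  fun t => csqr (z (time_repar_inv z t)).

Definition action (A : R -> plane R -> plane R) (f : plane R -> R) z : R :=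
  2 * L2norm z ^+ 2 * L2norm z^`()%classic ^+ 2 + 1 / L2norm z ^+ 2
  + \int[mu]_(tau in `[0, 1])
      sq_pullback A (time_repar z tau) (z tau) (z^`()%classic tau)
  - f (csqr (z 0)).

(* The representatives z of the critical points: the derivative of the action
   at z exists and vanishes in every tangent direction xi. *)
Definition critical Q (A : R -> plane R -> plane R) (f : plane R -> R)
    : set (R -> plane R) :=
  [set z | exists s : bool,
     punctured_twisted_loop s (csqr @^-1` Q) z /\
     forall xi, twisted_loop s [set: plane R] xi ->
       is_derive (0 : R) 1
         (fun eps : R => action A f (fun tau => z tau + eps *: xi tau))
         (0 : R)].

(* The critical points in the quotient of the punctured loop space by
   z ~ - z, whose elements are the classes [sign_class z]. *)
Definition CritB Q A f : set (set (R -> plane R)) :=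
  sign_class @` critical Q A f.

(* Maps defined on the circle R/Z are 1-periodic maps on R.  A W^{1,2} loop is
   the primitive of a square-integrable v, its weak derivative; it is
   absolutely continuous, and v is its pointwise derivative almost
   everywhere. *)
Definition W12_loop Q : set (R -> plane R) :=
  [set q | [/\ periodic q 1, (forall t, Q (q t)) &
    exists v, [/\ periodic v 1,
      measurable_fun [set: R] (fun t => (v t).1) /\
      measurable_fun [set: R] (fun t => (v t).2),
      mu.-integrable `[0, 1] (EFin \o (fun t => enorm (v t) ^+ 2)) &
      forall a b : R, a <= b ->
        q b - q a = (\int[mu]_(t in `[a, b]) (v t).1,
                     \int[mu]_(t in `[a, b]) (v t).2)]]].

(* The identities for e and beta involve the derivatives of q and q/|q|, which
   are merely weak derivatives a priori, hence the "almost everywhere". *)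
Definition collision_loop Q : set (R -> plane R) :=
  [set q | [/\ W12_loop Q q,
    finite_set (`[0, 1[%classic `&` q @^-1` [set 0]) &
    exists (alpha : R -> plane R) (e : R -> R) (beta : R -> plane R),
      [/\ [/\ continuous alpha, continuous e & continuous beta],
          [/\ periodic alpha 1, periodic e 1 & periodic beta 1],
          (forall t, enorm (alpha t) = 1) /\
          (forall t, q t = 0 -> beta t = 0),
          (forall t, q t != 0 -> alpha t = (enorm (q t))^-1 *: q t) &
          {ae mu, forall t, q t != 0 ->
             [/\ derivable q t 1, derivable alpha t 1,
                 e t = 2^-1 * enorm (q^`()%classic t) ^+ 2 - (enorm (q t))^-1 &
                 beta t = enorm (q t) *: alpha^`()%classic t]}]]].

Definition CollS Q (A : R -> plane R -> plane R) : set (R -> plane R) :=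
  [set q | collision_loop Q q /\
    forall t, q t != 0 ->
      [/\ derivable q t 1, derivable q^`() t 1 &
          q^`()^`() t = - magnetic A t (q t) *: imul (q^`()%classic t)
                        - dotA A t (q t) - (enorm (q t) ^+ 3)^-1 *: q t]].

End loops.

(* Main.v *)
(* Write r = |z|^2, n = ||z||^2, t = t_z (so t' = r / n), a = \dot A_t(z^2) and
   B = B_t(z^2).  The first variation of the action shows that z is critical if
   and only if there is a periodic function e, the energy, such that
     2 n^2 z'' = e z - 2 n r B i z' - r conj(z) a,
     2 n^2 |z'|^2 - 1 = e r,    e' = - 2 <a, z z'>.
   The second equation follows from the first one by integration, and forces
   the periodicity of e; it also shows that the zeros of z are simple.  Hence,
   at a collision, q = z^2 o t^-1 has the continuous direction z / conj(z), and
   q is a collision orbit with velocity 2 n z' / conj(z).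

   Injectivity: t^-1 has derivative n / |q|, so q determines n and t, hence also
   z^2, z z' and z'^2.  As (z, z') never vanishes, z is determined up to a
   constant sign.

   Surjectivity: let w = <q, q'> and L = q x q'.  Then w^2 + L^2 =
   2 e |q|^2 + 2 |q|, and w' - 1 / |q| extends continuously to the collisions.
   So 1 / |q| has a continuous primitive, a multiple of which is the inverse of
   t.  In the time s of z, with g = L / |q| and
   k = (2 e r + 2 - L g) / (4 n^2), the functions r, w, k and the direction
   alpha = q / |q| are of class C^1, even at the collisions, and
   4 n^2 k r = w^2.  Therefore (r - k) + i w / n is a nowhere vanishing C^1
   curve; its square root zeta + i xi satisfies zeta^2 = r and zeta' = xi, and
   z = zeta sqrt(alpha) is the required solution. *)

Require Import Defs.
From HB Require Import structures.
From mathcomp Require Import all_boot all_order all_algebra.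
From mathcomp Require Import all_classical all_reals all_analysis.
From mathcomp Require Import measurable_realfun.
From mathcomp Require Import ring lra.

Set Implicit Arguments.
Unset Strict Implicit.
Unset Printing Implicit Defensive.

Import Order.TTheory GRing.Theory Num.Theory.
Import numFieldNormedType.Exports.

Local Open Scope ring_scope.
Local Open Scope classical_set_scope.

(** The obstacle is that the velocity of q blows up at a collision and that no identity can be
    divided by |z|^2 there. Collisions are isolated, however: a derivative is computed off them, and
    the formula crosses them if the function and the claimed derivative are continuous. The curve (r
    - k) + i w / n is what (zeta + i zeta')^2 has to be: zeta^2 = r gives 2 zeta zeta' = r' = w / n,
    so k must be w^2 / (4 n^2 r), and the energy identity cancels the factor r. The modulus of the
    curve is r + k, with k = 1 / (2 n^2) at a collision; this is why a square root exists although
    sqrt r has a corner there. The sign of z under translation by 1 is not arranged: z and its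
    translate have the same square, so the injectivity argument applies to them. In the first
    variation the nonlocal time produces a double integral; exchanging the order of integration
    brings in the primitive of <a, z z'>, which is the energy up to a factor and a constant. Its
    periodicity is not yet known, so the equation first holds on [0, 1] only; the energy identity
    and, if z(0) = 0, one more derivative of the equation then give the periodicity. *)

(* A plain definition, so that unification never triggers the instance search
   attached to the class [is_derive]. *)
Definition HD {R : realType} (f : R -> R) (t d : R) : Prop := is_derive t 1 f d.
Arguments HD : clear scopes.

(** * Calculus of real functions *)

Section derivatives.
Context {R : realType}.
Implicit Types (f g : R -> R) (t d : R).

Lemma HDeq f t d d' : HD f t d -> d = d' -> HD f t d'.
Proof. by move=> h <-. Qed.

Lemma HDc c t : HD (fun _ : R => c) t 0.
Proof. exact: is_derive_cst. Qed.

Lemma HDid t : HD (fun s : R => s) t 1.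
Proof. exact: is_derive_id. Qed.

Lemma HDD f g t df dg : HD f t df -> HD g t dg ->
  HD (fun s => f s + g s) t (df + dg).
Proof. by move=> hf hg; exact: is_deriveD. Qed.

Lemma HDN f t df : HD f t df -> HD (fun s => - f s) t (- df).
Proof. by move=> hf; exact: is_deriveN. Qed.

Lemma HDM f g t df dg : HD f t df -> HD g t dg ->
  HD (fun s => f s * g s) t (df * g t + f t * dg).
Proof.
move=> hf hg; change (HD (f * g) t (df * g t + f t * dg)).
apply: (is_derive_eq (is_deriveM hf hg)).
by rewrite /GRing.scale /= addrC mulrC (mulrC _ dg) (mulrC dg).
Qed.

Lemma HDV f t df : f t != 0 -> HD f t df ->
  HD (fun s => (f s)^-1) t (- df / f t ^+ 2).
Proof.
move=> f0 hf; apply: (HDeq (is_deriveV f0 hf)).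
by rewrite /GRing.scale /= mulNr mulrC -mulNr.
Qed.

Lemma HDX f n t df : HD f t df ->
  HD (fun s => f s ^+ n.+1) t (n.+1%:R * f t ^+ n * df).
Proof.
move=> hf; have -> : (fun s => f s ^+ n.+1) = f ^+ n.+1.
  by rewrite exprfctE.
exact: is_deriveX.
Qed.

Lemma HDcomp f g t df dg : HD f (g t) df -> HD g t dg ->
  HD (fun s => f (g s)) t (df * dg).
Proof. by move=> hf hg; exact: is_derive1_comp. Qed.

Lemma HD_val f t d : HD f t d -> f^`() t = d.
Proof. by move=> h; rewrite derive1E; exact: (@derive_val _ _ _ _ _ _ _ h). Qed.

Lemma HD_ex f t d : HD f t d -> derivable f t 1.
Proof. by move=> h; exact: (@ex_derive _ _ _ _ _ _ _ h). Qed.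

Lemma HD_derive1 f t : derivable f t 1 -> HD f t (f^`() t).
Proof. by move=> h; rewrite derive1E; exact/derivableP. Qed.

Lemma HD_cont f t d : HD f t d -> {for t, continuous f}.
Proof.
by move=> /HD_ex/derivable1_diffP/differentiable_continuous.
Qed.

Lemma HD_continuous f g : (forall t, HD f t (g t)) -> continuous f.
Proof. by move=> h t; exact: HD_cont (h t). Qed.

Lemma HD_uniq f t d d' : HD f t d -> HD f t d' -> d = d'.
Proof. by move=> /HD_val <- /HD_val <-. Qed.

Lemma HD_near f g t d : (\near t, f t = g t) -> HD f t d -> HD g t d.
Proof. by move=> fg hf; exact: near_eq_is_derive fg hf. Qed.

Lemma HD_sqrt f t d : 0 < f t -> HD f t d ->
  HD (fun s => Num.sqrt (f s)) t (d / (2 * Num.sqrt (f t))).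
Proof.
move=> f0 hf; apply: HDeq.
  exact: (HDcomp (is_derive1_sqrt f0) hf).
by rewrite mulrC.
Qed.

Lemma HD_sin f t d : HD f t d -> HD (fun s => sin (f s)) t (cos (f t) * d).
Proof. by move=> hf; exact: (HDcomp (is_derive_sin _) hf). Qed.

Lemma HD_cos f t d : HD f t d -> HD (fun s => cos (f s)) t (- sin (f t) * d).
Proof. by move=> hf; exact: (HDcomp (is_derive_cos _) hf). Qed.

Lemma HD_exp f t d : HD f t d -> HD (fun s => expR (f s)) t (expR (f t) * d).
Proof. by move=> hf; exact: (HDcomp (is_derive_expR _) hf). Qed.

End derivatives.

Ltac der_leaf g :=
  first [ match goal with
          | H : forall _, HD ?f _ _ |- _ => constr_eq f g; eapply H
          | H : HD ?f _ _ |- _ => constr_eq f g; eapply H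
          end
        | eassumption ].
Ltac der_step :=
  lazymatch goal with
  | |- HD (fun _ => ?c) _ _ => eapply HDc
  | |- HD (fun s => s) _ _ => eapply HDid
  | |- HD (fun s => @?f s + @?g s) _ _ => eapply (@HDD _ f g)
  | |- HD (fun s => - @?f s) _ _ => eapply (@HDN _ f)
  | |- HD (fun s => @?f s * @?g s) _ _ => eapply (@HDM _ f g)
  | |- HD (fun s => @?f s ^+ 2) _ _ => eapply (@HDX _ f 1)
  | |- HD (fun s => @?f s ^+ 3) _ _ => eapply (@HDX _ f 2)
  | |- HD (fun s => (@?f s)^-1) _ _ => eapply (@HDV _ f)
  | |- HD (fun s => Num.sqrt (@?f s)) _ _ => eapply (@HD_sqrt _ f)
  | |- HD (fun s => sin (@?f s)) _ _ => eapply (@HD_sin _ f)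
  | |- HD (fun s => cos (@?f s)) _ _ => eapply (@HD_cos _ f)
  | |- HD (fun s => expR (@?f s)) _ _ => eapply (@HD_exp _ f)
  | |- HD (fun s => ?g s) _ _ => der_leaf g
  | |- HD ?g _ _ => der_leaf g
  end.
(** The side conditions of inverses and square roots come first; the equality of the computed with
    the claimed derivative comes last. *)
Ltac der := eapply HDeq; [ repeat der_step | cbv beta ].

Section realcalc.
Context {R : realType}.
Implicit Types (f g : R -> R) (s t d : R).

Lemma sqrD_eq0 (a b : R) : a ^+ 2 + b ^+ 2 = 0 -> a = 0 /\ b = 0.
Proof. by move/eqP; rewrite paddr_eq0 ?sqr_ge0// !sqrf_eq0 => /andP[/eqP -> /eqP ->]. Qed.

Lemma nearRP t (P : R -> Prop) :
  (\forall s \near t, P s) <->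
  exists2 d : R, 0 < d & forall s, `|s - t| < d -> P s.
Proof.
split.
  move/nbhs_ballP => [d /= d0 h]; exists d => // s st; apply: h.
  by rewrite /ball /= distrC.
move=> [d d0 h]; apply/nbhs_ballP; exists d => //= s.
by rewrite /ball /= distrC; exact: h.
Qed.

Lemma ctP f t : {for t, continuous f} <->
  forall e : R, 0 < e -> exists2 d : R, 0 < d & forall s, `|s - t| < d -> `|f s - f t| < e.
Proof.
split.
  move=> /cvgrPdist_lt h e /h /nearRP [d d0 hd]; exists d => // s /hd.
  by rewrite distrC.
move=> h; apply/cvgrPdist_lt => e /h [d d0 hd]; apply/nearRP; exists d => //.
by move=> s /hd; rewrite distrC.
Qed.

Lemma near_neq0 f t : {for t, continuous f} -> f t != 0 -> \forall s \near t, f s != 0.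
Proof. by move=> cf ft; apply: (cf [set y | y != 0]); exact: open_nbhs_nbhs (conj (@open_neq _ 0) ft). Qed.

(** Continuous induction: the supremum of the right ends reached from [a] is overtaken by a short
    interval around it. It stands in for the compactness of [a, b] in the proofs about isolated
    collisions, integrability and uniform neighbourhoods. *)
Lemma cousin (P : R -> R -> Prop) :
  (forall a b c, a <= b -> b <= c -> P a b -> P b c -> P a c) ->
  (forall t, exists2 d : R, 0 < d &
     forall a b, a <= t -> t <= b -> b - a < d -> P a b) ->
  forall a b, a <= b -> P a b.
Proof.
move=> cat loc a b ab.
pose S := [set x | (a <= x /\ x <= b) /\ P a x].
have Sa : S a.
  by split => //; have [d d0] := loc a; apply => //; rewrite subrr.
have hS : has_sup S.
  by split; [exists a | exists b => x [[]]].
set c := sup S.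
have ac : a <= c by apply: sup_upper_bound.
have cb : c <= b by apply: ge_sup; [exists a|move=> x [[]]].
have [d d0 hd] := loc c.
have d20 : 0 < d / 2 by lra.
have [x [[ax xb] Pax] cx] := sup_adherent d20 hS.
have xc : x <= c by apply: sup_upper_bound.
(* The point [x] is within d / 2 of [c], so an interval from [x] to at most c + d / 3 is shorter
   than [d]. *)
have [h|h] := leP b (c + d / 3).
  apply: (cat a x b) => //; apply: hd => //.
  by rewrite -/c in cx *; lra.
have : S (c + d / 3).
  split; first by lra.
  apply: (cat a x) => //; first by lra.
  by apply: hd => //; rewrite -/c in cx *; lra.
move=> /(sup_upper_bound hS); rewrite -/c => ?; lra.
Qed.

Lemma mvt_oo f g a b : a < b -> (forall s, a <= s <= b -> {for s, continuous f}) ->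
  (forall s, a < s < b -> HD f s (g s)) ->
  exists2 c, a < c < b & f b - f a = g c * (b - a).
Proof.
move=> ab hc hd.
have h1 s : s \in `]a, b[%R -> HD f s (g s) by rewrite in_itv /=; exact: hd.
have h2 : {within `[a, b], continuous f}.
  by apply: continuous_in_subspaceT => s; rewrite inE /= in_itv /=; exact: hc.
have [c cab E] := MVT ab h1 h2.
by exists c => //; move: cab; rewrite in_itv.
Qed.

Lemma mvt f g a b :
  (forall s, Num.min a b <= s <= Num.max a b -> {for s, continuous f}) ->
  (forall s, Num.min a b < s < Num.max a b -> HD f s (g s)) ->
  exists2 c : R, Num.min a b <= c <= Num.max a b & f b - f a = g c * (b - a).
Proof.
have [ab|ba|->] := ltgtP a b => hc hd.
- have [c /andP[c1 c2] ->] := mvt_oo ab hc hd.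
  by exists c => //; rewrite !ltW.
- have [c /andP[c1 c2] E] := mvt_oo ba hc hd.
  exists c; first by rewrite !ltW.
  by rewrite -opprB E; ring.
- by exists b; rewrite ?lexx// !subrr mulr0.
Qed.

Lemma mvtT f g a b : (forall s, HD f s (g s)) ->
  exists2 c : R, Num.min a b <= c <= Num.max a b & f b - f a = g c * (b - a).
Proof. by move=> h; apply: mvt => s _ //; apply: HD_cont (h s). Qed.

Lemma HDP f t l :
  (forall e : R, 0 < e -> exists2 d : R, 0 < d & forall s, s != t -> `|s - t| < d ->
    `|(f s - f t) / (s - t) - l| <= e) -> HD f t l.
Proof.
move=> h; apply/is_derive1_caratheodory.
exists (fun s => if s == t then l else (f s - f t) / (s - t)); split.
- move=> z; have [->|zt] := eqVneq z t; first by rewrite !subrr mulr0.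
  by rewrite mulfVK// subr_eq0.
- apply/ctP => e e0; rewrite eqxx.
  have e20 : 0 < e / 2 by lra.
  have [d d0 hd] := h _ e20; exists d => // s sd.
  case: ifPn => [_|st]; first by rewrite subrr normr0.
  by have := hd s st sd; lra.
- by rewrite eqxx.
Qed.

(** The difference quotient at [t] is a value of [g] at an intermediate point. This carries the
    derivative formulas of the regularization across the collisions. *)
Lemma HD_lim f g t :
  (exists2 d : R, 0 < d & forall s, s != t -> `|s - t| < d -> HD f s (g s)) ->
  {for t, continuous f} -> {for t, continuous g} -> HD f t (g t).
Proof.
move=> [d d0 hd] cf cg; apply: HDP => e e0.
have [d' d'0 hg] := (ctP g t).1 cg e e0.
exists (Num.min d d'); first by rewrite lt_min d0.
move=> s st; rewrite lt_min => /andP[sd sd'].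
have [|u|c cst E] := @mvt f g t s.
- move=> u hu; have [->//|ut] := eqVneq u t.
  apply: HD_cont (hd u ut _).
  apply: le_lt_trans sd; move: hu; have [ts|st'] := leP t s => /andP[h1 h2].
    by rewrite !ger0_norm; lra.
  by rewrite !ler0_norm; lra.
- move=> hu; apply: hd.
    apply/eqP => ut; move: hu; rewrite ut.
    by have [ts|st'] := leP t s; rewrite ltxx ?andbF.
  apply: lt_trans sd; move: hu; have [ts|st'] := leP t s => /andP[h1 h2].
    by rewrite !ger0_norm; lra.
  by rewrite !ler0_norm; lra.
rewrite E mulfK ?subr_eq0//; apply/ltW/hg.
apply: le_lt_trans sd'; move: cst; have [ts|st'] := leP t s => /andP[h1 h2].
  by rewrite !ger0_norm; lra.
by rewrite !ler0_norm; lra.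
Qed.

End realcalc.

(** * Functions of class C^n on the line *)

Section smoothcurves.
Context {R : realType}.
Implicit Types (f g : R -> R) (s t d : R).

(** Recursion through the first derivative is the form in which a differential equation raises the
    order by one. *)
Fixpoint ck (n : nat) f : Prop :=
  if n is n'.+1 then (forall t, derivable f t 1) /\ ck n' f^`()%classic else continuous f.

Lemma ckS n f g : (forall t, HD f t (g t)) -> ck n g -> ck n.+1 f.
Proof.
move=> h cg; split; first by move=> t; apply: HD_ex (h t).
by have -> : f^`()%classic = g by apply/funext => t; exact: HD_val.
Qed.

Lemma ck_cont n f : ck n f -> continuous f.
Proof.
case: n => [//|n] [h _] t; exact: HD_cont (HD_derive1 (h t)).
Qed.

Lemma ckW n f : ck n.+1 f -> ck n f.
Proof.
elim: n f => [f|n IH f]; first exact: ck_cont.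
by move=> [h1 h2]; split=> //; apply: IH.
Qed.

Lemma ckS_HD n f : ck n.+1 f -> forall t, HD f t (f^`()%classic t).
Proof. by move=> [h _] t; exact: HD_derive1. Qed.

Lemma ckc n (c : R) : ck n (fun=> c).
Proof.
elim: n c => [c t|n IH c]; first exact: cvg_cst.
by apply: (@ckS _ _ (fun=> 0)) => // t; exact: HDc.
Qed.

Lemma ckid n : ck n (fun t : R => t).
Proof.
case: n => [t|n]; first exact: cvg_id.
by apply: (@ckS _ _ (fun=> 1)) => [t|]; [exact: HDid|exact: ckc].
Qed.

Lemma ckD n f g : ck n f -> ck n g -> ck n (fun t => f t + g t).
Proof.
elim: n f g => [f g cf cg t|n IH f g cf cg].
  by apply: cvgD; [exact: cf|exact: cg].
apply: (@ckS _ _ (fun t => f^`()%classic t + g^`()%classic t)); last first.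
  by apply: IH; [exact: cf.2|exact: cg.2].
by move=> t; exact: HDD (ckS_HD cf t) (ckS_HD cg t).
Qed.

Lemma ckM n f g : ck n f -> ck n g -> ck n (fun t => f t * g t).
Proof.
elim: n f g => [f g cf cg t|n IH f g cf cg].
  by apply: cvgM; [exact: cf|exact: cg].
apply: (@ckS _ _ (fun t => f^`()%classic t * g t + f t * g^`()%classic t)).
  by move=> t; exact: HDM (ckS_HD cf t) (ckS_HD cg t).
by apply: ckD; apply: IH; [exact: cf.2|exact: ckW|exact: ckW|exact: cg.2].
Qed.

Lemma ckN n f : ck n f -> ck n (fun t => - f t).
Proof.
move=> cf; have -> : (fun t => - f t) = (fun t => -1 * f t).
  by apply/funext => t; rewrite mulN1r.
by apply: ckM => //; exact: ckc.
Qed.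

Lemma ckX n k f : ck n f -> ck n (fun t => f t ^+ k).
Proof.
move=> cf; elim: k => [|k IH]; first exact: (ckc n 1).
have -> : (fun t => f t ^+ k.+1) = (fun t => f t * f t ^+ k).
  by apply/funext => t; rewrite exprS.
exact: ckM.
Qed.

Lemma ckcomp n f g : ck n f -> ck n g -> ck n (fun t => f (g t)).
Proof.
elim: n f g => [f g cf cg t|n IH f g cf cg].
  by apply: continuous_comp; [exact: cg|exact: cf].
apply: (@ckS _ _ (fun t => f^`()%classic (g t) * g^`()%classic t)).
  by move=> t; exact: HDcomp (ckS_HD cf (g t)) (ckS_HD cg t).
by apply: ckM; [apply: IH; [exact: cf.2|exact: ckW]|exact: cg.2].
Qed.

Definition smooth f := forall n t, derivable f^`(n) t 1.

Lemma ck_smooth f : (forall n, ck n f) -> smooth f.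
Proof.
move=> h n; elim: n f h => [|n IH] f h t; first exact: (h 1%N).1.
by rewrite derive1Sn; apply: IH => m; exact: (h m.+1).2.
Qed.

Lemma smooth_HD f : smooth f -> forall t, HD f t (f^`()%classic t).
Proof. by move=> h t; apply: HD_derive1; exact: (h 0%N). Qed.

Lemma smooth_derive1 f : smooth f -> smooth f^`()%classic.
Proof. by move=> h n t; rewrite -derive1Sn; exact: h. Qed.

Lemma smooth_cont f : smooth f -> continuous f.
Proof. by move=> h t; apply: HD_cont (smooth_HD h t). Qed.

End smoothcurves.

(** * Rules for continuity at a point *)

Section continuity.
Context {R : realType} {X : topologicalType}.
Implicit Types (f g : X -> R) (p : X).

Lemma ctc (c : R) p : {for p, continuous (fun=> c)}.
Proof. exact: cvg_cst. Qed.

Lemma ctD f g p : {for p, continuous f} -> {for p, continuous g} ->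
  {for p, continuous (fun x => f x + g x)}.
Proof. by move=> hf hg; exact: cvgD. Qed.

Lemma ctM f g p : {for p, continuous f} -> {for p, continuous g} ->
  {for p, continuous (fun x => f x * g x)}.
Proof. by move=> hf hg; exact: cvgM. Qed.

Lemma ctN f p : {for p, continuous f} -> {for p, continuous (fun x => - f x)}.
Proof. by move=> hf; exact: cvgN. Qed.

Lemma ctV f p : f p != 0 -> {for p, continuous f} ->
  {for p, continuous (fun x => (f x)^-1)}.
Proof. by move=> f0 hf; exact: cvgV. Qed.

Lemma ctX k f p : {for p, continuous f} -> {for p, continuous (fun x => f x ^+ k)}.
Proof.
move=> hf; elim: k => [|k IH]; first exact: (@ctc 1 p).
have -> : (fun x => f x ^+ k.+1) = (fun x => f x * f x ^+ k).
  by apply/funext => t; rewrite exprS.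
exact: ctM.
Qed.

Lemma ctcomp {Y : topologicalType} (g : X -> Y) (f : Y -> R) p :
  {for p, continuous g} -> {for g p, continuous f} ->
  {for p, continuous (fun x => f (g x))}.
Proof. by move=> hg hf; apply: continuous_comp. Qed.

Lemma ctpair {Y Z : topologicalType} (f : X -> Y) (g : X -> Z) p :
  {for p, continuous f} -> {for p, continuous g} ->
  {for p, continuous (fun x => (f x, g x))}.
Proof. by move=> hf hg; exact: cvg_pair. Qed.

Lemma ct_near f g p : (\near p, f p = g p) -> {for p, continuous f} ->
  {for p, continuous g}.
Proof.
move=> fg; rewrite /prop_for /continuous_at -(nbhs_singleton fg).
by apply: cvg_trans; apply: near_eq_cvg.
Qed.

Lemma ctsqrt f p : {for p, continuous f} ->
  {for p, continuous (fun x => Num.sqrt (f x))}.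
Proof. by move=> hf; apply: (ctcomp hf); exact: sqrt_continuous. Qed.

End continuity.

Ltac ck_step :=
  lazymatch goal with
  | |- ck _ (fun _ => ?c) => exact: ckc
  | |- ck _ (fun s => s) => exact: ckid
  | |- ck _ (fun s => @?f s + @?g s) => refine (@ckD _ _ f g _ _)
  | |- ck _ (fun s => - @?f s) => refine (@ckN _ _ f _)
  | |- ck _ (fun s => @?f s * @?g s) => refine (@ckM _ _ f g _ _)
  | |- ck _ (fun s => @?f s ^+ ?n) => refine (@ckX _ _ n f _)
  | |- ck _ (fun s => ?g s) =>
      match goal with H : ck _ ?f |- _ => constr_eq f g; exact H end
  | |- ck _ _ => eassumption
  end.
Ltac ckt := repeat ck_step.

(* Hypotheses are selected syntactically: testing convertibility would unfold
   integrals and limits. *)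
Ltac ct_leaf g :=
  first [ match goal with
          | H : continuous ?f |- _ => constr_eq f g; refine (H _)
          | H : forall _, {for _, continuous ?f} |- _ => constr_eq f g; refine (H _)
          | H : {for _, continuous ?f} |- _ => constr_eq f g; exact H
          end
        | eassumption ].
Ltac ct_step :=
  lazymatch goal with
  | |- {for _, continuous (fun _ => ?c)} => refine (@ctc _ _ c _)
  | |- {for _, continuous (fun s => s)} => exact: cvg_id
  | |- {for _, continuous (fun s => @?f s + @?g s)} => refine (@ctD _ _ f g _ _ _)
  | |- {for _, continuous (fun s => - @?f s)} => refine (@ctN _ _ f _ _)
  | |- {for _, continuous (fun s => @?f s * @?g s)} => refine (@ctM _ _ f g _ _ _)
  | |- {for _, continuous (fun s => @?f s ^+ ?n)} => refine (@ctX _ _ n f _ _)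
  | |- {for _, continuous (fun s => (@?f s)^-1)} => refine (@ctV _ _ f _ _ _)
  | |- {for _, continuous (fun s => Num.sqrt (@?f s))} => refine (@ctsqrt _ _ f _ _)
  | |- {for _, continuous (fun s => ?g s)} => ct_leaf g
  | |- {for _, continuous ?g} => ct_leaf g
  end.
Ltac ct :=
  try lazymatch goal with
      | |- continuous_at ?p ?f => change {for p, continuous f}
      end; repeat ct_step.

(** * Integrals and primitives *)

Section integrals.
Context {R : realType}.
Notation mu := (@lebesgue_measure R).
Implicit Types (f g : R -> R) (s t d : R).

Definition locint f := forall a b : R, mu.-integrable `[a, b] (EFin \o f).

Lemma cont_locint f : continuous f -> locint f.
Proof.
move=> cf a b; apply: continuous_compact_integrable; first exact: segment_compact.
exact: continuous_subspaceT.
Qed.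

Lemma itv_integrable f (x y : R) (b0 b1 : bool) : locint f ->
  mu.-integrable [set` Interval (BSide b0 x) (BSide b1 y)] (EFin \o f).
Proof.
move=> lf; apply: integrableS (lf x y) => //.
by case: b0 b1 => [] []; apply: subset_itv; rewrite ?bnd_simp.
Qed.

Lemma Rint_cat f (a b c : R) : locint f -> a <= b -> b <= c ->
  \int[mu]_(x in `[a, c]) f x =
  \int[mu]_(x in `[a, b]) f x + \int[mu]_(x in `[b, c]) f x.
Proof.
move=> lf ab bc.
rewrite -(@Rintegral_itv_obnd_cbnd _ b); last exact: itv_integrable.
rewrite -(@Rintegral_itvB _ f (BLeft a) (BRight c) b) ?bnd_simp//.
by rewrite addrC subrK.
Qed.

Lemma oint_sub f (a b : R) : locint f ->
  oriented_int 0 b f - oriented_int 0 a f = oriented_int a b f.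
Proof.
move=> lf; rewrite /oriented_int.
have [a0|a0] := leP 0 a; have [b0|b0] := leP 0 b; have [ab|ab] := leP a b;
  try lra.
- by rewrite (Rint_cat lf a0 ab); ring.
- by rewrite (Rint_cat lf b0 (ltW ab)); ring.
- by rewrite (Rint_cat lf (ltW b0) a0); ring.
- by rewrite (Rint_cat lf (ltW a0) b0); ring.
- by rewrite (Rint_cat lf ab (ltW b0)); ring.
- by rewrite (Rint_cat lf (ltW ab) (ltW a0)); ring.
Qed.

Lemma oint_le f (a b : R) : a <= b -> oriented_int a b f = \int[mu]_(x in `[a, b]) f x.
Proof. by rewrite /oriented_int => ->. Qed.

Lemma oint0 f : oriented_int 0 0 f = 0.
Proof. by rewrite oint_le// set_itv1 Rintegral_set1. Qed.

Lemma oint_HD f t : locint f -> {for t, continuous f} ->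
  HD (fun s => oriented_int 0 s f) t (f t).
Proof.
move=> lf cf.
have h : HD (fun s => \int[mu]_(x in `[t - 1, s]) f x) t (f t).
  have t1 : t < t + 1 by lra.
  have t2 : t - 1 < t by lra.
  have [d1 <-] := continuous_FTC1_closed t1 (lf _ _) t2 cf.
  exact: HD_derive1.
apply: (@HD_near _ (fun s => (fun s => \int[mu]_(x in `[t - 1, s]) f x) s
    + oriented_int 0 (t - 1) f)).
  apply/nearRP; exists 1 => // s; rewrite ltr_distl => /andP[s1 s2].
  by rewrite -oint_le; [rewrite -oint_sub//; ring|lra].
apply: HDeq; first exact: HDD h (HDc _ _).
by rewrite addr0.
Qed.

Lemma oint_cont f : locint f -> continuous (fun s => oriented_int 0 s f).
Proof.
move=> lf t.
have h : {for t, continuous (fun s => \int[mu]_(x in `[t - 1, s]) f x)}.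
  have ab : t - 1 <= t + 1 by lra.
  have /continuous_within_itvP := @parameterized_integral_continuous R (t - 1) (t + 1) f ab (lf _ _).
  move=> h; have /h [+ _ _] : t - 1 < t + 1 by lra.
  by apply; rewrite in_itv /=; lra.
apply: (@ct_near _ _ (fun s => (fun s => \int[mu]_(x in `[t - 1, s]) f x) s
    + oriented_int 0 (t - 1) f)).
  apply/nearRP; exists 1 => // s; rewrite ltr_distl => /andP[s1 s2].
  by rewrite -oint_le; [rewrite -oint_sub//; ring|lra].
by ct.
Qed.

Lemma HD0_const f a b : (forall s, HD f s 0) -> f a = f b.
Proof. by move=> h; apply: is_derive_0_is_cst => x; exact: h. Qed.

Lemma oint_FTC f F (a b : R) : continuous f -> (forall s, HD F s (f s)) ->
  oriented_int a b f = F b - F a.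
Proof.
move=> cf h; have lf := cont_locint cf.
rewrite -oint_sub//.
have := @HD0_const (fun s => oriented_int 0 s f - F s) a b.
move=> E; apply/eqP; rewrite subr_eq -subr_eq0; apply/eqP.
suff : oriented_int 0 a f - F a = oriented_int 0 b f - F b by move=> ?; lra.
apply: E => s; apply: HDeq; first exact: HDD (oint_HD lf (cf s)) (HDN (h s)).
by rewrite subrr.
Qed.

Lemma Rint_ext f g (a b : R) : (forall s, a <= s <= b -> f s = g s) ->
  \int[mu]_(x in `[a, b]) f x = \int[mu]_(x in `[a, b]) g x.
Proof.
by move=> h; apply: eq_Rintegral => s; rewrite inE /= in_itv /=; exact: h.
Qed.

Lemma oint_ext f g (a b : R) : (forall s, f s = g s) ->
  oriented_int a b f = oriented_int a b g.
Proof. by move=> /funext ->. Qed.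

(** A short interval is cut at its exceptional point, which then is an end point and harmless to the
    mean value theorem; [cousin] glues the pieces. *)
Lemma HD0_const_isolated f : continuous f ->
  (forall t, exists2 d : R, 0 < d & forall s, s != t -> `|s - t| < d -> HD f s 0) ->
  forall a b, f a = f b.
Proof.
move=> cf h.
suff key a b : a <= b -> f a = f b.
  by move=> a b; have [/key//|/ltW/key] := leP a b.
apply: (@cousin _ (fun a b => f a = f b)) => [x y z _ _ -> //|t].
have [d d0 hd] := h t; exists d => // x y xt ty yx.
have eq1 (u v : R) : u <= t -> t <= v -> v - u < d -> (u = t \/ v = t) -> f u = f v.
  move=> ut tv uvd uv.
  have [||c _ E] := @mvt _ f (fun=> 0) u v.
  - by move=> s _; exact: cf.
  - move=> s; rewrite min_l ?max_r; try lra.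
    move=> /andP[s1 s2]; apply: hd; first by apply/eqP; lra.
    by rewrite ltr_distl; lra.
  - by lra.
have -> : f x = f t by apply: eq1 => //; [lra|right].
by apply: eq1 => //; [lra|left].
Qed.

(** The same cut as for [HD0_const_isolated]. It serves both time changes: the derivative of one
    vanishes at the collisions, that of its inverse is infinite there. *)
Lemma strict_mono_isolated (F g : R -> R) : continuous F ->
  (forall t, exists2 d : R, 0 < d & forall s, s != t -> `|s - t| < d -> HD F s (g s) /\ 0 < g s) ->
  forall a b, a < b -> F a < F b.
Proof.
move=> cF h.
suff K l l' : l <= l' -> l < l' -> F l < F l'.
  by move=> a b ab; exact: K (ltW ab) ab.
(* The premise a < b admits the degenerate intervals that [cousin] asks for. *)
apply: (@cousin _ (fun a b => a < b -> F a < F b)) => [p q r pq qr h1 h2 pr|t].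
  move: pq qr; rewrite !le_eqVlt => /predU1P[E|pq] /predU1P[E'|qr].
  - by move: pr; rewrite E E' ltxx.
  - by rewrite E; exact: h2.
  - by rewrite -E'; exact: h1.
  - exact: lt_trans (h1 pq) (h2 qr).
have [d d0 hd] := h t; exists d => // a b at' tb ba ab.
have side p q : p < q -> (q <= t \/ t <= p) -> a <= p -> q <= b -> F p < F q.
  move=> pq tpq ap qb.
  have [s /andP[s1 s2]|c /andP[c1 c2] E] := @mvt_oo _ F g p q pq (fun s _ => @cF s) _.
    apply: (hd s _ _).1; first by apply/eqP; case: tpq; lra.
    by rewrite ltr_distl; lra.
  have [_ gc] : HD F c (g c) /\ 0 < g c.
    apply: hd; first by apply/eqP; case: tpq; lra.
    by rewrite ltr_distl; lra.
  by rewrite -subr_gt0 E mulr_gt0// subr_gt0.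
move: at' tb; rewrite !le_eqVlt => /predU1P[E|at'] /predU1P[E'|tb].
- by move: ab; rewrite E E' ltxx.
- by apply: side => //; lra.
- by apply: side => //; lra.
- by apply: lt_trans (side a t _ _ _ _) (side t b _ _ _ _) => //; lra.
Qed.

End integrals.

(** * Integrability near isolated singularities and differentiation under the integral *)

Section domination.
Context {R : realType}.
Notation mu := (@lebesgue_measure R).
Implicit Types (f g h H : R -> R) (s t d : R).

(** A compact exhaustion of ]a, b[; the shift of the index by 3 keeps every member nondegenerate. *)
Let Fn (a b : R) (i : nat) : set R := `[a + (b - a) / i.+3%:R, b - (b - a) / i.+3%:R].

Let Fn_step (a b : R) i : a < b -> 0 < (b - a) / i.+3%:R <= (b - a) / 3.
Proof.
move=> ab; rewrite divr_gt0 ?subr_gt0//= ler_pM2l ?subr_gt0//.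
by rewrite lef_pV2 ?posrE// ler_nat.
Qed.

Let Fn_nd (a b : R) : a < b -> nondecreasing_seq (Fn a b).
Proof.
move=> ab; apply/nondecreasing_seqP => n; rewrite subsetEset => s.
rewrite /Fn /= !in_itv /= => /andP[s1 s2].
have : (b - a) / n.+4%:R <= (b - a) / n.+3%:R.
  by rewrite ler_pM2l ?subr_gt0// lef_pV2 ?posrE// ler_nat.
set u := _ / _ in s1 s2 *; set v := _ / _ => uv.
by apply/andP; split; lra.
Qed.

Let Fn_bigcup (a b : R) : a < b -> \bigcup_i Fn a b i = `]a, b[.
Proof.
move=> ab; apply/seteqP; split => s /=.
  move=> [i _]; rewrite /Fn /= !in_itv /= => /andP[s1 s2].
  have /andP[] := Fn_step i ab; set u := _ / _ in s1 s2 * => u0 u1.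
  by apply/andP; split; lra.
rewrite in_itv /= => /andP[s1 s2].
pose m := Num.min (s - a) (b - s).
have m0 : 0 < m by rewrite lt_min; lra.
pose i := Num.truncn ((b - a) / m).
exists i => //; rewrite /Fn /= in_itv /=.
have : (b - a) / i.+3%:R <= m.
  rewrite ler_pdivrMr// mulrC -ler_pdivrMr//.
  apply: ltW; apply: lt_le_trans (truncnS_gt _) _.
  by rewrite ler_nat; exact: leq_trans (leqnSn _) (leqnSn _).
set u := _ / _; rewrite le_min => /andP[h1 h2].
by apply/andP; split; lra.
Qed.

(** The bound [h] may blow up at the end points, but its primitive [H] is continuous there. On every
    compact subinterval the integral of |f| is at most H b - H a, and monotone convergence
    concludes. *)
Lemma dominated_oo f H h (a b : R) : a < b ->
  measurable_fun [set: R] f ->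
  (forall s, a <= s <= b -> {for s, continuous H}) ->
  (forall s, a < s < b -> [/\ HD H s (h s), {for s, continuous h} & `|f s| <= h s]) ->
  mu.-integrable `[a, b] (EFin \o f).
Proof.
move=> ab mf cH hh.
have mfn : measurable_fun [set: R] (abse \o (EFin \o f)).
  by apply: measurableT_comp => //; exact/measurable_EFinP.
apply/integrableP; split.
  by apply/measurable_EFinP; exact: measurable_funTS.
rewrite integral_itv_bndoo; last exact: measurable_funTS.
apply: (@le_lt_trans _ _ (H b - H a)%:E); last exact: ltry.
rewrite -Fn_bigcup//.
have mF i : measurable (Fn a b i) by exact: measurable_itv.
have cv : (\int[mu]_(x in Fn a b i) `|(EFin \o f) x|)%E @[i --> \oo]
    --> (\int[mu]_(x in \bigcup_i Fn a b i) `|(EFin \o f) x|)%E.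
  apply: ge0_nondecreasing_set_cvg_integral => //; first exact: Fn_nd.
  by move=> i; exact: measurable_funTS.
rewrite -(cvg_lim _ cv)//; apply: lime_le; first by apply/cvg_ex; eexists; exact: cv.
apply: nearW => i; have /andP[] := Fn_step i ab; rewrite /Fn.
set u := _ / i.+3%:R => e0 e1; set a' := a + u; set b' := b - u.
have a'b' : a' < b' by rewrite /a' /b'; lra.
have sub s : a' <= s <= b' -> a < s < b by rewrite /a' /b'; lra.
have ch : {within `[a', b'], continuous h}.
  by apply: continuous_in_subspaceT => s; rewrite inE /= in_itv /= => /sub/hh[].
have E : (\int[mu]_(x in `[a', b']) (h x)%:E = (H b')%:E - (H a')%:E)%E.
  apply: continuous_FTC2 => //.
    split.
    - by move=> s; rewrite in_itv /= => s1; have [|/HD_ex//] := hh s; apply: sub; lra.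
    - by apply: cvg_at_right_filter; apply: cH; rewrite /a'; lra.
    - by apply: cvg_at_left_filter; apply: cH; rewrite /b'; lra.
  move=> s; rewrite in_itv /= => s1.
  by have [|/HD_val->] := hh s; first by apply: sub; lra.
apply: (@le_trans _ _ (\int[mu]_(x in `[a', b']) (h x)%:E)%E).
  apply: ge0_le_integral => //.
  - exact: measurable_funTS.
  - by apply/measurable_EFinP; apply: subspace_continuous_measurable_fun.
  - by move=> s; rewrite /= in_itv /= => /sub/hh[_ _ h0]; rewrite lee_fin.
rewrite E -EFinB lee_fin.
have mono (x y : R) : a <= x -> x <= y -> y <= b -> H x <= H y.
  move=> ax xy yb; have [||c _ E2] := @mvt _ H (fun s => `|h s|) x y.
  - by move=> s; rewrite min_l ?max_r// => s1; apply: cH; lra.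
  - rewrite min_l ?max_r// => s s1.
    have [|h1 _ h2] := hh s; first by lra.
    by rewrite ger0_norm//; apply: le_trans h2.
  - by rewrite -subr_ge0 E2 mulr_ge0// subr_ge0.
have m1 : H a <= H a' by apply: mono; rewrite /a'; lra.
have m2 : H b' <= H b by apply: mono; rewrite /b'; lra.
by lra.
Qed.

(** Every [t] may be a singularity of [f]: short intervals are cut at [t], so that [dominated_oo]
    sees it as an end point. The velocity of a collision orbit is of this kind. *)
Lemma dominated_locint f : measurable_fun [set: R] f ->
  (forall t, exists d, 0 < d /\ exists H h,
     (forall s, `|s - t| < d -> {for s, continuous H}) /\
     (forall s, s != t -> `|s - t| < d ->
        [/\ HD H s (h s), {for s, continuous h} & `|f s| <= h s])) ->
  locint f.
Proof.
move=> mf loc.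
suff key : forall a b : R, a <= b -> mu.-integrable `[a, b] (EFin \o f).
  move=> a b; have [/key//|ba] := leP a b.
  by rewrite set_itv_ge ?bnd_simp -?ltNge//; exact: integrable_set0.
have cat (a b c : R) : a <= b -> b <= c -> mu.-integrable `[a, b] (EFin \o f) ->
    mu.-integrable `[b, c] (EFin \o f) -> mu.-integrable `[a, c] (EFin \o f).
  move=> ab bc /integrableP[_ i1] /integrableP[_ i2].
  have mfn : measurable_fun [set: R] (abse \o (EFin \o f)).
    by apply: measurableT_comp => //; exact/measurable_EFinP.
  apply/integrableP; split.
    by apply/measurable_EFinP; exact: measurable_funTS.
  rewrite /= (@itv_bndbnd_setU _ _ (BLeft a) (BRight b) (BRight c)) ?bnd_simp//.
  rewrite ge0_integral_setU//=.
  - apply: lte_add_pinfty => //.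
    apply: le_lt_trans i2; apply: ge0_subset_integral => //.
      exact: measurable_funTS.
    by apply: subset_itvr; rewrite bnd_simp.
  - exact: measurable_funTS.
  - apply/disj_setPS => y [/=]; rewrite 2!in_itv/= => /andP[_ h1] /andP[h2 _].
    by have := lt_le_trans h2 h1; rewrite ltxx.
apply: (@cousin _ (fun a b => mu.-integrable `[a, b] (EFin \o f))) => [//|t].
have [d [d0 [H [h [cH hh]]]]] := loc t.
exists d => // a b at_ tb ba.
have half (x y : R) : x <= y -> x = t \/ y = t -> y - x < d ->
    mu.-integrable `[x, y] (EFin \o f).
  rewrite le_eqVlt => /predU1P[<- _ _|xy xyt yx].
    rewrite set_itv1; apply/integrableP; split; last by rewrite integral_set1.
    by apply/measurable_EFinP; exact: measurable_funTS.
  apply: (@dominated_oo f H h) => //.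
    by move=> s s1; apply: cH; rewrite ltr_distl; lra.
  by move=> s s1; apply: hh; [apply/eqP; lra|rewrite ltr_distl; lra].
apply: (cat _ t) => //; apply: half => //.
- by right.
- by lra.
- by left.
- by lra.
Qed.

Lemma compact_bound (a b c d : R) (g : R * R -> R) :
  (forall p, a <= p.1 <= b -> c <= p.2 <= d -> {for p, continuous g}) ->
  exists M : R, 0 <= M /\ forall p, a <= p.1 <= b -> c <= p.2 <= d -> `|g p| <= M.
Proof.
move=> cg.
have [[p [h1 h2]]|no] := pselect (exists p : R * R, a <= p.1 <= b /\ c <= p.2 <= d); last first.
  by exists 0; split => // p h1 h2; exfalso; apply: no; exists p.
pose K : set (R * R) := `[a, b] `*` `[c, d].
have K0 : K !=set0 by exists p; split => /=; rewrite in_itv.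
have cK : compact K by apply: compact_setX; exact: segment_compact.
have cgK : {within K, continuous (fun p => `|g p|)}.
  apply: continuous_in_subspaceT => q; rewrite inE => -[/=]; rewrite !in_itv /= => q1 q2.
  by apply: continuous_comp; [exact: cg|exact: norm_continuous].
have [q Kq hq] := compact_EVT_max K0 cK cgK.
exists `|g q|; split => // r r1 r2; apply: hq.
by rewrite inE; split => /=; rewrite in_itv.
Qed.

(** On the compact rectangle |e| <= dl / 2 the continuous derivative is bounded, and the constant
    bound dominates. *)
Lemma diff_int (h h1 : R -> R -> R) (dl : R) : 0 < dl ->
  (forall e s, `|e| < dl -> 0 <= s <= 1 -> HD (h^~ s) e (h1 e s)) ->
  (forall e s, `|e| < dl -> 0 <= s <= 1 -> {for s, continuous (h e)}) ->
  (forall e s, `|e| < dl -> 0 <= s <= 1 ->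
     {for (e, s), continuous (fun p : R * R => h1 p.1 p.2)}) ->
  HD (fun e => \int[mu]_(s in `[0, 1]) h e s) 0 (\int[mu]_(s in `[0, 1]) h1 0 s).
Proof.
move=> dl0 hd hc h1c.
pose g (p : R * R) := h1 p.1 p.2.
have [M [M0 hM]] : exists M : R, 0 <= M /\
    forall p : R * R, - (dl / 2) <= p.1 <= dl / 2 -> 0 <= p.2 <= 1 -> `|g p| <= M.
  apply: compact_bound => -[e s] /= e1 s1; apply: (h1c e s) => //.
  by rewrite ltr_norml; lra.
have e0 : `]- (dl / 2), dl / 2[ (0 : R) by rewrite /= in_itv /=; lra.
have I (e : R) : `]- (dl / 2), dl / 2[ e -> `|e| < dl.
  by rewrite /= in_itv /= ltr_norml; lra.
have mB : measurable (`[0, 1] : set R) by [].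
have i1 (e : R) : `]- (dl / 2), dl / 2[ e -> mu.-integrable `[0, 1] (EFin \o h e).
  move=> /I ie; apply: continuous_compact_integrable; first exact: segment_compact.
  apply: continuous_in_subspaceT => s; rewrite inE /= in_itv /=; exact: hc.
have i2 (e s : R) : `]- (dl / 2), dl / 2[ e -> `[0, 1] s -> derivable (h^~ s) e 1.
  by move=> /I ie; rewrite /= in_itv /= => s1; exact: HD_ex (hd _ _ ie s1).
have i3 (s : R) : 0 <= cst M s by [].
have i4 : mu.-integrable `[0, 1] (EFin \o (cst M : R -> R)).
  by apply: cont_locint => t; exact: cvg_cst.
have i5 (e s : R) : `]- (dl / 2), dl / 2[ e -> `[0, 1] s ->
    `|partial1of2 h e s| <= cst M s.
  move=> /[dup] /I ie ie'; rewrite /= in_itv /= => s1; rewrite /partial1of2.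
  rewrite (HD_val (hd _ _ ie s1)); apply: (hM (e, s)) => //=.
  by move: ie'; rewrite /= in_itv /=; lra.
have D := @derivable_under_integral R _ _ mu h `[0, 1] mB 0 _ _ e0 i1 i2 (cst M) i3 i4 i5.
have V := @differentiation_under_integral R _ _ mu h `[0, 1] mB 0 _ _ e0 i1 i2 (cst M) i3 i4 i5.
apply: HDeq; first exact: HD_derive1 D.
rewrite V; apply: eq_Rintegral => s; rewrite inE /= in_itv /= => s1.
rewrite /partial1of2; apply: HD_val; apply: hd => //.
by rewrite normr0.
Qed.

End domination.

(** * Chain rules for time-dependent fields *)

Section chainrule.
Context {R : realType}.
Implicit Types (f g : R -> R) (s t d : R).

(** A Caratheodory slope in the first variable, while the parameter [y s] moves along. Its
    continuity at [t] comes from the mean value theorem applied at the moving parameter. Such slopes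
    can be added when the variables change one after another. *)
Lemma slope_near {X : topologicalType} (G G1 : R -> X -> R) (a : R -> R) (y : R -> X) t :
  {for t, continuous a} -> {for t, continuous y} ->
  (\forall p \near (a t, y t), HD (fun s => G s p.2) p.1 (G1 p.1 p.2)) ->
  {for (a t, y t), continuous (fun p : R * X => G1 p.1 p.2)} ->
  exists k : R -> R, [/\ {for t, continuous k}, k t = G1 (a t) (y t) &
    forall s, G (a s) (y s) - G (a t) (y s) = k s * (a s - a t)].
Proof.
move=> ca cy hG cG1.
exists (fun s => if a s == a t then G1 (a t) (y t)
  else (G (a s) (y s) - G (a t) (y s)) / (a s - a t)); split; last first.
- move=> s; case: ifPn => [/eqP->|st]; first by rewrite !subrr mulr0.
  by rewrite mulfVK// subr_eq0.
- by rewrite eqxx.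
apply/ctP => e e0; rewrite eqxx.
have /cvgrPdist_lt /(_ _ e0) cG := cG1.
have [[U V] /= [Ua Vy] UV] : nbhs (a t, y t) [set p : R * X |
    HD (fun s => G s p.2) p.1 (G1 p.1 p.2) /\
    `|G1 (a t) (y t) - G1 p.1 p.2| < e].
  by apply: filterI.
have [dU dU0 hU] := (nearRP (a t) _).1 Ua.
have [d1 d10 h1] := (nearRP t _).1 (ca _ Ua).
have [d2 d20 h2] := (nearRP t _).1 (cy _ Vy).
have [d3 d30 h3] := (ctP _ _).1 ca _ dU0.
exists (Num.min d2 d3); first by rewrite lt_min d20.
move=> s; rewrite lt_min => /andP[s2 s3].
case: ifPn => [_|st]; first by rewrite subrr normr0.
have Vs := h2 _ s2; have as3 := h3 _ s3.
have inU c : Num.min (a t) (a s) <= c <= Num.max (a t) (a s) -> U c.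
  move=> hc; apply: hU; apply: le_lt_trans as3; move: hc.
  have [ts|st'] := leP (a t) (a s) => /andP[c1 c2].
    by rewrite !ger0_norm; lra.
  by rewrite !ler0_norm; lra.
have [||c hc ->] := @mvt _ (fun u => G u (y s)) (fun u => G1 u (y s)) (a t) (a s).
- by move=> c /inU Uc; have [|h _] := UV (c, y s); [split|exact: HD_cont h].
- move=> c /andP[c1 c2]; have Uc : U c by apply: inU; rewrite !ltW.
  by have [|h _] := UV (c, y s).
rewrite mulfK ?subr_eq0// distrC.
by have [|_ h] := UV (c, y s); [split => //; exact: inU|].
Qed.

(** The increment is telescoped by moving one variable at a time, and each step has a slope from
    [slope_near]. Continuous partial derivatives are what [Ck_on] supplies. *)
Lemma chain3 (G G1 G2 G3 : R -> R -> R -> R) (a b c : R -> R) t da db dc :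
  HD a t da -> HD b t db -> HD c t dc ->
  (\forall p \near (a t, (b t, c t)),
     [/\ HD (fun s => G s p.2.1 p.2.2) p.1 (G1 p.1 p.2.1 p.2.2),
         HD (fun s => G p.1 s p.2.2) p.2.1 (G2 p.1 p.2.1 p.2.2) &
         HD (fun s => G p.1 p.2.1 s) p.2.2 (G3 p.1 p.2.1 p.2.2)]) ->
  {for (a t, (b t, c t)), continuous (fun p : R * (R * R) => G1 p.1 p.2.1 p.2.2)} ->
  {for (a t, (b t, c t)), continuous (fun p : R * (R * R) => G2 p.1 p.2.1 p.2.2)} ->
  {for (a t, (b t, c t)), continuous (fun p : R * (R * R) => G3 p.1 p.2.1 p.2.2)} ->
  HD (fun s => G (a s) (b s) (c s)) t
     (G1 (a t) (b t) (c t) * da + G2 (a t) (b t) (c t) * db + G3 (a t) (b t) (c t) * dc).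
Proof.
move=> ha hb hc hG c1 c2 c3.
have ca := HD_cont ha; have cb := HD_cont hb; have cc := HD_cont hc.
have [k1 [ck1 k1t k1E]] := @slope_near (R * R)%type (fun u p => G u p.1 p.2)
  (fun u p => G1 u p.1 p.2) a (fun s => (b s, c s)) t ca (ctpair cb cc)
  (filterS (fun p h => let: And3 h1 _ _ := h in h1) hG) c1.
have pull2 : {for (b t, c t), continuous (fun p : R * R => (a t, p))}.
  by apply: ctpair; [exact: cvg_cst|exact: cvg_id].
have pull3 : {for (c t, 0), continuous (fun p : R * R => (a t, (b t, p.1)))}.
  apply: ctpair; first exact: cvg_cst.
  by apply: ctpair; [exact: cvg_cst|exact: cvg_fst].
have h2 : \forall p \near (b t, c t), HD (fun s => G (a t) s p.2) p.1 (G2 (a t) p.1 p.2).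
  apply: (@filterS _ (nbhs (b t, c t)) _ _ _ _ (pull2 _ hG)); by move=> [x y] /= [? ? ?].
have h3 : \forall p \near (c t, 0 : R), HD (fun s => G (a t) (b t) s) p.1 (G3 (a t) (b t) p.1).
  apply: (@filterS _ (nbhs (c t, 0 : R)) _ _ _ _ (pull3 _ hG)); by move=> [x y] /= [? ? ?].
have [k2 [ck2 k2t k2E]] := @slope_near R (fun u v => G (a t) u v)
  (fun u v => G2 (a t) u v) b c t cb cc h2 (ctcomp pull2 c2).
(* When the last variable moves, the other two are frozen at [t]; the parameter is a dummy
   constant. *)
have [k3 [ck3 k3t k3E]] := @slope_near R (fun u v => G (a t) (b t) u)
  (fun u v => G3 (a t) (b t) u) c (fun=> 0) t cc (@ctc R R 0 t) h3 (ctcomp pull3 c3).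
have [ga [gaE cga gat]] := (is_derive1_caratheodory _ _ _).1 ha.
have [gb [gbE cgb gbt]] := (is_derive1_caratheodory _ _ _).1 hb.
have [gc [gcE cgc gct]] := (is_derive1_caratheodory _ _ _).1 hc.
apply/is_derive1_caratheodory.
exists (fun s => k1 s * ga s + k2 s * gb s + k3 s * gc s); split.
- move=> s; have := k1E s; have := k2E s; have := k3E s.
  rewrite gaE gbE gcE /= => e3 e2 e1.
  rewrite !mulrDl -!mulrA -e1 -e2 -e3; ring.
- by ct.
- by rewrite k1t k2t k3t gat gbt gct.
Qed.

End chainrule.

(** * Plane curves and directional derivatives *)

Section planecurves.
Context {R : realType}.
Implicit Types (z : R -> plane R) (s t d : R).

(** The difference quotients along [path] and along the line in direction [v] coincide. This moves
    directional derivatives between a field on space-time and its restrictions to a fixed time or to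
    a coordinate line. *)
Lemma line_derive (V V' : normedModType R) (F : V -> plane R) (p v : V)
    (path : V' -> V) (q w : V') :
  path q = p -> (forall h : R, path (h *: w + q) = h *: v + p) -> derivable F p v ->
  is_derive q w (fun u => (F (path u)).1) ('D_v F p).1 /\
  is_derive q w (fun u => (F (path u)).2) ('D_v F p).2.
Proof.
move=> pq hp /cvg_ex [l hl].
have -> : 'D_v F p = l by apply: cvg_lim.
have comp (pr : plane R -> R) : (forall h a b, pr (h *: (a - b)) = h *: (pr a - pr b)) ->
    pr x @[x --> l] --> pr l -> is_derive q w (fun u => pr (F (path u))) (pr l).
  move=> prl cpr.
  have E : h^-1 *: (((fun u => pr (F (path u))) \o shift q) (h *: w) -
      pr (F (path q))) @[h --> 0^'] --> pr l.
    apply: cvg_trans (cvg_comp _ _ hl cpr); apply: near_eq_cvg; near=> h.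
    by rewrite /= -prl pq hp.
  by split; [apply/cvg_ex; exists (pr l)|apply: cvg_lim].
by split; apply: comp => //; [exact: cvg_fst|exact: cvg_snd].
Unshelve. all: by end_near. Qed.

Lemma line_derive1 (V V' : normedModType R) (F : V -> R) (p v : V)
    (path : V' -> V) (q w : V') :
  path q = p -> (forall h : R, path (h *: w + q) = h *: v + p) -> derivable F p v ->
  is_derive q w (fun u => F (path u)) ('D_v F p).
Proof.
move=> pq hp /cvg_ex [l hl].
have -> : 'D_v F p = l by apply: cvg_lim.
have E : h^-1 *: (((fun u => F (path u)) \o shift q) (h *: w) -
    F (path q)) @[h --> 0^'] --> l.
  by apply: cvg_trans hl; apply: near_eq_cvg; near=> h; rewrite /= pq hp.
by split; [apply/cvg_ex; exists l|apply: cvg_lim].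
Unshelve. all: by end_near. Qed.

Lemma curve_HD z t : derivable z t 1 ->
  HD (fun s => (z s).1) t (z^`()%classic t).1 /\
  HD (fun s => (z s).2) t (z^`()%classic t).2.
Proof.
move=> h; rewrite derive1E; exact: (@line_derive R R z t 1 id t 1).
Qed.

Lemma HD_curve z t d1 d2 : HD (fun s => (z s).1) t d1 -> HD (fun s => (z s).2) t d2 ->
  derivable z t 1 /\ z^`()%classic t = (d1, d2).
Proof.
move=> [h1 e1] [h2 e2]; move: h1 h2 => /cvg_ex [l1 h1] /cvg_ex[l2 h2].
have E1 : l1 = d1 by rewrite -e1; apply/esym/cvg_lim.
have E2 : l2 = d2 by rewrite -e2; apply/esym/cvg_lim.
subst l1 l2.
have E : h^-1 *: ((z \o shift t) (h *: 1) - z t) @[h --> 0^'] --> (d1, d2).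
  apply: cvg_trans (cvg_pair h1 h2); apply: near_eq_cvg; near=> h.
  by rewrite /=; case: (z _) (z t) => [x y] [x' y'].
split; first by apply/cvg_ex; exists (d1, d2).
by rewrite derive1E; apply: cvg_lim.
Unshelve. all: by end_near. Qed.

Lemma curve_smooth z : smooth_curve z ->
  smooth (fun s => (z s).1) /\ smooth (fun s => (z s).2).
Proof.
move=> h.
have E n : z^`(n)%classic = fun t => ((fun s => (z s).1)^`(n)%classic t, (fun s => (z s).2)^`(n)%classic t).
  elim: n => [|n IH]; first by apply/funext => t; rewrite !derive1n0 /= -surjective_pairing.
  apply/funext => t; rewrite !derive1nS.
  have [h1 h2] := curve_HD (h n t).
  have -> : (fun s => (z s).1)^`(n)%classic = fun s => (z^`(n)%classic s).1 by rewrite IH.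
  have -> : (fun s => (z s).2)^`(n)%classic = fun s => (z^`(n)%classic s).2 by rewrite IH.
  by rewrite (HD_val h1) (HD_val h2) -surjective_pairing.
by split=> n t; have [] := curve_HD (h n t); rewrite E /= => h1 h2;
  [exact: HD_ex h1|exact: HD_ex h2].
Qed.

Lemma smooth_curveP z :
  smooth (fun s => (z s).1) -> smooth (fun s => (z s).2) -> smooth_curve z.
Proof.
move=> h1 h2 n t.
have E m : z^`(m)%classic = fun t => ((fun s => (z s).1)^`(m)%classic t, (fun s => (z s).2)^`(m)%classic t).
  elim: m => [|m IH]; first by apply/funext => s; rewrite !derive1n0 /= -surjective_pairing.
  apply/funext => s; rewrite !derive1nS IH.
  by have [_ ->] := HD_curve (z := fun t => (_ t, _ t)) (HD_derive1 (h1 m s)) (HD_derive1 (h2 m s)).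
by have [] := HD_curve (z := fun t => (_ t, _ t)) (HD_derive1 (h1 n t)) (HD_derive1 (h2 n t)); rewrite E.
Qed.

End planecurves.

(** * Fields on space-time and the effect of the twist *)

Section fields.
Context {R : realType}.
Implicit Types (s t d : R).

Notation et := ((1, (0, 0)) : R * plane R).
Notation ex := ((0, (1, 0)) : R * plane R).
Notation ey := ((0, (0, 1)) : R * plane R).

Lemma Ck_cont {V W : normedModType R} k (U : set V) (G : V -> W) x :
  Ck_on k U G -> U x -> {for x, continuous G}.
Proof. by case: k => [|k] [h _]; exact: h. Qed.

Lemma ct_fst {X Y Z : topologicalType} (F : X -> Y * Z) p :
  {for p, continuous F} -> {for p, continuous (fun x => (F x).1)}.
Proof. by move=> h; exact: (cvg_comp _ _ h cvg_fst). Qed.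

Lemma ct_snd {X Y Z : topologicalType} (F : X -> Y * Z) p :
  {for p, continuous F} -> {for p, continuous (fun x => (F x).2)}.
Proof. by move=> h; exact: (cvg_comp _ _ h cvg_snd). Qed.

Section chain.
Variables (Q : set (plane R)) (oQ : open Q).
Let U : set (R * plane R) := [set: R] `*` Q.

Lemma near_spacetime (p : R * plane R) : Q p.2 -> \forall r \near p, U r.
Proof.
move=> Qp; exists ([set: R], Q); last by move=> r [].
by split => /=; [exact: filterT|exact: open_nbhs_nbhs].
Qed.

Lemma chain_partials (G Gt Gx Gy : R * plane R -> R) (a b c : R -> R) t da db dc :
  let p := (a t, (b t, c t)) in
  (\forall q \near p,
     [/\ HD (fun s => G (s, (q.2.1, q.2.2))) q.1 (Gt q),
         HD (fun s => G (q.1, (s, q.2.2))) q.2.1 (Gx q) &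
         HD (fun s => G (q.1, (q.2.1, s))) q.2.2 (Gy q)]) ->
  {for p, continuous Gt} -> {for p, continuous Gx} -> {for p, continuous Gy} ->
  HD a t da -> HD b t db -> HD c t dc ->
  HD (fun s => G (a s, (b s, c s))) t (Gt p * da + Gx p * db + Gy p * dc).
Proof.
move=> p hG ct cx cy ha hb hc.
have E (H : R * plane R -> R) : {for p, continuous H} ->
    {for p, continuous (fun q => H (q.1, (q.2.1, q.2.2)))}.
  move=> cH; have -> : (fun q => H (q.1, (q.2.1, q.2.2))) = H.
    by apply/funext => -[? []].
  exact: cH.
apply: (@chain3 R (fun x y z => G (x, (y, z))) (fun x y z => Gt (x, (y, z)))
  (fun x y z => Gx (x, (y, z))) (fun x y z => Gy (x, (y, z))) a b c t da db dc
  ha hb hc _ (E _ ct) (E _ cx) (E _ cy)).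
by apply: (@filterS _ (nbhs p) _ _ _ _ hG) => -[x [y z]].
Qed.

Lemma coord_derivatives (G : R * plane R -> plane R) (q : R * plane R) :
  (forall v, derivable G q v) ->
  [/\ HD (fun s => (G (s, (q.2.1, q.2.2))).1) q.1 ('D_et G q).1 /\
      HD (fun s => (G (s, (q.2.1, q.2.2))).2) q.1 ('D_et G q).2,
      HD (fun s => (G (q.1, (s, q.2.2))).1) q.2.1 ('D_ex G q).1 /\
      HD (fun s => (G (q.1, (s, q.2.2))).2) q.2.1 ('D_ex G q).2 &
      HD (fun s => (G (q.1, (q.2.1, s))).1) q.2.2 ('D_ey G q).1 /\
      HD (fun s => (G (q.1, (q.2.1, s))).2) q.2.2 ('D_ey G q).2].
Proof.
case: q => x [y z] dG /=; split.
- apply: (line_derive (path := fun s => (s, (y, z))) erefl _ (dG _)) => h.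
  by rewrite /GRing.scale /GRing.add /= /add_pair /scale_pair /=; congr (_, (_, _)); rewrite scaler0 add0r.
- apply: (line_derive (path := fun s => (x, (s, z))) erefl _ (dG _)) => h.
  by congr (_, (_, _)); rewrite /= scaler0 add0r.
- apply: (line_derive (path := fun s => (x, (y, s))) erefl _ (dG _)) => h.
  by congr (_, (_, _)); rewrite /= scaler0 add0r.
Qed.

Lemma chain_field (G : R * plane R -> plane R) (a b c : R -> R) t da db dc :
  Ck_on 1 U G -> Q (b t, c t) -> HD a t da -> HD b t db -> HD c t dc ->
  let p := (a t, (b t, c t)) in
  HD (fun s => (G (a s, (b s, c s))).1) t
    (('D_et G p).1 * da + ('D_ex G p).1 * db + ('D_ey G p).1 * dc) /\
  HD (fun s => (G (a s, (b s, c s))).2) t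
    (('D_et G p).2 * da + ('D_ex G p).2 * db + ('D_ey G p).2 * dc).
Proof.
move=> [_ hG] Qp ha hb hc p.
have Up : U p by [].
have cD v : {for p, continuous (fun q => 'D_v G q)} := (hG v).2.1 _ Up.
have nU : \forall q \near p, U q := near_spacetime (p := p) Qp.
have L (q : R * plane R) (Uq : U q) := coord_derivatives (fun v => (hG v).1 q Uq).
split.
- apply: (chain_partials (G := fun q => (G q).1) (Gt := fun q => ('D_et G q).1)
    (Gx := fun q => ('D_ex G q).1) (Gy := fun q => ('D_ey G q).1) _
    (ct_fst (cD et)) (ct_fst (cD ex)) (ct_fst (cD ey)) ha hb hc).
  by apply: (@filterS _ (nbhs p) _ _ _ _ nU) => q /L [[? _] [? _] [? _]].
- apply: (chain_partials (G := fun q => (G q).2) (Gt := fun q => ('D_et G q).2)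
    (Gx := fun q => ('D_ex G q).2) (Gy := fun q => ('D_ey G q).2) _
    (ct_snd (cD et)) (ct_snd (cD ex)) (ct_snd (cD ey)) ha hb hc).
  by apply: (@filterS _ (nbhs p) _ _ _ _ nU) => q /L [[_ ?] [_ ?] [_ ?]].
Qed.

(** The chain rule expresses the derivative through directional derivatives of [G], which are again
    fields, of class C^k; hence the induction over all fields at once. *)
Lemma ck_field k (G : R * plane R -> plane R) (a b c : R -> R) :
  Ck_on k U G -> (forall t, Q (b t, c t)) -> ck k a -> ck k b -> ck k c ->
  ck k (fun s => (G (a s, (b s, c s))).1) /\ ck k (fun s => (G (a s, (b s, c s))).2).
Proof.
elim: k G => [|k IH] G hG Qp ha hb hc.
  have cc : continuous (fun s => (a s, (b s, c s))).
    by move=> s; apply: ctpair (ha s) (ctpair (hb s) (hc s)).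
  have cG s : {for s, continuous (fun s => G (a s, (b s, c s)))}.
    have Us : U (a s, (b s, c s)) by split => //=; exact: Qp.
    exact: (cvg_comp _ _ (cc s) (Ck_cont hG Us)).
  by split=> s; [exact: ct_fst (cG s)|exact: ct_snd (cG s)].
have hG1 : Ck_on 1 U G.
  split; first exact: hG.1.
  move=> v; split; first exact: (hG.2 v).1.
  by split=> // x Ux; exact: Ck_cont (hG.2 v).2 Ux.
have I v := IH _ (hG.2 v).2 Qp (ckW ha) (ckW hb) (ckW hc).
split.
- apply: ckS; last first.
    apply: ckD; last by apply: ckM (I ey).1 hc.2.
    by apply: ckD; [apply: ckM (I et).1 ha.2|apply: ckM (I ex).1 hb.2].
  by move=> t; apply: (chain_field hG1 (Qp t) (ckS_HD ha t) (ckS_HD hb t) (ckS_HD hc t)).1.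
- apply: ckS; last first.
    apply: ckD; last by apply: ckM (I ey).2 hc.2.
    by apply: ckD; [apply: ckM (I et).2 ha.2|apply: ckM (I ex).2 hb.2].
  by move=> t; apply: (chain_field hG1 (Qp t) (ckS_HD ha t) (ckS_HD hb t) (ckS_HD hc t)).2.
Qed.

End chain.

(** The second difference of [F] over a small square, evaluated by the mean value theorem in both
    orders, is the area times [F12] at one point and the area times [F21] at another. Both values
    are close to those at (x, y). *)
Lemma schwarz (F F1 F2 F12 F21 : R -> R -> R) (x y : R) :
  (\forall p \near (x, y),
     (HD (fun s => F s p.2) p.1 (F1 p.1 p.2) /\ HD (fun s => F p.1 s) p.2 (F2 p.1 p.2)) /\
     (HD (fun s => F1 p.1 s) p.2 (F12 p.1 p.2) /\ HD (fun s => F2 s p.2) p.1 (F21 p.1 p.2))) ->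
  {for (x, y), continuous (fun p : R * R => F12 p.1 p.2)} ->
  {for (x, y), continuous (fun p : R * R => F21 p.1 p.2)} ->
  F12 x y = F21 x y.
Proof.
move=> hF c12 c21; apply/eqP; rewrite -subr_eq0; apply/negPn/negP => ne.
pose e := `|F12 x y - F21 x y| / 2.
have e0 : 0 < e by rewrite divr_gt0 ?normr_gt0.
have /cvgrPdist_lt /(_ _ e0) C1 := c12; have /cvgrPdist_lt /(_ _ e0) C2 := c21.
have [[A B] /= [Ax By] AB] := filterI hF (filterI C1 C2).
have [d1 d10 h1] := (nearRP x _).1 Ax.
have [d2 d20 h2] := (nearRP y _).1 By.
pose d := Num.min d1 d2.
have d0 : 0 < d by rewrite lt_min d10.
have [dd1 dd2] : d <= d1 /\ d <= d2 by rewrite !ge_min !lexx orbT.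
have K (u v : R) : x <= u <= x + d / 2 -> y <= v <= y + d / 2 -> A u /\ B v.
  by move=> hu hv; split; [apply: h1|apply: h2]; rewrite ltr_distl; lra.
pose x' := x + d / 2; pose y' := y + d / 2.
have xx : x <= x' by rewrite /x'; lra.
have yy : y <= y' by rewrite /y'; lra.
have M (f g : R -> R) (u v : R) : u <= v -> (forall s, u <= s <= v -> HD f s (g s)) ->
    exists2 c : R, u <= c <= v & f v - f u = g c * (v - u).
  move=> uv h; have [||c cuv E] := @mvt _ f g u v.
  - by move=> s; rewrite min_l ?max_r// => /h /HD_cont.
  - by move=> s; rewrite min_l ?max_r// => /andP[s1 s2]; apply: h; rewrite !ltW.
  - by exists c => //; move: cuv; rewrite min_l ?max_r.
have ABP u v : x <= u <= x' -> y <= v <= y' -> _ := fun hu hv => AB (u, v) (K u v hu hv).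
have [c1 hc1 E1] := @M (fun s => F s y' - F s y) (fun s => F1 s y' - F1 s y) x x' xx
  (fun s hs => HDD (ABP s y' hs ltac:(by rewrite yy lexx)).1.1.1
                  (HDN (ABP s y hs ltac:(by rewrite yy lexx)).1.1.1)).
have [k1 hk1 G1] := @M (fun s => F1 c1 s) (fun s => F12 c1 s) y y' yy
  (fun s hs => (ABP c1 s hc1 hs).1.2.1).
have [c2 hc2 E2] := @M (fun s => F x' s - F x s) (fun s => F2 x' s - F2 x s) y y' yy
  (fun s hs => HDD (ABP x' s ltac:(by rewrite xx lexx) hs).1.1.2
                  (HDN (ABP x s ltac:(by rewrite xx lexx) hs).1.1.2)).
have [k2 hk2 G2] := @M (fun s => F2 s c2) (fun s => F21 s c2) x x' xx
  (fun s hs => (ABP s c2 hs hc2).1.2.2).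
have [_ [b1 _]] := ABP c1 k1 hc1 hk1; have [_ [_ b2]] := ABP k2 c2 hk2 hc2.
have EE : F12 c1 k1 = F21 k2 c2.
  have : F12 c1 k1 * (y' - y) * (x' - x) = F21 k2 c2 * (x' - x) * (y' - y).
    by rewrite -G1 -G2 -E1 -E2; ring.
  rewrite -!mulrA (mulrC (x' - x)) => /mulIf; apply.
  by rewrite mulf_neq0// subr_eq0 /x' /y' gt_eqF//; lra.
have : `|F12 x y - F21 x y| < `|F12 x y - F21 x y|.
  apply: le_lt_trans (_ : `|F12 x y - F12 c1 k1| + `|F21 x y - F21 k2 c2| < _).
    rewrite -[X in X <= _](_ : `|(F12 x y - F12 c1 k1) - (F21 x y - F21 k2 c2)| = _).
      exact: ler_normB.
    by rewrite EE; congr `|_|; ring.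
  by move: b1 b2; rewrite /e /=; lra.
by rewrite ltxx.
Qed.

Section twisted.
Variables (Q : set (plane R)) (A : R -> plane R -> plane R) (f : plane R -> R).
Hypotheses (oQ : open Q) (tp : twisted_periodic Q A f).
Let Ah (p : R * plane R) := A p.1 p.2.

Lemma Ah_smooth k : Ck_on k ([set: R] `*` Q) Ah.
Proof. by case: tp => h _ _ _; exact: h. Qed.

Lemma Ah_derivable t q v : Q q -> derivable Ah (t, q) v.
Proof. by move=> Qq; exact: ((Ah_smooth 1).2 v).1. Qed.

Lemma dotAE t q : Q q -> dotA A t q = 'D_et Ah (t, q).
Proof.
move=> Qq.
have [|h1 h2] := line_derive (F := Ah) (path := fun s : R => (s, q)) (q := t) (w := 1)
  erefl _ (@Ah_derivable t q et Qq).
  by move=> h; congr (_, _); rewrite /= [_ *: (0, 0)]scaler0 add0r.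
rewrite /dotA; have [_ ->] := HD_curve (z := fun s => A s q) h1 h2.
by rewrite -surjective_pairing.
Qed.

Lemma magneticE t q : Q q ->
  magnetic A t q = ('D_ex Ah (t, q)).2 - ('D_ey Ah (t, q)).1.
Proof.
move=> Qq; rewrite /magnetic.
have [|_ [_ ->]] := line_derive (F := Ah) (path := fun x : plane R => (t, x)) (q := q)
  (w := (1, 0) : plane R) erefl _ (@Ah_derivable t q ex Qq).
  by move=> h; congr (_, _); rewrite /= scaler0 add0r.
have [|[_ ->] _] := line_derive (F := Ah) (path := fun x : plane R => (t, x)) (q := q)
  (w := (0, 1) : plane R) erefl _ (@Ah_derivable t q ey Qq).
  by move=> h; congr (_, _); rewrite /= scaler0 add0r.
by [].
Qed.

Lemma f_schwarz q : Q q ->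
  'D_((1, 0) : plane R) ('D_((0, 1) : plane R) f) q =
  'D_((0, 1) : plane R) ('D_((1, 0) : plane R) f) q.
Proof.
move=> Qq; have [_ hf _ _] := tp; have h2 := hf 2%N.
case: q Qq => x y Qq.
pose e1 := (1, 0) : plane R; pose e2 := (0, 1) : plane R.
apply/esym.
apply: (@schwarz (fun x y => f (x, y)) (fun x y => 'D_e1 f (x, y))
  (fun x y => 'D_e2 f (x, y)) (fun x y => 'D_e2 ('D_e1 f) (x, y))
  (fun x y => 'D_e1 ('D_e2 f) (x, y))).
- have nQ : \forall p \near (x, y), Q p by apply: open_nbhs_nbhs; split.
  apply: (@filterS _ (nbhs (x, y)) _ _ _ _ nQ) => -[u v] Quv /=.
  have P1 (g : plane R -> R) : derivable g (u, v) e1 ->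
      HD (fun s => g (s, v)) u ('D_e1 g (u, v)).
    move=> dg; apply: (line_derive1 (path := fun s : R => (s, v)) erefl _ dg) => h.
    by congr (_, _); rewrite /= scaler0 add0r.
  have P2 (g : plane R -> R) : derivable g (u, v) e2 ->
      HD (fun s => g (u, s)) v ('D_e2 g (u, v)).
    move=> dg; apply: (line_derive1 (path := fun s : R => (u, s)) erefl _ dg) => h.
    by congr (_, _); rewrite /= scaler0 add0r.
  split; split.
  - by apply: P1; exact: (h2.2 e1).1.
  - by apply: P2; exact: (h2.2 e2).1.
  - by apply: P2; exact: ((h2.2 e1).2.2 e2).1.
  - by apply: P1; exact: ((h2.2 e2).2.2 e1).1.
- have -> : (fun p : R * R => 'D_e2 ('D_e1 f) (p.1, p.2)) = 'D_e2 ('D_e1 f).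
    by apply/funext => -[].
  exact: (((h2.2 e1).2.2 e2).2.1 _ Qq).
- have -> : (fun p : R * R => 'D_e1 ('D_e2 f) (p.1, p.2)) = 'D_e1 ('D_e2 f).
    by apply/funext => -[].
  exact: (((h2.2 e2).2.2 e1).2.1 _ Qq).
Qed.

(** The twist changes the form by the gradient of [f], whose curl vanishes by [f_schwarz]. *)
Lemma magnetic_periodic t q : Q q -> magnetic A (t + 1) q = magnetic A t q.
Proof.
move=> Qq; have [_ hf _ tw] := tp; have h2 := hf 2%N.
have nQ : \forall p \near q, Q p by apply: open_nbhs_nbhs; split.
have pt (w : plane R) (v : R * plane R) : v = (0, w) ->
    is_derive q w (fun x => (A t x).1) ('D_v Ah (t, q)).1 /\
    is_derive q w (fun x => (A t x).2) ('D_v Ah (t, q)).2.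
  move=> ->; apply: (line_derive (F := Ah) (path := fun x : plane R => (t, x)) erefl _
    (@Ah_derivable t q (0, w) Qq)).
  by move=> h; congr (_, _); rewrite /= scaler0 add0r.
have E1 : 'D_((1, 0) : plane R) (fun x => (A (t + 1) x).2) q =
  'D_((1, 0) : plane R) (fun x => (A t x).2) q +
  'D_((1, 0) : plane R) ('D_((0, 1) : plane R) f) q.
  rewrite -deriveD.
  - apply: near_eq_derive; apply: (@filterS _ (nbhs q) _ _ _ _ nQ) => x Qx.
    by rewrite tw.
  - by have [_ []] := pt (1, 0) _ erefl.
  - exact: ((h2.2 _).2.2 _).1.
have E2 : 'D_((0, 1) : plane R) (fun x => (A (t + 1) x).1) q =
  'D_((0, 1) : plane R) (fun x => (A t x).1) q +
  'D_((0, 1) : plane R) ('D_((1, 0) : plane R) f) q.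
  rewrite -deriveD.
  - apply: near_eq_derive; apply: (@filterS _ (nbhs q) _ _ _ _ nQ) => x Qx.
    by rewrite tw.
  - by have [[]] := pt (0, 1) _ erefl.
  - exact: ((h2.2 _).2.2 _).1.
by rewrite /magnetic E1 E2 f_schwarz//; ring.
Qed.

End twisted.
End fields.

(** * The first variation of the action *)

Section action.
Context {R : realType}.
Notation mu := (@lebesgue_measure R).
Implicit Types (s t d e : R).

Definition prim (f : R -> R) (s : R) : R := oriented_int 0 s f.

Lemma prim_HD (f : R -> R) s : continuous f -> HD (prim f) s (f s).
Proof. by move=> cf; apply: oint_HD (cf s); exact: cont_locint. Qed.

Lemma prim0 (f : R -> R) : prim f 0 = 0.
Proof. exact: oint0. Qed.

Lemma prim_cont (f : R -> R) : continuous f -> continuous (prim f).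
Proof. by move=> cf s; exact: HD_cont (prim_HD s cf). Qed.

Lemma prim_unique (f F : R -> R) s : continuous f -> (forall s, HD F s (f s)) ->
  prim f s = F s - F 0.
Proof. by move=> cf h; rewrite /prim (oint_FTC _ _ cf h). Qed.

Lemma prim1E (f : R -> R) : prim f 1 = \int[mu]_(s in `[0, 1]) f s.
Proof. by rewrite /prim oint_le. Qed.

Lemma is_derive_csqr (z w : plane R) :
  'D_w csqr z = (2 * (z.1 * w.1 - z.2 * w.2), 2 * (z.1 * w.2 + z.2 * w.1)).
Proof.
pose c (h : R) : plane R :=
  ((h * w.1 + z.1) * (h * w.1 + z.1) - (h * w.2 + z.2) * (h * w.2 + z.2),
   (h * w.1 + z.1) * (h * w.2 + z.2) + (h * w.2 + z.2) * (h * w.1 + z.1)).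
have e1 : HD (fun h : R => (c h).1) 0 (2 * (z.1 * w.1 - z.2 * w.2)).
  by rewrite /c /=; der; ring.
have e2 : HD (fun h : R => (c h).2) 0 (2 * (z.1 * w.2 + z.2 * w.1)).
  by rewrite /c /=; der; ring.
have [_ <-] := HD_curve e1 e2.
rewrite /derive1 /derive; set d := (fun _ : R => _); set d' := (fun _ : R => _).
suff -> : d = d' by []; rewrite funeqE => h; rewrite /d /d' /=.
have -> : c (h + 0) = csqr (h *: w + z) by rewrite addr0.
have -> : c 0 = csqr z by rewrite /c /csqr !mul0r !add0r.
by [].
Qed.

Lemma L2norm_sqr (z : R -> plane R) (x y : R -> R) :
  (forall s, z s = (x s, y s)) ->
  L2norm z ^+ 2 = prim (fun s => x s ^+ 2 + y s ^+ 2) 1.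
Proof.
move=> zE; rewrite prim1E /L2norm sqr_sqrtr.
  by apply: Rint_ext => s _; rewrite zE /edot /= !expr2.
by apply: Rintegral_ge0 => s _; rewrite /edot addr_ge0// -expr2 sqr_ge0.
Qed.

Lemma enorm_sqr (z : plane R) : enorm z ^+ 2 = z.1 ^+ 2 + z.2 ^+ 2.
Proof.
by rewrite /enorm sqr_sqrtr /edot -?expr2// addr_ge0// sqr_ge0.
Qed.

Lemma time_reparE (z : R -> plane R) (x y : R -> R) s :
  (forall s, z s = (x s, y s)) ->
  time_repar z s = prim (fun s => x s ^+ 2 + y s ^+ 2) s /
                   prim (fun s => x s ^+ 2 + y s ^+ 2) 1.
Proof.
move=> zE; rewrite /time_repar (L2norm_sqr zE) mulrC; congr (_ / _).
by apply: oint_ext => r; rewrite enorm_sqr zE.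
Qed.

Lemma actionE (A : R -> plane R -> plane R) (f : plane R -> R)
    (z : R -> plane R) (x y u v : R -> R) :
  (forall s, z s = (x s, y s)) -> (forall s, HD x s (u s)) -> (forall s, HD y s (v s)) ->
  let r s := x s ^+ 2 + y s ^+ 2 in
  action A f z =
  2 * prim r 1 * prim (fun s => u s ^+ 2 + v s ^+ 2) 1 + 1 / prim r 1 +
  \int[mu]_(s in `[0, 1])
    ((A (prim r s / prim r 1) (csqr (x s, y s))).1 * (2 * (x s * u s - y s * v s)) +
     (A (prim r s / prim r 1) (csqr (x s, y s))).2 * (2 * (x s * v s + y s * u s)))
  - f (csqr (x 0, y 0)).
Proof.
move=> zE hx hy r.
have dz s : z^`()%classic s = (u s, v s).
  have h1 : HD (fun s => (z s).1) s (u s) by under eq_fun do rewrite zE; exact: hx.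
  have h2 : HD (fun s => (z s).2) s (v s) by under eq_fun do rewrite zE; exact: hy.
  by have [_ ->] := HD_curve h1 h2.
rewrite /action (L2norm_sqr zE) (L2norm_sqr dz) zE; congr (_ + _ + _ - _).
by apply: Rint_ext => s _; rewrite (time_reparE _ zE) dz zE /sq_pullback is_derive_csqr.
Qed.

End action.

Section tube.
Context {R : realType}.

(** The tube lemma around the slice e = 0; of two neighbouring tubes the thinner radius is kept. *)
Lemma tube (P : R -> R -> Prop) (a b : R) : a <= b ->
  (forall s, a <= s <= b -> \forall p \near ((0, s) : R * R), P p.1 p.2) ->
  exists2 dl : R, 0 < dl & forall e s, `|e| < dl -> a <= s <= b -> P e s.
Proof.
move=> ab loc.
pose S u w := exists2 dl : R, 0 < dl & forall e s : R,
  `|e| < dl -> u <= s <= w -> a <= s <= b -> P e s.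
suff [dl dl0 h] : S a b by exists dl => // e s he hs; exact: h.
apply: (@cousin _ S) ab => [u v w uv vw [d1 d10 h1] [d2 d20 h2]|t].
  exists (Num.min d1 d2); first by rewrite lt_min d10.
  move=> e s; rewrite lt_min => /andP[e1 e2] /andP[us sw] hs.
  by have [sv|/ltW vs] := leP s v; [apply: h1|apply: h2]; rewrite ?us ?sw ?sv ?vs.
(* Outside [a, b] the claim is void for intervals shorter than the distance to [a, b]. *)
have [tab|tab] := boolP (a <= t <= b); last first.
  pose d := Num.max (a - t) (t - b).
  have d0 : 0 < d by rewrite lt_max; move: tab; rewrite negb_and -!ltNge; lra.
  exists d => // u w ut tw wud; exists 1 => // e s _ usw sab; exfalso.
  by move: wud; rewrite lt_max => /orP[]; lra.
have [[U V] /= [U0 Vt] UV] := loc t tab.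
have [d1 d10 h1] := (nearRP 0 _).1 U0.
have [d2 d20 h2] := (nearRP t _).1 Vt.
exists d2 => // u w ut tw wud; exists d1 => // e s e1 usw sab.
have : (U `*` V) (e, s).
  by split => /=; [apply: h1; rewrite subr0|apply: h2; rewrite ltr_distl; lra].
exact: UV.
Qed.

Lemma ct_field {X : topologicalType} (F : R -> plane R -> plane R)
    (T B C : X -> R) (p : X) :
  {for (T p, (B p, C p)), continuous (fun q : R * plane R => F q.1 q.2)} ->
  {for p, continuous T} -> {for p, continuous B} -> {for p, continuous C} ->
  {for p, continuous (fun r => (F (T r) (B r, C r)).1)} /\
  {for p, continuous (fun r => (F (T r) (B r, C r)).2)}.
Proof.
move=> cF cT cB cC.
have c : {for p, continuous (fun r => (T r, (B r, C r)))}.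
  exact: ctpair cT (ctpair cB cC).
have cG : {for p, continuous (fun r => F (T r) (B r, C r))} := cvg_comp _ _ c cF.
by split; [exact: ct_fst cG|exact: ct_snd cG].
Qed.

End tube.

Section field_data.
Context {R : realType}.
Implicit Types (t d : R).

(* The derivatives of A and f as abstract functions, which keeps unification
   away from the definition of directional derivatives. *)
Record field_data (Q : set (plane R)) (A : R -> plane R -> plane R) (f : plane R -> R)
   (At Ax Ay : R -> plane R -> plane R) (fx fy : plane R -> R) : Prop := FieldData {
  fd_A : forall (a b c : R -> R) t da db dc, Q (b t, c t) ->
    HD a t da -> HD b t db -> HD c t dc ->
    HD (fun s => (A (a s) (b s, c s)).1) t
     ((At (a t) (b t, c t)).1 * da + (Ax (a t) (b t, c t)).1 * db +
      (Ay (a t) (b t, c t)).1 * dc) /\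
    HD (fun s => (A (a s) (b s, c s)).2) t
     ((At (a t) (b t, c t)).2 * da + (Ax (a t) (b t, c t)).2 * db +
      (Ay (a t) (b t, c t)).2 * dc);
  fd_cA : forall t q, Q q -> {for (t, q), continuous (fun p : R * plane R => A p.1 p.2)};
  fd_cAt : forall t q, Q q -> {for (t, q), continuous (fun p : R * plane R => At p.1 p.2)};
  fd_cAx : forall t q, Q q -> {for (t, q), continuous (fun p : R * plane R => Ax p.1 p.2)};
  fd_cAy : forall t q, Q q -> {for (t, q), continuous (fun p : R * plane R => Ay p.1 p.2)};
  fd_f : forall (b c : R -> R) t db dc, Q (b t, c t) -> HD b t db -> HD c t dc ->
    HD (fun s => f (b s, c s)) t (fx (b t, c t) * db + fy (b t, c t) * dc);
  fd_tw : forall t q, Q q -> A (t + 1) q = A t q + (fx q, fy q);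
  fd_dotA : forall t q, Q q -> dotA A t q = At t q;
  fd_magnetic : forall t q, Q q -> magnetic A t q = (Ax t q).2 - (Ay t q).1;
  fd_ck : forall k (F : R -> plane R -> plane R), F = At \/ F = Ax \/ F = Ay ->
    forall a b c : R -> R, (forall t, Q (b t, c t)) -> ck k a -> ck k b -> ck k c ->
    ck k (fun s => (F (a s) (b s, c s)).1) /\ ck k (fun s => (F (a s) (b s, c s)).2);
  fd_dotA1 : forall t q, Q q -> dotA A (t + 1) q = dotA A t q;
  fd_magnetic1 : forall t q, Q q -> magnetic A (t + 1) q = magnetic A t q
}.

End field_data.

Section variation.
Context {R : realType}.
Notation mu := (@lebesgue_measure R).
Implicit Types (s t d e : R).
Variables (Q : set (plane R)) (A At Ax Ay : R -> plane R -> plane R).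
Variables (f fx fy : plane R -> R).
Hypothesis oQ : open Q.
Hypothesis fd : field_data Q A f At Ax Ay fx fy.
Let chainA := fd_A fd.
Let cA := fd_cA fd.
Let cAt := fd_cAt fd.
Let cAx := fd_cAx fd.
Let cAy := fd_cAy fd.
Let chainf := fd_f fd.
Let tw := fd_tw fd.

Variables (x y u v u2 v2 : R -> R).
Hypotheses (hx : forall s, HD x s (u s)) (hy : forall s, HD y s (v s)).
Hypotheses (hu : forall s, HD u s (u2 s)) (hv : forall s, HD v s (v2 s)).
Hypotheses (cu2 : continuous u2) (cv2 : continuous v2).
Hypothesis Qz : forall s, Q (csqr (x s, y s)).

Let cx := HD_continuous hx.
Let cy := HD_continuous hy.
Let cu := HD_continuous hu.
Let cv := HD_continuous hv.

(* For z = (x, y): vr = |z|^2, vn = ||z||^2, vM = ||z'||^2, vt = t_z, and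
   (va1, va2), vb are the t-derivative of A and the magnetic field at
   (t_z, z^2). *)
Definition vr s := x s ^+ 2 + y s ^+ 2.
Definition vn := prim vr 1.
Definition vM := prim (fun s => u s ^+ 2 + v s ^+ 2) 1.
Definition vt s := prim vr s / vn.
Definition va1 s := (At (vt s) (csqr (x s, y s))).1.
Definition va2 s := (At (vt s) (csqr (x s, y s))).2.
Definition vb s := (Ax (vt s) (csqr (x s, y s))).2 - (Ay (vt s) (csqr (x s, y s))).1.
Definition vg s := va1 s * (x s * u s - y s * v s) + va2 s * (x s * v s + y s * u s).
Definition vGam s := prim vg s.
Definition vMu s := prim (fun s => vg s * vt s) s.
(* The Euler-Lagrange expression: the first variation is its L2 product with xi. *)
Definition vE1 s :=
  4 * vM * x s - 2 * x s / vn ^+ 2 + 4 * vb s * vr s * v s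
  + 4 / vn * (vGam 1 - vGam s - vMu 1) * x s
  - 2 * vr s / vn * (x s * va1 s + y s * va2 s) - 4 * vn * u2 s.
Definition vE2 s :=
  4 * vM * y s - 2 * y s / vn ^+ 2 - 4 * vb s * vr s * u s
  + 4 / vn * (vGam 1 - vGam s - vMu 1) * y s
  - 2 * vr s / vn * (x s * va2 s - y s * va1 s) - 4 * vn * v2 s.

Let cr : continuous vr. Proof. by move=> s; rewrite /vr; ct. Qed.

Hypothesis vn0 : 0 < vn.
Let vnN : vn != 0. Proof. by rewrite gt_eqF. Qed.

Lemma vt_HD s : HD vt s (vr s / vn).
Proof.
rewrite /vt; have h := prim_HD s cr.
by der; rewrite mulr0 addr0.
Qed.
Let ctt := HD_continuous vt_HD.

Let cq1 s : {for s, continuous (fun s => x s * x s - y s * y s)}. Proof. by ct. Qed.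
Let cq2 s : {for s, continuous (fun s => x s * y s + y s * x s)}. Proof. by ct. Qed.

Lemma field_cont (F : R -> plane R -> plane R) :
  (forall t q, Q q -> {for (t, q), continuous (fun p : R * plane R => F p.1 p.2)}) ->
  continuous (fun s => (F (vt s) (csqr (x s, y s))).1) /\
  continuous (fun s => (F (vt s) (csqr (x s, y s))).2).
Proof.
move=> cF.
have h s := @ct_field R R F vt (fun s => x s * x s - y s * y s) (fun s => x s * y s + y s * x s)
   s (cF _ _ (Qz s)) (@ctt s) (@cq1 s) (@cq2 s).
by split=> s; [exact: (h s).1|exact: (h s).2].
Qed.

Lemma va1_cont : continuous va1. Proof. exact: (field_cont cAt).1. Qed.
Lemma va2_cont : continuous va2. Proof. exact: (field_cont cAt).2. Qed.
Lemma vb_cont : continuous vb.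
Proof.
by have c1 := (field_cont cAx).2; have c2 := (field_cont cAy).1; move=> s; rewrite /vb; ct.
Qed.
Lemma vg_cont : continuous vg.
Proof. by have := va1_cont; have := va2_cont => c1 c2 s; rewrite /vg; ct. Qed.
Lemma vGam_HD s : HD vGam s (vg s).
Proof. exact: prim_HD vg_cont. Qed.
Lemma vMu_HD s : HD vMu s (vg s * vt s).
Proof. by apply: prim_HD => r; have := vg_cont => c1; ct. Qed.

Lemma vE_cont : continuous vE1 /\ continuous vE2.
Proof.
have := va1_cont; have := va2_cont; have := vb_cont => c1 c2 c3.
have c4 := HD_continuous vGam_HD.
by split=> s; rewrite /vE1 /vE2; ct.
Qed.

Variables (g h dg dh : R -> R).
Hypotheses (hg : forall s, HD g s (dg s)) (hh : forall s, HD h s (dh s)).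
Hypotheses (cdg : continuous dg) (cdh : continuous dh).
Variable sg : R.
Hypothesis sg2 : sg * sg = 1.
Hypotheses (x1 : x 1 = sg * x 0) (y1 : y 1 = sg * y 0).
Hypotheses (u1 : u 1 = sg * u 0) (v1 : v 1 = sg * v 0).
Hypotheses (g1 : g 1 = sg * g 0) (h1 : h 1 = sg * h 0).

Let cg := HD_continuous hg.
Let ch := HD_continuous hh.

Let p1 s := x s * g s + y s * h s.
Let p2 s := g s ^+ 2 + h s ^+ 2.
Let m1 s := u s * dg s + v s * dh s.
Let m2 s := dg s ^+ 2 + dh s ^+ 2.
Let cp1 : continuous p1. Proof. by move=> s; rewrite /p1; ct. Qed.
Let cp2 : continuous p2. Proof. by move=> s; rewrite /p2; ct. Qed.
Let cm1 : continuous m1. Proof. by move=> s; rewrite /m1; ct. Qed.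
Let cm2 : continuous m2. Proof. by move=> s; rewrite /m2; ct. Qed.

Let X e s := x s + e * g s.
Let Y e s := y s + e * h s.
Let U e s := u s + e * dg s.
Let V e s := v s + e * dh s.
(** The squared norm of the perturbed loop up to [s] is a quadratic polynomial in [e], so for fixed
    [s] the nonlocal time [T] is a rational function of [e]. *)
Let Nn e s := prim vr s + 2 * e * prim p1 s + e ^+ 2 * prim p2 s.
Let Nd e s := 2 * prim p1 s + 2 * e * prim p2 s.
Let T e s := Nn e s / Nn e 1.
Let TE e s := Nd e s / Nn e 1 - Nn e s * Nd e 1 / Nn e 1 ^+ 2.

Lemma Nn_HD e s : HD (Nn ^~ s) e (Nd e s).
Proof. by rewrite /Nn /Nd; der; ring. Qed.

Lemma NnE e s : prim (fun s => X e s ^+ 2 + Y e s ^+ 2) s = Nn e s.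
Proof.
rewrite (@prim_unique _ _ (Nn e)); last 2 first.
- by move=> r; rewrite /X /Y; ct.
- move=> r; have := prim_HD r cr; have := prim_HD r cp1; have := prim_HD r cp2 => d1 d2 d3.
  by rewrite /Nn; der; rewrite /X /Y /vr /p1 /p2; ring.
by rewrite /Nn !prim0 !mulr0 !addr0 subr0.
Qed.

Lemma MnE e : prim (fun s => U e s ^+ 2 + V e s ^+ 2) 1 =
  vM + 2 * e * prim m1 1 + e ^+ 2 * prim m2 1.
Proof.
have c0 : continuous (fun s => u s ^+ 2 + v s ^+ 2) by move=> r; ct.
rewrite (@prim_unique _ _ (fun s => prim (fun s => u s ^+ 2 + v s ^+ 2) s
  + 2 * e * prim m1 s + e ^+ 2 * prim m2 s)); last 2 first.
- by move=> r; rewrite /U /V; ct.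
- move=> r; have := prim_HD r c0; have := prim_HD r cm1; have := prim_HD r cm2 => d1 d2 d3.
  by der; rewrite /U /V /m1 /m2; ring.
by rewrite !prim0 !mulr0 !addr0 subr0.
Qed.

Let fA1 e s := (A (T e s) (csqr (X e s, Y e s))).1.
Let fA2 e s := (A (T e s) (csqr (X e s, Y e s))).2.
Let dA1 e s := (At (T e s) (csqr (X e s, Y e s))).1 * TE e s
  + (Ax (T e s) (csqr (X e s, Y e s))).1 * (2 * (X e s * g s - Y e s * h s))
  + (Ay (T e s) (csqr (X e s, Y e s))).1 * (2 * (X e s * h s + Y e s * g s)).
Let dA2 e s := (At (T e s) (csqr (X e s, Y e s))).2 * TE e s
  + (Ax (T e s) (csqr (X e s, Y e s))).2 * (2 * (X e s * g s - Y e s * h s))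
  + (Ay (T e s) (csqr (X e s, Y e s))).2 * (2 * (X e s * h s + Y e s * g s)).
Let H e s := fA1 e s * (2 * (X e s * U e s - Y e s * V e s)) +
             fA2 e s * (2 * (X e s * V e s + Y e s * U e s)).
Let H1 e s := dA1 e s * (2 * (X e s * U e s - Y e s * V e s)) +
  fA1 e s * (2 * (g s * U e s + X e s * dg s - h s * V e s - Y e s * dh s)) +
  dA2 e s * (2 * (X e s * V e s + Y e s * U e s)) +
  fA2 e s * (2 * (g s * V e s + X e s * dh s + h s * U e s + Y e s * dg s)).

Let pr_cont (k : R -> R) (p : R * R) : continuous k ->
  {for p, continuous (fun q : R * R => k q.2)}.
Proof. by move=> ck; exact: (ctcomp (cvg_snd : {for p, continuous snd}) (ck _)). Qed.

Let cfst (p : R * R) : {for p, continuous (fun q : R * R => q.1)}.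
Proof. exact: cvg_fst. Qed.

Lemma good_tube : exists2 dl : R, 0 < dl &
  forall e s, `|e| < dl -> 0 <= s <= 1 -> Q (csqr (X e s, Y e s)) /\ 0 < Nn e 1.
Proof.
apply: (@tube _ (fun e s => Q (csqr (X e s, Y e s)) /\ 0 < Nn e 1)) => // s _.
have := @pr_cont _ (0, s) cx; have := @pr_cont _ (0, s) cy; have := @pr_cont _ (0, s) cg;
  have := @pr_cont _ (0, s) ch; have := @cfst (0, s) => c1 c2 c3 c4 c5.
have cX : {for (0, s), continuous (fun p : R * R => X p.1 p.2)} by rewrite /X; ct.
have cY : {for (0, s), continuous (fun p : R * R => Y p.1 p.2)} by rewrite /Y; ct.
have cN : {for (0, s), continuous (fun p : R * R => Nn p.1 1)} by rewrite /Nn; ct.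
have cZ : {for (0, s), continuous (fun p : R * R => csqr (X p.1 p.2, Y p.1 p.2))}.
  by apply: ctpair; rewrite /=; ct.
have E0 : (X 0 s, Y 0 s) = (x s, y s) by rewrite /X /Y !mul0r !addr0.
apply: filterI.
  apply: (cZ Q); rewrite /= E0; apply: open_nbhs_nbhs; split => //; exact: Qz.
apply: (cN [set r | 0 < r]); apply: open_nbhs_nbhs; split; first exact: open_gt.
by rewrite /Nn /= !mulr0 expr0n /= !mul0r !addr0.
Qed.

Let field2_cont (F : R -> plane R -> plane R) e s :
  (forall t q, Q q -> {for (t, q), continuous (fun p : R * plane R => F p.1 p.2)}) ->
  Q (csqr (X e s, Y e s)) -> 0 < Nn e 1 ->
  {for (e, s), continuous (fun p : R * R => (F (T p.1 p.2) (csqr (X p.1 p.2, Y p.1 p.2))).1)} /\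
  {for (e, s), continuous (fun p : R * R => (F (T p.1 p.2) (csqr (X p.1 p.2, Y p.1 p.2))).2)}.
Proof.
move=> cF Qe Ne.
have := @pr_cont _ (e, s) cx; have := @pr_cont _ (e, s) cy; have := @pr_cont _ (e, s) cg;
  have := @pr_cont _ (e, s) ch; have := @cfst (e, s) => c1 c2 c3 c4 c5.
have := @pr_cont _ (e, s) (prim_cont cr); have := @pr_cont _ (e, s) (prim_cont cp1);
  have := @pr_cont _ (e, s) (prim_cont cp2) => c6 c7 c8.
apply: (@ct_field R _ F (fun p : R * R => T p.1 p.2)
  (fun p : R * R => X p.1 p.2 * X p.1 p.2 - Y p.1 p.2 * Y p.1 p.2)
  (fun p : R * R => X p.1 p.2 * Y p.1 p.2 + Y p.1 p.2 * X p.1 p.2)) => //=.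
- exact: cF.
- by rewrite /T /Nn; ct; rewrite /= gt_eqF.
- by rewrite /X /Y; ct.
- by rewrite /X /Y; ct.
Qed.

Lemma H1_cont e s : Q (csqr (X e s, Y e s)) -> 0 < Nn e 1 ->
  {for (e, s), continuous (fun p : R * R => H1 p.1 p.2)}.
Proof.
move=> Qe Ne.
have [k1 k2] := field2_cont cA Qe Ne; have [k3 k4] := field2_cont cAt Qe Ne.
have [k5 k6] := field2_cont cAx Qe Ne; have [k7 k8] := field2_cont cAy Qe Ne.
have := @pr_cont _ (e, s) cx; have := @pr_cont _ (e, s) cy; have := @pr_cont _ (e, s) cg;
  have := @pr_cont _ (e, s) ch; have := @cfst (e, s) => c1 c2 c3 c4 c5.
have := @pr_cont _ (e, s) (prim_cont cr); have := @pr_cont _ (e, s) (prim_cont cp1);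
  have := @pr_cont _ (e, s) (prim_cont cp2) => c6 c7 c8.
have := @pr_cont _ (e, s) cu; have := @pr_cont _ (e, s) cv; have := @pr_cont _ (e, s) cdg;
  have := @pr_cont _ (e, s) cdh => c9 c10 c11 c12.
have N2 : Nn e 1 != 0 by rewrite gt_eqF.
have N3 : Nn e 1 ^+ 2 != 0 by rewrite expf_neq0.
have cTE : {for (e, s), continuous (fun p : R * R => TE p.1 p.2)}.
  by rewrite /TE /Nn /Nd; ct.
have cX : {for (e, s), continuous (fun p : R * R => X p.1 p.2)} by rewrite /X; ct.
have cY : {for (e, s), continuous (fun p : R * R => Y p.1 p.2)} by rewrite /Y; ct.
have cU : {for (e, s), continuous (fun p : R * R => U p.1 p.2)} by rewrite /U; ct.
have cV : {for (e, s), continuous (fun p : R * R => V p.1 p.2)} by rewrite /V; ct.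
by rewrite /H1 /dA1 /dA2 /fA1 /fA2; ct.
Qed.

Lemma variation_raw :
  HD (fun e => action A f (fun s => (X e s, Y e s))) 0
    (4 * prim p1 1 * vM + 4 * vn * prim m1 1 - 2 * prim p1 1 / vn ^+ 2
     + \int[mu]_(s in `[0, 1]) H1 0 s
     - (fx (csqr (x 0, y 0)) * (2 * (x 0 * g 0 - y 0 * h 0)) +
        fy (csqr (x 0, y 0)) * (2 * (x 0 * h 0 + y 0 * g 0)))).
Proof.
have [dl dl0 good] := good_tube.
have dI : HD (fun e => \int[mu]_(s in `[0, 1]) H e s) 0 (\int[mu]_(s in `[0, 1]) H1 0 s).
  apply: (diff_int dl0) => e s he hs; have [Qe Ne] := good e s he hs.
  - have hT : HD (T ^~ s) e (TE e s).
      rewrite /T /TE; have := Nn_HD e s; have := Nn_HD e 1 => d1 d2.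
      by der; [rewrite gt_eqF|field; rewrite gt_eqF].
    have hB : HD (fun e => X e s * X e s - Y e s * Y e s) e (2 * (X e s * g s - Y e s * h s)).
      by rewrite /X /Y; der; ring.
    have hC : HD (fun e => X e s * Y e s + Y e s * X e s) e (2 * (X e s * h s + Y e s * g s)).
      by rewrite /X /Y; der; ring.
    have [d1 d2] := @chainA (T ^~ s) (fun e => X e s * X e s - Y e s * Y e s)
      (fun e => X e s * Y e s + Y e s * X e s) e _ _ _ Qe hT hB hC.
    have hX : HD (X ^~ s) e (g s) by rewrite /X; der; ring.
    have hY : HD (Y ^~ s) e (h s) by rewrite /Y; der; ring.
    have hU : HD (U ^~ s) e (dg s) by rewrite /U; der; ring.
    have hV : HD (V ^~ s) e (dh s) by rewrite /V; der; ring.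
    rewrite /H /H1 /fA1 /fA2; der; rewrite /dA1 /dA2 /fA1 /fA2 /csqr /=; ring.
  - have [k1 k2] := field2_cont cA Qe Ne.
    have pe : {for s, continuous (fun s : R => (e, s))} 
      by refine (@ctpair _ _ _ (fun=> e) (fun s => s) s _ _); [exact: cvg_cst|exact: cvg_id].
    have j1 : {for s, continuous (fun s => fA1 e s)} := ctcomp pe k1.
    have j2 : {for s, continuous (fun s => fA2 e s)} := ctcomp pe k2.
    by rewrite /H /X /Y /U /V; ct.
  - exact: H1_cont.
have Q00 : Q (csqr (X 0 0, Y 0 0)) by rewrite /X /Y !mul0r !addr0; exact: Qz.
have df : HD (fun e => f (csqr (X e 0, Y e 0))) 0
   (fx (csqr (x 0, y 0)) * (2 * (x 0 * g 0 - y 0 * h 0)) +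
    fy (csqr (x 0, y 0)) * (2 * (x 0 * h 0 + y 0 * g 0))).
  have hB : HD (fun e => X e 0 * X e 0 - Y e 0 * Y e 0) 0 (2 * (x 0 * g 0 - y 0 * h 0)).
    by rewrite /X /Y; der; ring.
  have hC : HD (fun e => X e 0 * Y e 0 + Y e 0 * X e 0) 0 (2 * (x 0 * h 0 + y 0 * g 0)).
    by rewrite /X /Y; der; ring.
  apply: HDeq; first exact: (@chainf (fun e => X e 0 * X e 0 - Y e 0 * Y e 0)
      (fun e => X e 0 * Y e 0 + Y e 0 * X e 0) 0 _ _ Q00 hB hC).
  by rewrite /csqr /= /X /Y !mul0r !addr0.
have EE : (fun e => action A f (fun s => (X e s, Y e s))) = fun e =>
    2 * Nn e 1 * (vM + 2 * e * prim m1 1 + e ^+ 2 * prim m2 1) + 1 / Nn e 1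
    + \int[mu]_(s in `[0, 1]) H e s - f (csqr (X e 0, Y e 0)).
  apply/funext => e.
  rewrite (@actionE _ A f _ (X e) (Y e) (U e) (V e)) //; last 2 first.
  - by move=> s; rewrite /X /U; der; ring.
  - by move=> s; rewrite /Y /V; der; ring.
  rewrite /= MnE NnE; congr (_ + _ - _).
  by apply: Rint_ext => s _; rewrite !NnE.
rewrite EE; have d1 := Nn_HD 0 1.
have N1 : Nn 0 1 = vn by rewrite /Nn !mulr0 expr0n /= !mul0r !addr0.
have N2 : Nd 0 1 = 2 * prim p1 1 by rewrite /Nd mulr0 mul0r addr0.
der; first by rewrite N1.
by rewrite N1 N2; field.
Qed.

Lemma first_variation :
  HD (fun e => action A f (fun s => (X e s, Y e s))) 0
    (\int[mu]_(s in `[0, 1]) (vE1 s * g s + vE2 s * h s)).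
Proof.
apply: HDeq; first exact: variation_raw.
pose W s := (A (vt s) (csqr (x s, y s))).1 * (2 * (x s * g s - y s * h s)) +
            (A (vt s) (csqr (x s, y s))).2 * (2 * (x s * h s + y s * g s)).
(* [K] collects all integrations by parts: that of <z', xi'>, that of the pullback term and, in the
   summands with the factor 4 / vn, the exchange of the order of integration in the double integral
   of [vg] against the variation of the time, which is [TE0] below. *)
pose K s := 4 * vn * (u s * g s + v s * h s) + W s
  + 4 / vn * (vGam s * prim p1 s - vMu s * prim p1 1)
  - 4 / vn * (vGam 1 - vMu 1) * prim p1 s.
have N1 : Nn 0 1 = vn by rewrite /Nn !mulr0 expr0n /= !mul0r !addr0.
have T0 s : T 0 s = vt s by rewrite /T N1 /Nn !mulr0 expr0n /= !mul0r !addr0.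
have X0 s : X 0 s = x s by rewrite /X mul0r addr0.
have Y0 s : Y 0 s = y s by rewrite /Y mul0r addr0.
have U0 s : U 0 s = u s by rewrite /U mul0r addr0.
have V0 s : V 0 s = v s by rewrite /V mul0r addr0.
have TE0 s : TE 0 s = 2 * (prim p1 s - vt s * prim p1 1) / vn.
  by rewrite /TE N1 /Nd /Nn /vt !mulr0 expr0n /= !mul0r !addr0; field.
have [cE1 cE2] := vE_cont.
pose I s := 4 * vM * p1 s + 4 * vn * m1 s - 2 / vn ^+ 2 * p1 s + H1 0 s.
have HK s : HD K s (I s - (vE1 s * g s + vE2 s * h s)).
  have hB : HD (fun s => x s * x s - y s * y s) s (2 * (x s * u s - y s * v s)).
    by der; ring.
  have hC : HD (fun s => x s * y s + y s * x s) s (2 * (x s * v s + y s * u s)).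
    by der; ring.
  have [d1 d2] := @chainA vt (fun s => x s * x s - y s * y s)
      (fun s => x s * y s + y s * x s) s _ _ _ (Qz s) (vt_HD s) hB hC.
  have := prim_HD s cp1; have := vGam_HD s; have := vMu_HD s => d3 d4 d5.
  rewrite /K /W; der.
  rewrite /I /H1 /dA1 /dA2 /fA1 /fA2 T0 TE0 X0 Y0 U0 V0 /vE1 /vE2 /p1 /m1.
  rewrite /vg /vb /va1 /va2 /vr /csqr /=.
  set A1 := (A _ _).1; set A2 := (A _ _).2; set t1 := (At _ _).1; set t2 := (At _ _).2.
  set X1 := (Ax _ _).1; set X2 := (Ax _ _).2; set Y1 := (Ay _ _).1; set Y2 := (Ay _ _).2.
  by field.
have cH1 : continuous (H1 0).
  move=> s; have Q0s : Q (csqr (X 0 s, Y 0 s)) by rewrite X0 Y0; exact: Qz.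
  have N0 : 0 < Nn 0 1 by rewrite N1.
  have pe : {for s, continuous (fun s : R => (0 : R, s))}.
    by refine (@ctpair _ _ _ (fun=> 0) (fun s => s) s _ _); [exact: cvg_cst|exact: cvg_id].
  exact: (ctcomp pe (H1_cont Q0s N0)).
pose EX s := vE1 s * g s + vE2 s * h s.
have cEX : continuous EX by move=> s; rewrite /EX; ct.
have cI : continuous (fun s => I s - EX s) by move=> s; rewrite /I; ct.
have E1 := prim_unique 1 cI HK.
have E2 : prim (fun s => I s - EX s) 1 = 4 * vM * prim p1 1 + 4 * vn * prim m1 1
    - 2 / vn ^+ 2 * prim p1 1 + prim (H1 0) 1 - prim EX 1.
  rewrite (@prim_unique _ _ (fun s => 4 * vM * prim p1 s + 4 * vn * prim m1 s
    - 2 / vn ^+ 2 * prim p1 s + prim (H1 0) s - prim EX s) 1 cI).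
    by rewrite !prim0 !mulr0 !addr0 !subr0.
  move=> s; have := prim_HD s cp1; have := prim_HD s cm1; have := prim_HD s cH1;
    have := prim_HD s cEX => d1 d2 d3 d4.
  by der; rewrite /I; ring.
rewrite -!prim1E -/EX; rewrite E1 in E2.
have t1 : vt 1 = 0 + 1 by rewrite add0r /vt -/vn divff.
have t0 : vt 0 = 0 by rewrite /vt prim0 mul0r.
have Z1 : csqr (x 1, y 1) = csqr (x 0, y 0).
  rewrite x1 y1 /csqr /=; congr (_, _).
    by transitivity (sg * sg * (x 0 * x 0 - y 0 * y 0)); [ring|rewrite sg2 mul1r].
  by transitivity (sg * sg * (x 0 * y 0 + y 0 * x 0)); [ring|rewrite sg2 mul1r].
(* Products of two factors that both acquire the sign [sg] are periodic, but the time has advanced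
   by 1, so [A] has changed by the gradient of [f]. What remains is the variation of f(z(0)^2),
   which the action subtracts. *)
have KK : K 1 - K 0 = fx (csqr (x 0, y 0)) * (2 * (x 0 * g 0 - y 0 * h 0)) +
        fy (csqr (x 0, y 0)) * (2 * (x 0 * h 0 + y 0 * g 0)).
  rewrite /K /W t1 t0 Z1 tw; last exact: Qz.
  rewrite /vGam /vMu !prim0 x1 y1 g1 h1 u1 v1 /=.
  transitivity ((sg * sg - 1) * (4 * vn * (u 0 * g 0 + v 0 * h 0)
    + ((A 0 (csqr (x 0, y 0))).1 + fx (csqr (x 0, y 0))) * (2 * (x 0 * g 0 - y 0 * h 0))
    + ((A 0 (csqr (x 0, y 0))).2 + fy (csqr (x 0, y 0))) * (2 * (x 0 * h 0 + y 0 * g 0)))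
    + (fx (csqr (x 0, y 0)) * (2 * (x 0 * g 0 - y 0 * h 0)) +
       fy (csqr (x 0, y 0)) * (2 * (x 0 * h 0 + y 0 * g 0)))).
    by ring.
  by rewrite sg2 subrr mul0r add0r.
rewrite KK in E2; apply/eqP; rewrite -subr_eq0; apply/eqP.
move: E2; set a := prim EX 1; set b := prim (H1 0) 1 => E2.
rewrite (_ : _ - a = 4 * vM * prim p1 1 + 4 * vn * prim m1 1
    - 2 / vn ^+ 2 * prim p1 1 + b - a - (fx (csqr (x 0, y 0)) * (2 * (x 0 * g 0 - y 0 * h 0)) +
        fy (csqr (x 0, y 0)) * (2 * (x 0 * h 0 + y 0 * g 0)))); first by rewrite -E2 subrr.
by rewrite /b; field.
Qed.

End variation.

(** * The fundamental lemma for twisted-periodic test functions *)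

Section flat.
Context {R : realType}.
Implicit Types (p : {poly R}) (s t d e : R).

(** In the induction a factor 'X is absorbed into the power of [y]; this is why the exponent [k] is
    arbitrary. *)
Lemma poly_expR p (k : nat) : exists2 C : R, 0 <= C &
  forall y : R, 1 <= y -> `|p.[y]| * y ^+ k <= C * expR y.
Proof.
elim/poly_ind: p k => [|p c IH] k.
  by exists 0 => // y _; rewrite horner0 normr0 !mul0r.
have [C C0 hC] := IH k.+1.
have [C' C'0 hC'] : exists2 C : R, 0 <= C & forall y : R, 1 <= y -> y ^+ k <= C * expR y.
  case: k {IH C C0 hC} => [|k].
    by exists 1 => // y y1; rewrite mul1r expr0 -expR0 ler_expR; lra.
  exists k.+1`!%:R => [|y y1]; first by rewrite ler0n.
  have h := @expR_ge1Dxn R y k (le_trans ler01 y1).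
  rewrite mulrC -ler_pdivrMr ?ltr0n ?fact_gt0//.
  by apply: le_trans h; rewrite lerDr.
exists (C + `|c| * C'); first by rewrite addr_ge0// mulr_ge0.
move=> y y1; have y0 : 0 <= y := le_trans ler01 y1.
rewrite hornerMXaddC; apply: le_trans (_ : (`|p.[y]| * y + `|c|) * y ^+ k <= _).
  apply: ler_wpM2r; first exact: exprn_ge0.
  by apply: le_trans (ler_normD _ _) _; rewrite normrM (ger0_norm y0).
rewrite mulrDl -mulrA -exprS mulrDl lerD//; first exact: hC.
by rewrite -mulrA; apply: ler_wpM2l => //; exact: hC'.
Qed.

Definition flat p (s : R) : R := if 0 < s then p.[s^-1] * expR (- s^-1) else 0.

(** With y = 1 / s one has dy/ds = - y^2, so the derivative of p(y) exp(- y) is y^2 (p - p')(y)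
    exp(- y). The flat functions are closed under differentiation. *)
Definition flat_deriv p : {poly R} := 'X^2 * (p - p^`()).

Lemma HD_horner p (f : R -> R) t d : HD f t d ->
  HD (fun s => p.[f s]) t ((p^`()).[f t] * d).
Proof. by move=> hf; apply: (HDcomp (f := horner p)) hf; exact: is_derive_poly. Qed.

Lemma flat_HD p t : HD (flat p) t (flat (flat_deriv p) t).
Proof.
have [t0|t0|<-] := ltgtP 0 t.
- have -> : flat (flat_deriv p) t = (flat_deriv p).[t^-1] * expR (- t^-1) by rewrite /flat t0.
  apply: (@HD_near _ (fun s => p.[s^-1] * expR (- s^-1))).
    apply/nearRP; exists t => // s; rewrite ltr_distl => /andP[s1 _].
    by rewrite /flat ifT//; lra.
  have tN : t != 0 by rewrite gt_eqF.
  have hi : HD (fun s : R => s^-1) t (- 1 / t ^+ 2) by der.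
  apply: HDeq.
    by apply: HDM; [exact: HD_horner hi|apply: HD_exp; apply: HDN hi].
  by rewrite /flat_deriv hornerM hornerXn hornerD hornerN; field.
- have -> : flat (flat_deriv p) t = 0 by rewrite /flat ltNge ltW.
  apply: (@HD_near _ (fun=> 0)); last exact: HDc.
  apply/nearRP; exists (- t); first by lra.
  by move=> s; rewrite ltr_distl => /andP[_ s1]; rewrite /flat ifF//; apply/negbTE; rewrite -leNgt; lra.
- have E0 q : flat q 0 = 0 by rewrite /flat ltxx.
  rewrite E0; apply: HDP => e e0; rewrite E0.
  (* The exponent 2 pays for the division by [s] and leaves one more factor [s], which tends to
     0. *)
  have [C C0 hC] := poly_expR p 2.
  have C1 : 0 < C + 1 by lra.
  exists (Num.min 1 (e / (C + 1))); first by rewrite lt_min ltr01 divr_gt0.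
  move=> s sN; rewrite !subr0 lt_min => /andP[s1 s2]; rewrite /flat.
  case: ifPn => [s0|_]; last by rewrite mul0r normr0 ltW.
  rewrite gtr0_norm// in s1; rewrite gtr0_norm// in s2.
  have i1 : 1 <= s^-1 by rewrite invf_ge1// ltW.
  have i0 : 0 < s^-1 by rewrite invr_gt0.
  have h := hC _ i1; set y := s^-1 in h i0 *.
  have E : `|p.[y] * expR (- y) / s| = `|p.[y]| * y ^+ 2 * expR (- y) * s.
    rewrite !normrM -/y (gtr0_norm (expR_gt0 _)) (gtr0_norm i0) /y expr2.
    by field; rewrite gt_eqF.
  rewrite E; apply: le_trans (_ : C * s <= _).
    rewrite ler_pM2r// expRN ler_pdivrMr ?expR_gt0//.
  apply: le_trans (_ : (C + 1) * s <= _); first by rewrite ler_pM2r//; lra.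
  by rewrite mulrC -ler_pdivlMr// ltW.
Qed.

Lemma flat_smooth p n : ck n (flat p).
Proof.
elim: n p => [|n IH] p.
  by move=> t; exact: HD_cont (flat_HD p t).
by apply: (ckS (flat_HD p)); exact: IH.
Qed.

Definition bump s : R := flat 1 s.

Lemma bump_gt0 s : 0 < s -> 0 < bump s.
Proof. by move=> s0; rewrite /bump /flat s0 hornerC mul1r expR_gt0. Qed.

Lemma bump0 s : s <= 0 -> bump s = 0.
Proof. by move=> s0; rewrite /bump /flat ltNge s0. Qed.

Lemma bump_ge0 s : 0 <= bump s.
Proof. by have [/bump0->//|/bump_gt0/ltW] := leP s 0. Qed.

Lemma ck_cos n (f : R -> R) : ck n f -> ck n (fun s => cos (f s)).
Proof.
move=> cf; apply: ckcomp => //.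
suff : forall n, ck n (cos : R -> R) /\ ck n (sin : R -> R) by move=> /(_ n)[].
elim=> [|m [IH1 IH2]].
  by split=> s; [exact: continuous_cos|exact: continuous_sin].
split.
  apply: (@ckS _ _ _ (fun s => - sin s)); last exact: ckN.
  by move=> s; exact: is_derive_cos.
by apply: (@ckS _ _ _ cos) => // s; exact: is_derive_sin.
Qed.

(* Powers of cos (pi (t - t0)) have the required sign behaviour under the
   translation by 1. *)
Lemma test_function (sg : bool) (t0 dl : R) : 0 < dl -> dl < t0 -> dl < 1 - t0 ->
  exists phi : R -> R, [/\ smooth phi, forall s, phi (s + 1) = (-1) ^+ sg * phi s,
    forall s, 0 <= s <= 1 -> 0 <= phi s, 0 < phi t0 &
    forall s, 0 <= s <= 1 -> dl <= `|s - t0| -> phi s = 0].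
Proof.
move=> dl0 dlt dlt1.
pose C s : R := cos (pi * (s - t0)).
have pi0 : 0 < pi :> R := pi_gt0 R.
have cC n : ck n C.
  by apply: ck_cos; apply: ckM; [exact: ckc|apply: ckD; [exact: ckid|exact: ckc]].
(* The bump factor is even in [C], hence 1-periodic, and vanishes where |C| <= cos (pi * dl); the
   power of [C] contributes the sign. On [0, 1] only the part of the support around [t0] is met,
   because [t0] is farther than [dl] from both end points. *)
pose phi s := bump (C s ^+ 2 - cos (pi * dl) ^+ 2) * C s ^+ sg.
have C1 s : C (s + 1) = - C s.
  rewrite /C (_ : pi * (s + 1 - t0) = pi * (s - t0) + pi); last by ring.
  by rewrite cosDpi.
have Cn s : C s = cos (pi * `|s - t0|).
  by rewrite /C -[LHS]cos_norm normrM gtr0_norm.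
have cdl : 0 < cos (pi * dl).
  apply: cos_gt0_pihalf; apply/andP; split; first by nra.
  have dlh : dl < 2^-1 by lra.
  by nra.
have near_pos s : `|s - t0| < dl -> 0 < C s.
  move=> sd; rewrite Cn; apply: cos_gt0_pihalf; have := normr_ge0 (s - t0) => ?.
  by apply/andP; split; nra.
have far s : 0 <= s <= 1 -> dl <= `|s - t0| -> phi s = 0.
  move=> s01 sd; rewrite /phi bump0 ?mul0r// subr_le0.
  have h1 : `|s - t0| <= 1 - dl by rewrite ler_distl; lra.
  have mono (a b : R) : 0 <= a -> a <= b -> b <= 1 -> cos (pi * b) <= cos (pi * a).
    move=> a0 ab b1; rewrite leNgt ltr_cos ?in_itv /=; try by apply/andP; split; nra.
    by rewrite -leNgt ler_pM2l.
  have k1 : C s <= cos (pi * dl) by rewrite Cn; apply: mono => //; lra.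
  have k2 : - cos (pi * dl) <= C s.
    rewrite -cosDpi Cn (_ : pi * dl + pi = - (pi * (1 - dl)) + pi *+ 2); last by rewrite mulr2n; ring.
    by rewrite cosD2pi cosN; apply: mono => //; lra.
  by nra.
exists phi; split => //.
- apply: ck_smooth => n; apply: ckM; last exact: ckX.
  by apply: ckcomp; [exact: flat_smooth|apply: ckD; [exact: ckX|exact: ckc]].
- by move=> s; rewrite /phi C1 sqrrN [X in _ * X]exprNn mulrCA.
- move=> s s01; have [sd|sd] := ltP `|s - t0| dl; last by rewrite far.
  by rewrite mulr_ge0 ?bump_ge0// exprn_ge0// ltW// near_pos.
- rewrite mulr_gt0//; last by rewrite exprn_gt0// near_pos// subrr normr0.
  apply: bump_gt0; rewrite /C subrr mulr0 cos0 expr1n subr_gt0.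
  rewrite -(expr1n _ 2) ltr_sqr ?nnegrE ?ltW//.
  by rewrite -[ltRHS]cos0 ltr_cos ?in_itv /= ?lexx ?pi_ge0 ?mulr_gt0//; apply/andP; split; nra.
Qed.

(** [key] excludes a positive value at an interior point and is applied to [D] and to [- D]; the end
    points follow by continuity. The integral tests [D] on [0, 1] only. *)
Lemma fundamental_lemma (sg : bool) (D : R -> R) : continuous D ->
  (forall phi, smooth phi -> (forall s, phi (s + 1) = (-1) ^+ sg * phi s) ->
     prim (fun s => D s * phi s) 1 = 0) ->
  forall s, 0 <= s <= 1 -> D s = 0.
Proof.
move=> cD H.
have key (E : R -> R) t0 : continuous E ->
    (forall phi, smooth phi -> (forall s, phi (s + 1) = (-1) ^+ sg * phi s) ->
       prim (fun s => E s * phi s) 1 = 0) ->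
    0 < t0 < 1 -> ~ 0 < E t0.
  move=> cE HE /andP[t00 t01] E0.
  have [d d0 hd] := (ctP _ _).1 (cE t0) _ E0.
  pose dl := Num.min d (Num.min (t0 / 2) ((1 - t0) / 2)).
  have [dl0 [dld [dl1 dl2]]] : 0 < dl /\ dl <= d /\ dl <= t0 / 2 /\ dl <= (1 - t0) / 2.
    by rewrite /dl !lt_min !ge_min !lexx !orbT; split => //; rewrite d0; lra.
  have [|||phi [sphi pphi phi_ge phi_t0 phi0]] := @test_function sg t0 dl; try lra.
  pose F s := E s * phi s.
  have cphi := smooth_cont sphi.
  have cF : continuous F by move=> s; rewrite /F; ct.
  have F0 s : 0 <= s <= 1 -> 0 <= F s.
    move=> s01; rewrite /F; have [sd|sd] := ltP `|s - t0| dl; last by rewrite phi0// mulr0.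
    rewrite mulr_ge0 ?phi_ge//.
    have := hd s (lt_le_trans sd dld); rewrite ltr_distl => /andP[h _]; lra.
  have mono a b : 0 <= a -> a <= b -> b <= 1 -> prim F a <= prim F b.
    move=> a0 ab b1; have [c] := @mvtT _ (prim F) F a b (fun s => prim_HD s cF).
    rewrite min_l ?max_r// => c1 E2; rewrite -subr_ge0 E2 mulr_ge0 ?subr_ge0//.
    by apply: F0; lra.
  have Z s : 0 <= s <= 1 -> prim F s = 0.
    move=> /andP[s0 s1]; apply/eqP; rewrite eq_le.
    by rewrite -[X in _ <= X](HE phi sphi pphi) mono//= -[X in X <= _](prim0 F) mono.
  have Ft0 : F t0 = 0.
    apply: (@HD_uniq _ (prim F) t0); first exact: prim_HD.
    apply: (@HD_near _ (fun=> 0)); last exact: HDc.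
    apply/nearRP; exists dl => // s; rewrite ltr_distl => /andP[h1 h2].
    by rewrite Z//; lra.
  by move: Ft0 => /eqP; rewrite gt_eqF// mulr_gt0.
have Doo s : 0 < s < 1 -> D s = 0.
  move=> s01; have h1 := key D s cD H s01.
  have cN : continuous (fun s => - D s) by move=> r; ct.
  have h2 : ~ 0 < - D s.
    apply: (key (fun s => - D s) s cN _ s01) => phi h1' h2; have cphi := smooth_cont h1'.
    have cDp : continuous (fun s => D s * phi s) by move=> r; ct.
    rewrite (prim_unique (F := fun s => - prim (fun s => D s * phi s) s)).
    - by rewrite (H phi)// prim0 subrr.
    - by move=> r; ct.
    - by move=> r; have := prim_HD r cDp => h3; der; ring.
  apply/eqP; move: h1 => /negP; rewrite -leNgt => h1.
  move: h2 => /negP; rewrite oppr_gt0 -leNgt => h2.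
  by rewrite eq_le h1.
move=> s s01; apply/eqP/negPn/negP => Ds.
have Ds0 : 0 < `|D s| by rewrite normr_gt0.
have [d d0 hd] := (ctP _ _).1 (cD s) _ Ds0.
pose m := Num.min 1 d.
have [m0 [m1 md]] : 0 < m /\ m <= 1 /\ m <= d.
  by rewrite /m lt_min ltr01 !ge_min !lexx orbT.
pose s' := s + m * (2^-1 - s).
have s'01 : 0 < s' < 1 by rewrite /s'; apply/andP; split; nra.
have := hd s'; rewrite Doo// sub0r normrN ltxx => h.
suff : false by []; apply: h.
by rewrite /s' addrAC subrr add0r ltr_norml; apply/andP; split; nra.
Qed.

End flat.

(** * Critical points and the regularized equations of motion *)

Section regular_def.
Context {R : realType}.
Implicit Types (s t d : R).

Lemma periodic_ind (P : R -> Prop) :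
  (forall s, P s -> P (s + 1)) -> (forall s, P (s + 1) -> P s) ->
  (forall s, 0 <= s <= 1 -> P s) -> forall s, P s.
Proof.
move=> up dn h01 s.
have upn (n : nat) r : P r -> P (r + n%:R).
  by move=> h; elim: n => [|n IH]; rewrite ?addr0// -natr1 addrA; exact: up.
have dnn (n : nat) r : P (r + n%:R) -> P r.
  by elim: n r => [|n IH] r; rewrite ?addr0// -natr1 addrA => /dn; exact: IH.
have [f1 f2] : (Num.floor s)%:~R <= s /\ s < (Num.floor s)%:~R + 1.
  by have /andP[] := mem_rg1_floor s.
case: (Num.floor s) f1 f2 => n f1 f2.
  rewrite -(subrK n%:R s); apply: upn; apply: h01.
  by rewrite -pmulrn in f1 f2; lra.
apply: (dnn n.+1); apply: h01.
by rewrite NegzE mulrNz -pmulrn in f1 f2; lra.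
Qed.

(* The regularized equations of motion of z = (x, y), where (u, v) = z', t is
   the physical time, e the energy and n the squared L2 norm of z. *)
Record regular (Q : set (plane R)) (A : R -> plane R -> plane R)
    (n : R) (t x y u v e : R -> R) : Prop := Regular {
  rg_n : 0 < n;
  rg_Q : forall s, Q (csqr (x s, y s));
  rg_t : forall s, HD t s ((x s ^+ 2 + y s ^+ 2) / n);
  rg_x : forall s, HD x s (u s);
  rg_y : forall s, HD y s (v s);
  rg_u : forall s, HD u s ((e s * x s
     + 2 * n * (x s ^+ 2 + y s ^+ 2) * magnetic A (t s) (csqr (x s, y s)) * v s
     - (x s ^+ 2 + y s ^+ 2) * (x s * (dotA A (t s) (csqr (x s, y s))).1
                              + y s * (dotA A (t s) (csqr (x s, y s))).2)) / (2 * n ^+ 2));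
  rg_v : forall s, HD v s ((e s * y s
     - 2 * n * (x s ^+ 2 + y s ^+ 2) * magnetic A (t s) (csqr (x s, y s)) * u s
     - (x s ^+ 2 + y s ^+ 2) * (x s * (dotA A (t s) (csqr (x s, y s))).2
                              - y s * (dotA A (t s) (csqr (x s, y s))).1)) / (2 * n ^+ 2));
  rg_e : forall s, HD e s (- 2 * ((dotA A (t s) (csqr (x s, y s))).1 * (x s * u s - y s * v s)
                                + (dotA A (t s) (csqr (x s, y s))).2 * (x s * v s + y s * u s)));
  rg_energy : forall s, 2 * n ^+ 2 * (u s ^+ 2 + v s ^+ 2) - 1 = e s * (x s ^+ 2 + y s ^+ 2);
  rg_t0 : t 0 = 0;
  rg_t1 : forall s, t (s + 1) = t s + 1;
  rg_e1 : forall s, e (s + 1) = e s;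
  rg_sg : exists sg : bool, forall s, x (s + 1) = (-1) ^+ sg * x s /\ y (s + 1) = (-1) ^+ sg * y s
}.

Lemma field_dataP (Q : set (plane R)) A f : open Q -> twisted_periodic Q A f ->
  exists At Ax Ay fx fy, field_data Q A f At Ax Ay fx fy.
Proof.
move=> oQ tp.
pose Ah (p : R * plane R) := A p.1 p.2.
pose D v t q := 'D_v Ah (t, q).
pose e1 := (1, 0) : plane R; pose e2 := (0, 1) : plane R.
exists (D (1, (0, 0))), (D (0, (1, 0))), (D (0, (0, 1))), (fun q => 'D_e1 f q), (fun q => 'D_e2 f q).
have sA := Ah_smooth tp; rewrite -/Ah in sA.
have cD v t q : Q q -> {for (t, q), continuous (fun p : R * plane R => D v p.1 p.2)}.
  move=> Qq; have -> : (fun p : R * plane R => D v p.1 p.2) = (fun p => 'D_v Ah p).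
    by apply/funext => -[].
  exact: (((sA 1%N).2 v).2.1 (t, q) (conj I Qq)).
case: (tp) => _ sf dA1 tw1; have f1 := sf 1%N.
split.
- by move=> a b c t da db dc; exact: (chain_field oQ (sA 1%N)).
- by move=> t q Qq; exact: ((sA 1%N).1 (t, q) (conj I Qq)).
- exact: cD.
- exact: cD.
- exact: cD.
- move=> b c t db dc Qq hb hc.
  have cf v : {for (0 : R, (b t, c t)), continuous (fun q : R * plane R => 'D_v f q.2)}.
    exact: (@ctcomp R _ _ (fun q : R * plane R => q.2) (fun q => 'D_v f q)
      (0 : R, (b t, c t)) cvg_snd ((f1.2 v).2.1 _ Qq)).
  apply: HDeq.
    apply: (chain_partials (G := fun q => f q.2) (Gt := fun=> 0) (Gx := fun q => 'D_e1 f q.2)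
      (Gy := fun q => 'D_e2 f q.2) _ _ (cf _) (cf _) (HDc 0 t) hb hc); last exact: ctc.
    apply: (@filterS _ (nbhs (0 : R, (b t, c t))) _ _ _ _ (near_spacetime oQ (p := (0 : R, (b t, c t))) Qq)).
    move=> [w [p q]] [_ /= Qpq]; split; first exact: HDc.
      apply: (line_derive1 (path := fun s : R => (s, q)) erefl _ ((f1.2 e1).1 _ Qpq)) => h.
      by congr (_, _); rewrite /= scaler0 add0r.
    apply: (line_derive1 (path := fun s : R => (p, s)) erefl _ ((f1.2 e2).1 _ Qpq)) => h.
    by congr (_, _); rewrite /= scaler0 add0r.
  by rewrite mulr0 add0r.
- by move=> t q Qq; rewrite tw1.
- by move=> t q Qq; rewrite (dotAE tp).
- by move=> t q Qq; rewrite (magneticE tp).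
- move=> k F FE a b c Qbc ha hb hc.
  have K v : ck k (fun s => (D v (a s) (b s, c s)).1) /\ ck k (fun s => (D v (a s) (b s, c s)).2).
    exact: (ck_field oQ ((sA k.+1).2 v).2 Qbc ha hb hc).
  by case: FE => [|[]] ->; exact: K.
- by move=> t q Qq; rewrite dA1.
- by move=> t q Qq; rewrite (magnetic_periodic oQ tp).
Qed.

End regular_def.

Section euler_lagrange.
Context {R : realType}.
Implicit Types (s t d : R).

(** [F] is controlled on [0, 1] only, so at an end point the derivative is read off from the inside:
    the point [r] is displaced into the interval. *)
Lemma HD_zero_on (F : R -> R) s d : 0 <= s <= 1 -> HD F s d ->
  (forall r, 0 <= r <= 1 -> F r = 0) -> d = 0.
Proof.
move=> s01 /is_derive1_caratheodory [g [gE cg gs]] F0.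
apply/eqP/negPn/negP => dN.
have d0 : 0 < `|d| by rewrite normr_gt0.
have [dl dl0 hd] := (ctP _ _).1 cg _ d0.
pose m := Num.min 1 dl / 2.
have [m0 [m1 md]] : 0 < m /\ m < 1 /\ m < dl.
  have : Num.min 1 dl <= 1 by rewrite ge_min lexx.
  have : Num.min 1 dl <= dl by rewrite ge_min lexx orbT.
  have : 0 < Num.min 1 dl by rewrite lt_min ltr01.
  by rewrite /m => *; repeat split; lra.
pose r := if s <= 2^-1 then s + m * 2^-1 else s - m * 2^-1.
have [r01 [rs rd]] : 0 <= r <= 1 /\ r - s != 0 /\ `|r - s| < dl.
  rewrite /r; case: ifPn => [h|]; last rewrite -ltNge => h.
    have -> : s + m * 2^-1 - s = m * 2^-1 by ring.
    rewrite gtr0_norm; last by lra.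
    by split; [lra|split; [apply/eqP; lra|lra]].
  have -> : s - m * 2^-1 - s = - (m * 2^-1) by ring.
  rewrite normrN gtr0_norm; last by lra.
  by split; [lra|split; [apply/eqP; lra|lra]].
have := gE r; rewrite !F0// subrr => /esym/eqP; rewrite mulf_eq0 (negbTE rs) orbF => /eqP gr.
by have := hd _ rd; rewrite gr gs sub0r normrN ltxx.
Qed.

Lemma prim_gt0 (f : R -> R) s : continuous f -> (forall r, 0 <= f r) ->
  0 <= s <= 1 -> 0 < f s -> 0 < prim f 1.
Proof.
move=> cf f0 s01 fs; rewrite ltNge; apply/negP => le0.
have mono a b : a <= b -> prim f a <= prim f b.
  move=> ab; have [c _ E] := @mvtT _ (prim f) f a b (fun s => prim_HD s cf).
  by rewrite -subr_ge0 E mulr_ge0 ?subr_ge0.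
have Z r : 0 <= r <= 1 -> prim f r = 0.
  move=> /andP[r0 r1]; apply/eqP; rewrite eq_le.
  by rewrite (le_trans (mono _ _ r1) le0)/= -(prim0 f) mono.
by have := HD_zero_on s01 (prim_HD s cf) Z => E; rewrite E ltxx in fs.
Qed.

Lemma HD_shift (f : R -> R) s d : HD f (s + 1) d -> HD (fun s => f (s + 1)) s d.
Proof.
move=> h; have hs : HD (fun s : R => s + 1) s 1 by der; ring.
by apply: HDeq; [exact: (HDcomp (g := fun s => s + 1)) h hs|rewrite mulr1].
Qed.

Lemma deriv_twist (k : R) (x u : R -> R) : (forall s, HD x s (u s)) ->
  (forall s, x (s + 1) = k * x s) -> forall s, u (s + 1) = k * u s.
Proof.
move=> hx xk s; have h1 := HD_shift (hx (s + 1)).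
have h2 : HD (fun s => x (s + 1)) s (k * u s).
  by under eq_fun do rewrite xk; der; ring.
exact: HD_uniq h1 h2.
Qed.

Lemma periodic_prim (f : R -> R) s : continuous f -> (forall s, f (s + 1) = f s) ->
  prim f (s + 1) = prim f s + prim f 1.
Proof.
move=> cf pf; have h := @HD0_const R (fun s => prim f (s + 1) - prim f s) s 0.
have : prim f (s + 1) - prim f s = prim f (0 + 1) - prim f 0.
  apply: h => r; apply: HDeq; first by apply: HDD; [apply: HD_shift; exact: prim_HD|apply: HDN; exact: prim_HD].
  by rewrite pf subrr.
by rewrite prim0 subr0 add0r => <-; ring.
Qed.

(* At a zero of order two the other factor need not be differentiable. *)
Lemma HD_mul_double_zero (r w : R -> R) s : HD r s 0 -> r s = 0 ->
  {for s, continuous w} -> HD (fun s => r s * w s) s 0.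
Proof.
move=> /is_derive1_caratheodory [g [gE cg gs]] r0 cw.
apply/is_derive1_caratheodory; exists (fun z => g z * w z); split.
- by move=> z; have := gE z; rewrite r0 subr0 mul0r subr0 => ->; ring.
- exact: ctM.
- by rewrite gs mul0r.
Qed.

Section fields.
Variables (Q : set (plane R)) (A At Ax Ay : R -> plane R -> plane R).
Variables (f fx fy : plane R -> R).
Hypothesis oQ : open Q.
Hypothesis fd : field_data Q A f At Ax Ay fx fy.

Section critical.
Variables (x y u v u2 v2 u3 v3 : R -> R) (sg : bool).
Hypotheses (hx : forall s, HD x s (u s)) (hy : forall s, HD y s (v s)).
Hypotheses (hu : forall s, HD u s (u2 s)) (hv : forall s, HD v s (v2 s)).
Hypotheses (hu2 : forall s, HD u2 s (u3 s)) (hv2 : forall s, HD v2 s (v3 s)).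
Hypothesis Qz : forall s, Q (csqr (x s, y s)).
Hypotheses (xs : forall s, x (s + 1) = (-1) ^+ sg * x s).
Hypotheses (ys : forall s, y (s + 1) = (-1) ^+ sg * y s).
Hypothesis vn0 : 0 < vn x y.
Hypothesis E1_0 : forall s, 0 <= s <= 1 -> vE1 At Ax Ay x y u v u2 s = 0.
Hypothesis E2_0 : forall s, 0 <= s <= 1 -> vE2 At Ax Ay x y u v v2 s = 0.

Let n := vn x y.
Let t := vt x y.
Let r := vr x y.
Let a1 := va1 At x y.
Let a2 := va2 At x y.
Let b := vb Ax Ay x y.
Let g := vg At x y u v.
Let Gam := vGam At x y u v.
Let Mu := vMu At x y u v.
Let M := vM u v.
(** Up to the field terms, this is n / 2 times the coefficient of z in the Euler-Lagrange
    expression. It changes by - 2 * Gam 1 over one period, so its periodicity amounts to [Gam1]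
    below. *)
Let e s := 2 * n * M - 1 / n + 2 * (Gam 1 - Gam s - Mu 1).
Let k : R := (-1) ^+ sg.

Let cu2 := HD_continuous hu2.
Let cv2 := HD_continuous hv2.
Let cx := HD_continuous hx.
Let cy := HD_continuous hy.
Let cu := HD_continuous hu.
Let cv := HD_continuous hv.
Let cr : continuous r. Proof. by move=> s; rewrite /r /vr; ct. Qed.
Let nN : n != 0. Proof. by rewrite gt_eqF. Qed.

Let k2 : k * k = 1.
Proof. by rewrite /k -expr2 sqrr_sign. Qed.

Let us s : u (s + 1) = k * u s. Proof. exact: deriv_twist hx xs s. Qed.
Let vs s : v (s + 1) = k * v s. Proof. exact: deriv_twist hy ys s. Qed.
Let u2s s : u2 (s + 1) = k * u2 s. Proof. exact: deriv_twist hu us s. Qed.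
Let v2s s : v2 (s + 1) = k * v2 s. Proof. exact: deriv_twist hv vs s. Qed.
Let u3s s : u3 (s + 1) = k * u3 s. Proof. exact: deriv_twist hu2 u2s s. Qed.
Let v3s s : v3 (s + 1) = k * v3 s. Proof. exact: deriv_twist hv2 v2s s. Qed.

Let kk (p q : R) : (k * p) * (k * q) = p * q.
Proof. by transitivity (k * k * (p * q)); [ring|rewrite k2 mul1r]. Qed.

Let zs s : csqr (x (s + 1), y (s + 1)) = csqr (x s, y s).
Proof. by rewrite xs ys -/k /csqr /= !kk. Qed.
Let rs s : r (s + 1) = r s.
Proof. by rewrite /r /vr xs ys -/k !expr2 !kk. Qed.

Let ht s : HD t s (r s / n). Proof. exact (vt_HD hx hy s). Qed.
Let t0 : t 0 = 0. Proof. by rewrite /t /vt prim0 mul0r. Qed.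
Let ts s : t (s + 1) = t s + 1.
Proof. by rewrite /t /vt periodic_prim// mulrDl -/(vn x y) divff. Qed.

Let a1E s : a1 s = (dotA A (t s) (csqr (x s, y s))).1.
Proof. by rewrite (fd_dotA fd). Qed.
Let a2E s : a2 s = (dotA A (t s) (csqr (x s, y s))).2.
Proof. by rewrite (fd_dotA fd). Qed.
Let bE s : b s = magnetic A (t s) (csqr (x s, y s)).
Proof. by rewrite (fd_magnetic fd). Qed.
Let a1s s : a1 (s + 1) = a1 s.
Proof. by rewrite !a1E ts zs (fd_dotA1 fd). Qed.
Let a2s s : a2 (s + 1) = a2 s.
Proof. by rewrite !a2E ts zs (fd_dotA1 fd). Qed.
Let bs s : b (s + 1) = b s.
Proof. by rewrite !bE ts zs (fd_magnetic1 fd). Qed.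
Let gs s : g (s + 1) = g s.
Proof.
rewrite /g /vg -/(a1 _) -/(a2 _) -/(a1 s) -/(a2 s) a1s a2s xs ys us vs -/k.
by rewrite -!/(k * _) !kk.
Qed.

Let ca1 : continuous a1. Proof. exact (va1_cont fd hx hy Qz). Qed.
Let ca2 : continuous a2. Proof. exact (va2_cont fd hx hy Qz). Qed.
Let cb : continuous b. Proof. exact (vb_cont fd hx hy Qz). Qed.
Let hGam s : HD Gam s (g s). Proof. exact (vGam_HD fd hx hy hu hv Qz s). Qed.
Let hMu s : HD Mu s (g s * t s). Proof. exact (vMu_HD fd hx hy hu hv Qz s). Qed.
Let cg : continuous g. Proof. exact (vg_cont fd hx hy hu hv Qz). Qed.
Let he s : HD e s (- 2 * g s). Proof. by rewrite /e; der; ring. Qed.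

Let w1 s := 2 * n * b s * v s - (x s * a1 s + y s * a2 s).
Let w2 s := - (2 * n * b s * u s) - (x s * a2 s - y s * a1 s).

Let I1 s : 0 <= s <= 1 -> 2 * n ^+ 2 * u2 s = e s * x s + r s * w1 s.
Proof.
move=> /E1_0; rewrite /vE1 -/n -/M -/(b s) -/(r s) -/Gam -/Mu -/(a1 s) -/(a2 s) => E.
apply/eqP; rewrite -subr_eq0; apply/eqP.
transitivity (- (n / 2) * 0); last by rewrite mulr0.
by rewrite -E /e /w1; field.
Qed.

Let I2 s : 0 <= s <= 1 -> 2 * n ^+ 2 * v2 s = e s * y s + r s * w2 s.
Proof.
move=> /E2_0; rewrite /vE2 -/n -/M -/(b s) -/(r s) -/Gam -/Mu -/(a1 s) -/(a2 s) => E.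
apply/eqP; rewrite -subr_eq0; apply/eqP.
transitivity (- (n / 2) * 0); last by rewrite mulr0.
by rewrite -E /e /w2; field.
Qed.

Let N s := 2 * n ^+ 2 * (u s ^+ 2 + v s ^+ 2) - 1 - e s * r s.

(** The magnetic term does no work, and the work of [a] is compensated by the derivative of [e]. The
    equations of motion are so far known on [0, 1] only. *)
Let N_const s : 0 <= s <= 1 -> N s = N 0.
Proof.
move=> s01.
pose dN s := 4 * n ^+ 2 * (u s * u2 s + v s * v2 s) + 2 * g s * r s
  - 2 * e s * (x s * u s + y s * v s).
have hN q : HD N q (dN q).
  by rewrite /N /r /vr /dN /r /vr; der; ring.
have [c] := @mvtT _ N dN 0 s hN; rewrite min_l ?max_r; try lra.
move=> c0s /eqP; rewrite (_ : dN c = 0) ?mul0r ?subr_eq0; first by move=> /eqP.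
have c01 : 0 <= c <= 1 by lra.
rewrite /dN (_ : 4 * n ^+ 2 * (u c * u2 c + v c * v2 c)
  = 2 * u c * (2 * n ^+ 2 * u2 c) + 2 * v c * (2 * n ^+ 2 * v2 c)); last by ring.
rewrite I1// I2// /w1 /w2 /g /vg -/(a1 c) -/(a2 c); ring.
Qed.

(* The mean of the energy identity holds by the choice of the constant in e. *)
Let N0 s : 0 <= s <= 1 -> N s = 0.
Proof.
pose P := prim r; pose m s := u s ^+ 2 + v s ^+ 2.
have cm : continuous m by move=> q; rewrite /m; ct.
(* A primitive of [N]; the product of [Gam] and [r] is integrated by parts with P = n t, which
   brings in [Mu]. As J 0 = J 1, the function [N] has a zero in [0, 1], where it is constant. *)
pose J s := 2 * n ^+ 2 * prim m s - s
  - ((2 * n * M - 1 / n + 2 * (Gam 1 - Mu 1)) * P s - 2 * (Gam s * P s - n * Mu s)).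
have hJ q : HD J q (N q).
  have hm := prim_HD q cm; have hP := prim_HD q cr.
  rewrite /J /P; der; rewrite /N /e /m /t /vt -/n.
  by field.
have J0 : J 0 = 0.
  rewrite /J /P !prim0 /Gam /Mu /vGam /vMu !prim0; ring.
have J1 : J 1 = 0.
  rewrite /J /P -/n; have -> : prim r 1 = n by [].
  have -> : prim m 1 = M by [].
  by field.
have [c] := @mvtT _ J N 0 1 hJ; rewrite J0 J1 min_l ?max_r ?ler01// => c01.
rewrite !subr0 mulr1 => /esym Nc s01.
by rewrite N_const// -(N_const c01).
Qed.

(** If z(0) is nonzero, the energy identity at 0 and at 1 gives e 0 = e 1. If z(0) = 0 it says
    nothing about [e]; then the equation is differentiated once more, 2 n^2 z''' = e z' at both
    ends, and z'(0) is nonzero by the energy identity. *)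
Let Gam1 : Gam 1 = 0.
Proof.
have e01 : e 0 - e 1 = 2 * Gam 1.
  rewrite /e /Gam /vGam prim0; ring.
have i0 : 0 <= (0 : R) <= 1 by rewrite lexx ler01.
have i1 : 0 <= (1 : R) <= 1 by rewrite lexx ler01.
have r10 : r 1 = r 0 by rewrite -(rs 0) add0r.
have [r0|r0] := eqVneq (r 0) 0; last first.
  have := N0 i0; have := N0 i1; rewrite /N r10.
  have -> : u 1 = k * u 0 by rewrite -us add0r.
  have -> : v 1 = k * v 0 by rewrite -vs add0r.
  rewrite !expr2 !kk => h1 h2.
  have : (e 0 - e 1) * r 0 = 0 by lra.
  move/eqP; rewrite mulf_eq0 (negbTE r0) orbF e01 => /eqP; lra.
have [x0 y0] : x 0 = 0 /\ y 0 = 0 := sqrD_eq0 r0.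
have x1 : x 1 = 0 by rewrite -(add0r 1) xs x0 mulr0.
have y1 : y 1 = 0 by rewrite -(add0r 1) ys y0 mulr0.
have cw1 : continuous w1 by move=> s; rewrite /w1; ct.
have cw2 : continuous w2 by move=> s; rewrite /w2; ct.
have hr (s : R) : x s = 0 -> y s = 0 -> HD r s 0.
  by move=> xs0 ys0; rewrite /r /vr; der; rewrite xs0 ys0; ring.
have D1 s : 0 <= s <= 1 -> x s = 0 -> y s = 0 -> 2 * n ^+ 2 * u3 s = e s * u s.
  move=> s01 xs0 ys0; have r0s : r s = 0 by rewrite /r /vr xs0 ys0; ring.
  have h := HD_mul_double_zero (hr s xs0 ys0) r0s (@cw1 s).
  have h' : HD (fun s => 2 * n ^+ 2 * u2 s - e s * x s - r s * w1 s) s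
      (2 * n ^+ 2 * u3 s - e s * u s - 0).
    apply: HDD; last exact: HDN h.
    by der; rewrite xs0; ring.
  have := HD_zero_on s01 h' _ => /(_ _)E; apply/eqP; rewrite -subr_eq0; apply/eqP.
  by rewrite -[LHS]subr0; apply: E => q /I1 ->; ring.
have D2 s : 0 <= s <= 1 -> x s = 0 -> y s = 0 -> 2 * n ^+ 2 * v3 s = e s * v s.
  move=> s01 xs0 ys0; have r0s : r s = 0 by rewrite /r /vr xs0 ys0; ring.
  have h := HD_mul_double_zero (hr s xs0 ys0) r0s (@cw2 s).
  have h' : HD (fun s => 2 * n ^+ 2 * v2 s - e s * y s - r s * w2 s) s
      (2 * n ^+ 2 * v3 s - e s * v s - 0).
    apply: HDD; last exact: HDN h.
    by der; rewrite ys0; ring.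
  have := HD_zero_on s01 h' _ => /(_ _)E; apply/eqP; rewrite -subr_eq0; apply/eqP.
  by rewrite -[LHS]subr0; apply: E => q /I2 ->; ring.
have u31 : u3 1 = k * u3 0 by rewrite -u3s add0r.
have v31 : v3 1 = k * v3 0 by rewrite -v3s add0r.
have u11 : u 1 = k * u 0 by rewrite -us add0r.
have v11 : v 1 = k * v 0 by rewrite -vs add0r.
have A1 := D1 0 i0 x0 y0; have A2 := D1 1 i1 x1 y1.
have B1 := D2 0 i0 x0 y0; have B2 := D2 1 i1 x1 y1.
have kN : k != 0 by apply/eqP => k0; move: k2; rewrite k0 mul0r => /eqP; rewrite eq_sym oner_eq0.
have eu : (e 0 - e 1) * u 0 = 0.
  have : k * ((e 0 - e 1) * u 0) = 0.
    rewrite mulrBl mulrBr -A1 mulrCA -u31 A2 u11; ring.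
  by move/eqP; rewrite mulf_eq0 (negbTE kN) => /eqP.
have ev : (e 0 - e 1) * v 0 = 0.
  have : k * ((e 0 - e 1) * v 0) = 0.
    rewrite mulrBl mulrBr -B1 mulrCA -v31 B2 v11; ring.
  by move/eqP; rewrite mulf_eq0 (negbTE kN) => /eqP.
have := N0 i0; rewrite /N r0 mulr0 subr0 => N00.
have : e 0 - e 1 = 0.
  transitivity (2 * n ^+ 2 * (u 0 * ((e 0 - e 1) * u 0) + v 0 * ((e 0 - e 1) * v 0))
     - (e 0 - e 1) * (2 * n ^+ 2 * (u 0 ^+ 2 + v 0 ^+ 2) - 1)); first by ring.
  by rewrite eu ev N00; ring.
by rewrite e01 => ?; lra.
Qed.

Let es s : e (s + 1) = e s.
Proof. by rewrite /e /Gam /vGam -/g periodic_prim// -/(vGam At x y u v 1) -/Gam Gam1 addr0. Qed.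

Let kinj (p q : R) : k * p = k * q -> p = q.
Proof. by move=> h; rewrite -[p]mul1r -k2 -mulrA h mulrA k2 mul1r. Qed.

Lemma critical_system : regular Q A n t x y u v e.
Proof.
have w1s s : w1 (s + 1) = k * w1 s.
  by rewrite /w1 a1s a2s bs vs xs ys -/k; ring.
have w2s s : w2 (s + 1) = k * w2 s.
  by rewrite /w2 a1s a2s bs us xs ys -/k; ring.
(* With [e] periodic, both sides acquire the sign [k] under translation by 1, so the equation
   spreads from [0, 1] to the line. *)
have J1 : forall s, 2 * n ^+ 2 * u2 s = e s * x s + r s * w1 s.
  apply: periodic_ind => s; last exact: I1.
    move=> h; rewrite u2s es xs rs w1s -/k.
    by transitivity (k * (2 * n ^+ 2 * u2 s)); [ring|rewrite h; ring].
  rewrite u2s es xs rs w1s -/k => h; apply: kinj.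
  by transitivity (2 * n ^+ 2 * (k * u2 s)); [ring|rewrite h; ring].
have J2 : forall s, 2 * n ^+ 2 * v2 s = e s * y s + r s * w2 s.
  apply: periodic_ind => s; last exact: I2.
    move=> h; rewrite v2s es ys rs w2s -/k.
    by transitivity (k * (2 * n ^+ 2 * v2 s)); [ring|rewrite h; ring].
  rewrite v2s es ys rs w2s -/k => h; apply: kinj.
  by transitivity (2 * n ^+ 2 * (k * v2 s)); [ring|rewrite h; ring].
have JN : forall s, N s = 0.
  have Ns s : N (s + 1) = N s by rewrite /N us vs es rs !expr2 !kk.
  by apply: periodic_ind => s; [rewrite Ns|rewrite Ns|exact: N0].
split.
- exact: vn0.
- exact: Qz.
- exact: ht.
- exact: hx.
- exact: hy.
- move=> s; rewrite -a1E -a2E -bE; apply: HDeq; first exact: hu.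
  rewrite (_ : u2 s = (2 * n ^+ 2 * u2 s) / (2 * n ^+ 2)); last by field.
  by rewrite J1 /w1 /r /vr; congr (_ / _); ring.
- move=> s; rewrite -a1E -a2E -bE; apply: HDeq; first exact: hv.
  rewrite (_ : v2 s = (2 * n ^+ 2 * v2 s) / (2 * n ^+ 2)); last by field.
  by rewrite J2 /w2 /r /vr; congr (_ / _); ring.
- by move=> s; rewrite -a1E -a2E.
- by move=> s; have := JN s; rewrite /N => /eqP; rewrite subr_eq0 => /eqP.
- exact: t0.
- exact: ts.
- exact: es.
- by exists sg => s; split.
Qed.

End critical.
End fields.
End euler_lagrange.

Section critical_regular.
Context {R : realType}.
Implicit Types (s t d : R).
Variables (Q : set (plane R)) (A At Ax Ay : R -> plane R -> plane R).
Variables (f fx fy : plane R -> R).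
Hypothesis oQ : open Q.
Hypothesis fd : field_data Q A f At Ax Ay fx fy.

Lemma variation_formula (x y u v u2 v2 : R -> R) (g h dg dh : R -> R) (sg : bool) :
  (forall s, HD x s (u s)) -> (forall s, HD y s (v s)) ->
  (forall s, HD u s (u2 s)) -> (forall s, HD v s (v2 s)) ->
  continuous u2 -> continuous v2 -> (forall s, Q (csqr (x s, y s))) -> 0 < vn x y ->
  (forall s, HD g s (dg s)) -> (forall s, HD h s (dh s)) ->
  continuous dg -> continuous dh ->
  (forall s, x (s + 1) = (-1) ^+ sg * x s) -> (forall s, y (s + 1) = (-1) ^+ sg * y s) ->
  (forall s, g (s + 1) = (-1) ^+ sg * g s) -> (forall s, h (s + 1) = (-1) ^+ sg * h s) ->
  HD (fun e => action A f (fun s => (x s + e * g s, y s + e * h s))) 0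
    (prim (fun s => vE1 At Ax Ay x y u v u2 s * g s + vE2 At Ax Ay x y u v v2 s * h s) 1).
Proof.
move=> hx hy hu hv cu2 cv2 Qz n0 hg hh cdg cdh xs ys gs hs.
rewrite prim1E.
have us := deriv_twist hx xs; have vs := deriv_twist hy ys.
by apply: (first_variation oQ fd hx hy hu hv cu2 cv2 Qz n0 hg hh cdg cdh
  (sg := (-1) ^+ sg)); rewrite -?expr2 ?sqrr_sign// -[in LHS](add0r 1).
Qed.

Lemma twisted_components (s : bool) Z (z : R -> plane R) : twisted_loop s Z z ->
  [/\ smooth (fun t => (z t).1), smooth (fun t => (z t).2), (forall t, Z (z t)),
      (forall t, (z (t + 1)).1 = (-1) ^+ s * (z t).1) &
      (forall t, (z (t + 1)).2 = (-1) ^+ s * (z t).2)].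
Proof.
move=> [sz Zz tz]; have [s1 s2] := curve_smooth sz.
by split => // t; rewrite tz.
Qed.

Lemma twisted_loopP (s : bool) (g h : R -> R) : smooth g -> smooth h ->
  (forall t, g (t + 1) = (-1) ^+ s * g t) -> (forall t, h (t + 1) = (-1) ^+ s * h t) ->
  twisted_loop s [set: plane R] (fun t => (g t, h t)).
Proof.
move=> sg sh gt ht; split; first exact (@smooth_curveP R (fun t => (g t, h t)) sg sh).
  by move=> t; exact: I.
by move=> t; rewrite gt ht.
Qed.

Lemma vn_gt0 (s : bool) (x y : R -> R) : continuous x -> continuous y ->
  (forall t, x (t + 1) = (-1) ^+ s * x t) -> (forall t, y (t + 1) = (-1) ^+ s * y t) ->
  (exists t, (x t, y t) <> (0, 0)) -> 0 < vn x y.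
Proof.
move=> cx cy xs ys [t0 nz].
have cr : continuous (vr x y) by move=> t; rewrite /vr; ct.
have r0 t : 0 <= vr x y t by rewrite addr_ge0// sqr_ge0.
have [[t [t01 rt]]|no] := pselect (exists t, 0 <= t <= 1 /\ 0 < vr x y t).
  exact: prim_gt0 cr r0 t01 rt.
have Z : forall t, vr x y t = 0.
  have rs t : vr x y (t + 1) = vr x y t by rewrite /vr xs ys !exprMn sqrr_sign !mul1r.
  apply: periodic_ind => t; rewrite ?rs// => t01.
  apply/eqP; rewrite eq_le r0 andbT leNgt; apply/negP => rt.
  by apply: no; exists t.
exfalso; apply: nz; have /eqP := Z t0.
by rewrite /vr paddr_eq0 ?sqr_ge0// !sqrf_eq0 => /andP[/eqP -> /eqP ->].
Qed.

Let addM0 (a b c : R) : a * b = a * b + c * 0.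
Proof. by rewrite mulr0 addr0. Qed.
Let add0M (a b c : R) : a * b = c * 0 + a * b.
Proof. by rewrite mulr0 add0r. Qed.

Lemma critical_regular z : critical Q A f z ->
  exists n u v e, regular Q A n (time_repar z) (fun s => (z s).1) (fun s => (z s).2) u v e.
Proof.
move=> [sg [[tz znz] crit]].
have [s1 s2 Qz xs ys] := twisted_components tz.
pose x s := (z s).1; pose y s := (z s).2.
have zE s : z s = (x s, y s) by rewrite -surjective_pairing.
pose u := x^`()%classic; pose v := y^`()%classic.
pose u2 := u^`()%classic; pose v2 := v^`()%classic.
have su := smooth_derive1 s1; have sv := smooth_derive1 s2.
have su2 := smooth_derive1 su; have sv2 := smooth_derive1 sv.
have hx := smooth_HD s1; have hy := smooth_HD s2.
have hu := smooth_HD su; have hv := smooth_HD sv.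
have hu2 := smooth_HD su2; have hv2 := smooth_HD sv2.
have cu2 := smooth_cont su2; have cv2 := smooth_cont sv2.
have Qz' s : Q (csqr (x s, y s)) by rewrite -zE; exact: Qz.
have n0 : 0 < vn x y.
  apply: (vn_gt0 (smooth_cont s1) (smooth_cont s2) xs ys).
  apply: contrapT => no; apply: znz; apply/funext => s.
  by apply: contrapT => ne; apply: no; exists s; rewrite -zE.
have test g h : smooth g -> smooth h -> (forall t, g (t + 1) = (-1) ^+ sg * g t) ->
    (forall t, h (t + 1) = (-1) ^+ sg * h t) ->
    prim (fun s => vE1 At Ax Ay x y u v u2 s * g s + vE2 At Ax Ay x y u v v2 s * h s) 1 = 0.
  move=> sg' sh gt ht.
  have F := @variation_formula x y u v u2 v2 g h _ _ sg hx hy hu hv cu2 cv2 Qz' n0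
    (smooth_HD sg') (smooth_HD sh) (smooth_cont (smooth_derive1 sg'))
    (smooth_cont (smooth_derive1 sh)) xs ys gt ht.
  have C := crit _ (twisted_loopP sg' sh gt ht).
  apply: HD_uniq F _.
  have -> : (fun e => action A f (fun s => (x s + e * g s, y s + e * h s))) =
      (fun e => action A f (fun s => z s + e *: ((g s, h s) : plane R))).
    by apply/funext => e; congr (action A f); apply/funext => s; rewrite zE.
  exact: C.
have s0 : smooth (fun=> 0 : R) by apply: ck_smooth => k; exact: ckc.
have z0 t : (0 : R) = (-1) ^+ sg * 0 by rewrite mulr0.
have [h1 h2] : continuous (vE1 At Ax Ay x y u v u2) /\ continuous (vE2 At Ax Ay x y u v v2).
  exact (vE_cont fd hx hy hu hv cu2 cv2 Qz').
have E1 : forall s, 0 <= s <= 1 -> vE1 At Ax Ay x y u v u2 s = 0.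
  apply: (@fundamental_lemma _ sg _ h1) => phi sphi pphi.
  rewrite -(test phi (fun=> 0) sphi s0 pphi z0); congr (prim _ 1); apply/funext => s.
  exact: (addM0 (vE1 At Ax Ay x y u v u2 s) (phi s) (vE2 At Ax Ay x y u v v2 s)).
have E2 : forall s, 0 <= s <= 1 -> vE2 At Ax Ay x y u v v2 s = 0.
  apply: (@fundamental_lemma _ sg _ h2) => phi sphi pphi.
  rewrite -(test (fun=> 0) phi s0 sphi z0 pphi); congr (prim _ 1); apply/funext => s.
  exact: (add0M (vE2 At Ax Ay x y u v v2 s) (phi s) (vE1 At Ax Ay x y u v u2 s)).
have := critical_system fd hx hy hu hv hu2 hv2 Qz' xs ys n0 E1 E2.
have -> : vt x y = time_repar z.
  by apply/funext => s; rewrite (time_reparE s zE).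
by move=> reg; do 4 eexists; exact: reg.
Qed.

(** * Solutions of the regularized equations are critical *)

Section converse.
Variables (n : R) (t x y u v e : R -> R).
Hypothesis reg : regular Q A n t x y u v e.

Let n0 := rg_n reg.
Let nN : n != 0. Proof. by rewrite gt_eqF. Qed.
Let Qz := rg_Q reg.
Let hx := rg_x reg.
Let hy := rg_y reg.
Let ht := rg_t reg.
Let cx := HD_continuous hx.
Let cy := HD_continuous hy.
Let cr : continuous (vr x y). Proof. by move=> s; rewrite /vr; ct. Qed.

Lemma reg_prim s : prim (vr x y) s = n * t s.
Proof.
rewrite (prim_unique (F := fun s => n * t s)) ?(rg_t0 reg) ?mulr0 ?subr0//.
by move=> q; have h := ht q; der; rewrite /vr; field.
Qed.

Lemma reg_n : vn x y = n.
Proof. by rewrite /vn reg_prim -(add0r 1) (rg_t1 reg) (rg_t0 reg) add0r mulr1. Qed.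

Lemma reg_t : vt x y = t.
Proof. by apply/funext => s; rewrite /vt reg_n reg_prim mulrC mulKf. Qed.

Lemma reg_time z : (forall s, z s = (x s, y s)) -> time_repar z = t.
Proof. by move=> zE; apply/funext => s; rewrite (time_reparE s zE) -reg_t. Qed.

(** Bootstrapping: if all six functions are of class C^k, so are the right-hand sides of their
    equations. *)
Lemma regular_ck k : [/\ ck k t /\ ck k e, ck k x /\ ck k y & ck k u /\ ck k v].
Proof.
elim: k => [|k [[ct ce] [cx' cy'] [cu cv]]].
  split; split => s; [exact: HD_cont (ht s)|exact: HD_cont (rg_e reg s)|exact: cx|exact: cy|
    exact: HD_cont (rg_u reg s)|exact: HD_cont (rg_v reg s)].
have cq1 : ck k (fun s => x s * x s - y s * y s).
  by apply: ckD; [exact: ckM|apply: ckN; exact: ckM].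
have cq2 : ck k (fun s => x s * y s + y s * x s) by apply: ckD; exact: ckM.
have K F : F = At \/ F = Ax \/ F = Ay ->
    ck k (fun s => (F (t s) (csqr (x s, y s))).1) /\ ck k (fun s => (F (t s) (csqr (x s, y s))).2).
  by move=> FE; exact: (fd_ck fd FE Qz ct cq1 cq2).
have [K1 K2] := K At (or_introl erefl).
have [_ K3] := K Ax (or_intror (or_introl erefl)).
have [K4 _] := K Ay (or_intror (or_intror erefl)).
have ca1 : ck k (fun s => (dotA A (t s) (csqr (x s, y s))).1).
  by under eq_fun do rewrite (fd_dotA fd)//.
have ca2 : ck k (fun s => (dotA A (t s) (csqr (x s, y s))).2).
  by under eq_fun do rewrite (fd_dotA fd)//.
have cb : ck k (fun s => magnetic A (t s) (csqr (x s, y s))).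
  by under eq_fun do rewrite (fd_magnetic fd)//; apply: ckD => //; exact: ckN.
have cr' : ck k (fun s => x s ^+ 2 + y s ^+ 2) by apply: ckD; exact: ckX.
split; split.
- by apply: (ckS (rg_t reg)); apply: ckM cr' (ckc _ _).
- apply: (ckS (rg_e reg)); ckt.
- exact: ckS (rg_x reg) cu.
- exact: ckS (rg_y reg) cv.
- by apply: (ckS (rg_u reg)); ckt.
- by apply: (ckS (rg_v reg)); ckt.
Qed.

Lemma regular_critical : critical Q A f (fun s => (x s, y s)).
Proof.
have [sg hsg] := rg_sg reg.
have xs s : x (s + 1) = (-1) ^+ sg * x s := (hsg s).1.
have ys s : y (s + 1) = (-1) ^+ sg * y s := (hsg s).2.
have sx : smooth x by apply: ck_smooth => k; have [_ [h1 _] _] := regular_ck k; exact: h1.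
have sy : smooth y by apply: ck_smooth => k; have [_ [_ h1] _] := regular_ck k; exact: h1.
have ux : x^`()%classic = u by apply/funext => s; exact: HD_val (hx s).
have vy : y^`()%classic = v by apply/funext => s; exact: HD_val (hy s).
have su : smooth u by rewrite -ux; exact: smooth_derive1.
have sv : smooth v by rewrite -vy; exact: smooth_derive1.
have hu := smooth_HD su; have hv := smooth_HD sv.
pose u2 := u^`()%classic; pose v2 := v^`()%classic.
have cu2 := smooth_cont (smooth_derive1 su); have cv2 := smooth_cont (smooth_derive1 sv).
have cu := smooth_cont su; have cv := smooth_cont sv.
exists sg; split.
  split.
    split; first exact (@smooth_curveP R (fun t => (x t, y t)) sx sy).
      exact: Qz.
    by move=> s; rewrite xs ys.
  (* For the zero loop the energy identity would read -1 = 0. *)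
  move=> z0; have Z s : x s = 0 /\ y s = 0.
    by have := congr1 (fun w => w s) z0 => /= -[].
  have := rg_energy reg 0; have := Z 0 => -[-> ->].
  have u0 : u 0 = 0.
    apply: HD_uniq (hx 0) _; apply: (@HD_near _ (fun=> 0)); last exact: HDc.
    by apply/nearRP; exists 1 => // s _; rewrite (Z s).1.
  have v0 : v 0 = 0.
    apply: HD_uniq (hy 0) _; apply: (@HD_near _ (fun=> 0)); last exact: HDc.
    by apply/nearRP; exists 1 => // s _; rewrite (Z s).2.
  by rewrite u0 v0 expr0n /= addr0 !mulr0 sub0r => /eqP; rewrite oppr_eq0 oner_eq0.
move=> xi txi.
have [s1 s2 _ gs hs] := twisted_components txi.
have n1 : 0 < vn x y by rewrite reg_n.
have F := @variation_formula x y u v u2 v2 (fun s => (xi s).1) (fun s => (xi s).2) _ _ sg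
  hx hy hu hv cu2 cv2 Qz n1 (smooth_HD s1) (smooth_HD s2)
  (smooth_cont (smooth_derive1 s1)) (smooth_cont (smooth_derive1 s2)) xs ys gs hs.
pose a1 s := (dotA A (t s) (csqr (x s, y s))).1.
pose a2 s := (dotA A (t s) (csqr (x s, y s))).2.
pose b s := magnetic A (t s) (csqr (x s, y s)).
pose g s := a1 s * (x s * u s - y s * v s) + a2 s * (x s * v s + y s * u s).
have a1E s : va1 At x y s = a1 s by rewrite /va1 reg_t /a1 (fd_dotA fd).
have a2E s : va2 At x y s = a2 s by rewrite /va2 reg_t /a2 (fd_dotA fd).
have bE s : vb Ax Ay x y s = b s by rewrite /vb reg_t /b (fd_magnetic fd).
have gE : vg At x y u v = g by apply/funext => s; rewrite /vg a1E a2E.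
have cg : continuous g by rewrite -gE; exact (vg_cont fd hx hy hu hv Qz).
have hGam s : HD (vGam At x y u v) s (g s) by rewrite /vGam gE; exact: prim_HD.
have cts := HD_continuous ht.
have hMu s : HD (vMu At x y u v) s (g s * t s).
  have -> : vMu At x y u v = prim (fun s => g s * t s).
    by rewrite /vMu gE reg_t.
  by apply: (prim_HD s (f := fun s => g s * t s)) => q; ct.
set Gam := vGam At x y u v in hGam; set Mu := vMu At x y u v in hMu.
have Gam0 : Gam 0 = 0 by exact: prim0.
have Mu0 : Mu 0 = 0 by exact: prim0.
have eE s : e s = e 0 - 2 * Gam s.
  have := @HD0_const R (fun s => e s + 2 * Gam s) s 0.
  rewrite Gam0 mulr0 addr0 => <-; first by ring.
  move=> q; have h1 := rg_e reg q; have h2 := hGam q.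
  by der; rewrite /g /a1 /a2; ring.
have Gam1 : Gam 1 = 0.
  by have := eE 1; rewrite -[in LHS](add0r 1) (rg_e1 reg) => ?; lra.
pose m s := u s ^+ 2 + v s ^+ 2.
have cm : continuous m by move=> q; rewrite /m; ct.
(* The energy identity integrated over one period determines e 0; the result is the constant in the
   Euler-Lagrange expression. *)
have e0E : e 0 = 2 * n * vM u v - 1 / n - 2 * Mu 1.
  pose J s := 2 * n ^+ 2 * prim m s - s - (e 0 * (n * t s) - 2 * (Gam s * (n * t s) - n * Mu s)).
  have hJ s : HD J s 0.
    have h1 := prim_HD s cm; have h2 := ht s; have h3 := hGam s; have h4 := hMu s.
    rewrite /J; der.
    have En := rg_energy reg s; have Ee := eE s.
    transitivity ((2 * n ^+ 2 * (u s ^+ 2 + v s ^+ 2) - 1)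
       - (e 0 - 2 * Gam s) * (x s ^+ 2 + y s ^+ 2)); first by rewrite /m; field.
    by rewrite En -Ee subrr.
  have := HD0_const 1 0 hJ; rewrite /J prim0 (rg_t0 reg) Gam0 Mu0 Gam1.
  have -> : t 1 = 1 by rewrite -(add0r 1) (rg_t1 reg) (rg_t0 reg).
  have -> : prim m 1 = vM u v by [].
  move=> h; apply: (mulfI nN); apply/eqP; rewrite -subr_eq0; apply/eqP.
  transitivity (- (2 * n ^+ 2 * vM u v - 1 - (e 0 * (n * 1) - 2 * (0 * (n * 1) - n * Mu 1)))).
    by field.
  by rewrite h; ring.
have u2E s : u2 s = _ := HD_uniq (hu s) (rg_u reg s).
have v2E s : v2 s = _ := HD_uniq (hv s) (rg_v reg s).
have E1 s : vE1 At Ax Ay x y u v u2 s = 0.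
  rewrite /vE1 -/Gam -/Mu Gam1 reg_n a1E a2E bE u2E eE e0E /vr -/(a1 s) -/(a2 s) -/(b s).
  by field.
have E2 s : vE2 At Ax Ay x y u v v2 s = 0.
  rewrite /vE2 -/Gam -/Mu Gam1 reg_n a1E a2E bE v2E eE e0E /vr -/(a1 s) -/(a2 s) -/(b s).
  by field.
have Z : prim (fun s => vE1 At Ax Ay x y u v u2 s * (xi s).1 +
    vE2 At Ax Ay x y u v v2 s * (xi s).2) 1 = 0.
  have -> : (fun s => vE1 At Ax Ay x y u v u2 s * (xi s).1 +
    vE2 At Ax Ay x y u v v2 s * (xi s).2) = (fun=> 0).
    by apply/funext => s; rewrite E1 E2 !mul0r addr0.
  by rewrite (prim_unique (F := fun=> 0)) ?subrr//; [move=> s; exact: cvg_cst|move=> s; exact: HDc].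
rewrite Z in F.
have -> : (fun eps : R => action A f (fun tau => (x tau, y tau) + eps *: xi tau)) =
   (fun e0 : R => action A f (fun s => (x s + e0 * (xi s).1, y s + e0 * (xi s).2))).
  by apply/funext => eps; congr (action A f); apply/funext => s; case: (xi s).
exact: F.
Qed.

End converse.
End critical_regular.

(** * Collision orbits from regularized solutions *)

Section homeo.
Context {R : realType}.
Implicit Types (h g : R -> R) (s t d w : R).

Definition inverse h : R -> R := 'pinv_(fun=> 0) [set: R] h.

Section lift.
Variable h : R -> R.
Hypotheses (ch : continuous h) (h1 : forall s, h (s + 1) = h s + 1).
Hypothesis mh : forall s t, s < t -> h s < h t.

Lemma lift_le s t : s <= t -> h s <= h t.
Proof. by rewrite le_eqVlt => /predU1P[->//|/mh/ltW]. Qed.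

Lemma lift_inj s t : h s = h t -> s = t.
Proof.
move=> e; apply/eqP; rewrite eq_le !leNgt; apply/andP; split; apply/negP => /mh;
  by rewrite e ltxx.
Qed.

Lemma lift_surj w : exists s, h s = w.
Proof.
have hn (k : nat) s : h (s + k%:R) = h s + k%:R.
  by elim: k => [|k IH]; rewrite ?addr0// -natr1 !addrA h1 IH.
pose k := (Num.truncn (`|w - h 0|)%R).+1.
have kw : `|w - h 0| < k%:R by exact: truncnS_gt.
move: kw; rewrite ltr_norml => /andP[k1 k2].
have ab : - k%:R <= k%:R :> R by rewrite ge0_cp// ler0n.
have [|c _ <-] := @IVT R h (- k%:R) k%:R w ab (continuous_subspaceT ch); last by exists c.
have e1 := hn k 0; have e2 := hn k (- k%:R); rewrite add0r in e1.
rewrite addNr in e2; rewrite ge_min le_max e1; apply/andP; split; apply/orP; [left|right]; lra.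
Qed.

Lemma lift_bij : set_bij [set: R] [set: R] h.
Proof.
split=> //; first by move=> s t _ _; exact: lift_inj.
by move=> w _; have [s <-] := lift_surj w; exists s.
Qed.

Lemma inverseK s : inverse h (h s) = s.
Proof. by apply: pinvKV; rewrite ?inE// => p q _ _; exact: lift_inj. Qed.

Lemma inverseKV w : h (inverse h w) = w.
Proof. by have [s <-] := lift_surj w; rewrite inverseK. Qed.

Lemma inverse_lt w w' : w < w' -> inverse h w < inverse h w'.
Proof. by move=> ww; rewrite ltNge; apply/negP => /lift_le; rewrite !inverseKV leNgt ww. Qed.

Lemma inverse_cont : continuous (inverse h).
Proof.
move=> w; apply/ctP => e e0; set s := inverse h w.
have s1 : h (s - e) < w by rewrite -(inverseKV w); apply: mh; rewrite -/s; lra.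
have s2 : w < h (s + e) by rewrite -(inverseKV w); apply: mh; rewrite -/s; lra.
exists (Num.min (w - h (s - e)) (h (s + e) - w)); first by rewrite lt_min; lra.
move=> w'; rewrite lt_min !ltr_distl => /andP[/andP[a1 a2] /andP[a3 a4]].
have b1 : inverse h (h (s - e)) < inverse h w' by apply: inverse_lt; lra.
have b2 : inverse h w' < inverse h (h (s + e)) by apply: inverse_lt; lra.
by move: b1 b2; rewrite !inverseK => *; apply/andP; split; lra.
Qed.

Lemma inverse1 w : inverse h (w + 1) = inverse h w + 1.
Proof. by apply: lift_inj; rewrite h1 !inverseKV. Qed.

Lemma lift_homeo : circle_homeo_lift h.
Proof. by split; [exact: ch|exact: h1|exact: lift_bij|exact: inverse_cont]. Qed.

Lemma inverse_HD w d : d != 0 -> HD h (inverse h w) d -> HD (inverse h) w d^-1.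
Proof.
move=> d0 hd; have := @is_derive_inverse R h (inverse h) d (inverse h w) _ _ hd d0.
rewrite inverseKV; apply.
  by apply/nearRP; exists 1 => // s _; exact: inverseK.
by apply/nearRP; exists 1 => // s _; exact: ch.
Qed.

End lift.

Lemma isolated_finite (P : set R) (a b : R) :
  (forall t, exists2 d : R, 0 < d & forall s, s != t -> `|s - t| < d -> ~ P s) ->
  finite_set (`[a, b] `&` P).
Proof.
move=> iso; have [ab|ba] := leP a b; last by rewrite set_itv_ge -?leNgt ?bnd_simp -?ltNge// set0I.
apply: (@cousin _ (fun a b => finite_set (`[a, b] `&` P))) ab => [p q r pq qr h1 h2|t].
  apply: (sub_finite_set _ (_ : finite_set ((`[p, q] `&` P) `|` (`[q, r] `&` P)))).
    move=> s [] /=; rewrite !in_itv /= => /andP[ps sr] Ps.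
    by have [sq|/ltW qs] := leP s q; [left|right]; rewrite ?ps ?sq ?qs ?sr.
  by rewrite finite_setU.
have [d d0 hd] := iso t; exists d => // p q pt tq qp.
apply: (sub_finite_set _ (finite_set1 t)) => s [] /=; rewrite in_itv /= => sp Ps.
apply: contrapT => /eqP st; apply: (hd s st _ Ps).
by rewrite ltr_distl; lra.
Qed.

(** [f] is continuous on an open set and extended by 0. This serves the velocity, which blows up at
    the collisions. *)
Lemma measurable_off (f c : R -> R) : continuous c ->
  (forall w, c w != 0 -> {for w, continuous f}) -> (forall w, c w = 0 -> f w = 0) ->
  measurable_fun [set: R] f.
Proof.
move=> cc cf f0.
pose O := c @^-1` [set y | y != 0].
have oO : open O by apply: open_comp; [move=> w _; exact: cc|exact: open_neq].
have -> : f = f \_ O.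
  apply/funext => w; rewrite patchE; case: ifPn => // /negP wO.
  by apply: f0; apply/eqP/negPn/negP => h; apply: wO; rewrite inE.
apply: (measurable_restrictT _ _).1; first exact: open_measurable.
by apply: open_continuous_measurable_fun => // w; rewrite inE => /cf.
Qed.

Lemma enorm_csqr (x y : R) : enorm (csqr (x, y)) = x ^+ 2 + y ^+ 2.
Proof.
rewrite /enorm /edot /csqr /=.
have -> : (x * x - y * y) * (x * x - y * y) + (x * y + y * x) * (x * y + y * x)
   = (x ^+ 2 + y ^+ 2) ^+ 2 by ring.
by rewrite sqrtr_sqr ger0_norm// addr_ge0// sqr_ge0.
Qed.

Lemma csqr_eq0 (x y : R) : (csqr (x, y) == 0) = (x ^+ 2 + y ^+ 2 == 0).
Proof.
rewrite -enorm_csqr /enorm sqrtr_eq0 /edot.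
apply/eqP/idP => [->|]; first by rewrite /= mulr0 addr0.
case: (csqr (x, y)) => p q /= h.
have : p * p + q * q == 0 by rewrite eq_le h addr_ge0// -expr2 sqr_ge0.
rewrite paddr_eq0 -?expr2 ?sqr_ge0// !sqrf_eq0 => /andP[/eqP -> /eqP ->].
by [].
Qed.

End homeo.

Section ratio.
Context {R : realType}.

(** Since [r] is comparable to (p - s)^2, the derivative r K makes [D] of order |p - s|^3. Hence D /
    r tends to 0, which is also its value at [s]. *)
Lemma double_zero_ratio (m r D K : R -> R) s : {for s, continuous m} -> 0 < m s ->
  (forall p, r p = m p * (p - s) ^+ 2) -> (forall p, 0 <= r p) ->
  (forall p, HD D p (r p * K p)) -> D s = 0 -> {for s, continuous K} ->
  {for s, continuous (fun p => D p / r p)}.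
Proof.
move=> cm m00 rE r0 hD Ds cK.
set m0 := m s in m00.
have [d1 d10 hd1] := (ctP _ _).1 cm (m0 / 2) ltac:(lra).
have [d2 d20 hd2] := (ctP _ _).1 cK 1 ltr01.
pose M := 4 * (`|K s| + 1).
have M0 : 0 < M by rewrite mulr_gt0// ltr_wpDl.
apply/ctP => ep ep0; rewrite Ds mul0r.
exists (Num.min (Num.min d1 d2) (ep / M)); first by rewrite !lt_min d10 d20 divr_gt0.
move=> s' s's; rewrite subr0.
have [->|ne] := eqVneq s' s; first by rewrite Ds mul0r normr0.
move: s's; rewrite !lt_min => /andP[/andP[s1 s2] s3].
have [c cs E] := @mvtT _ D (fun s => r s * K s) s s' hD.
have cs' : `|c - s| <= `|s' - s|.
  move: cs; have [ss|ss] := leP s s' => /andP[c1 c2].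
    by rewrite !ger0_norm; lra.
  by rewrite !ler0_norm; lra.
have h0 : 0 < (s' - s) ^+ 2 by rewrite exprn_even_gt0//= subr_eq0.
have := hd1 _ s1; rewrite -/m0 ltr_distl => /andP[m1 m2].
have := hd1 _ (le_lt_trans cs' s1); rewrite -/m0 ltr_distl => /andP[m3 m4].
have Kc : `|K c| <= `|K s| + 1.
  have k1 := hd2 _ (le_lt_trans cs' s2).
  by have := ler_normD (K c - K s) (K s); rewrite subrK; lra.
have rs' : 0 < r s' by rewrite rE mulr_gt0//; lra.
(* Near [s] the factor [m] lies between m0 / 2 and 2 * m0, whence the constant 4. *)
have rcs : r c <= 4 * r s'.
  rewrite !rE.
  have c2 : (c - s) ^+ 2 <= (s' - s) ^+ 2.
    by rewrite -(real_normK (num_real (c - s))) -(real_normK (num_real (s' - s))) lerXn2r// nnegrE.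
  have c0 : 0 <= (c - s) ^+ 2 by exact: sqr_ge0.
  apply: (@le_trans _ _ (2 * m0 * (c - s) ^+ 2)); first by rewrite ler_wpM2r//; lra.
  apply: (@le_trans _ _ (2 * m0 * (s' - s) ^+ 2)); first by rewrite ler_wpM2l//; lra.
  by rewrite mulrA ler_wpM2r//; lra.
move: E; rewrite Ds subr0 => ->.
rewrite !normrM normfV (gtr0_norm rs') (ger0_norm (r0 c)).
rewrite ltr_pdivrMr//.
rewrite ltr_pdivlMr// in s3.
apply: (@le_lt_trans _ _ (r c * (`|K s| + 1) * `|s' - s|)).
  by rewrite ler_wpM2r// ler_wpM2l.
apply: (@le_lt_trans _ _ (4 * r s' * (`|K s| + 1) * `|s' - s|)).
  by rewrite ler_wpM2r// ler_wpM2r// addr_ge0.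
rewrite (_ : _ * _ = (`|s' - s| * M) * r s'); last by rewrite /M; ring.
by rewrite ltr_pM2r.
Qed.

End ratio.

(** * The orbit of a solution of the regularized equations *)

Section collision.
Context {R : realType}.
Notation mu := (@lebesgue_measure R).
Implicit Types (s d w : R).
Variables (Q : set (plane R)) (A At Ax Ay : R -> plane R -> plane R).
Variables (f fx fy : plane R -> R).
Hypothesis fd : field_data Q A f At Ax Ay fx fy.
Variables (n : R) (t x y u v e : R -> R).
Hypothesis reg : regular Q A n t x y u v e.

Let n0 := rg_n reg.
Let nN : n != 0. Proof. by rewrite gt_eqF. Qed.
Let hx := rg_x reg.
Let hy := rg_y reg.
Let ht := rg_t reg.
Let he := rg_e reg.
Let hu := rg_u reg.
Let hv := rg_v reg.
Let cx := HD_continuous hx.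
Let cy := HD_continuous hy.
Let cu := HD_continuous hu.
Let cv := HD_continuous hv.
Let ce := HD_continuous he.
Let ctt := HD_continuous ht.
Let r s := x s ^+ 2 + y s ^+ 2.
Let cr : continuous r. Proof. by move=> s; rewrite /r; ct. Qed.
Let r0 s : 0 <= r s. Proof. by rewrite /r addr_ge0// sqr_ge0. Qed.

Let rz s : r s = 0 -> x s = 0 /\ y s = 0 := @sqrD_eq0 R (x s) (y s).

(** At a zero of z the quotient z / (q - s) extends continuously by z', which is nonzero by
    [uv_pos]. This factorization yields the isolation of the collisions, the limit of the direction
    and the double zero of [r]. *)
Let slopes s : r s = 0 -> exists kx ky : R -> R,
  [/\ {for s, continuous kx}, {for s, continuous ky}, kx s = u s, ky s = v s &
      (forall q, x q = kx q * (q - s)) /\ (forall q, y q = ky q * (q - s))].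
Proof.
move=> /rz[xs ys].
have [kx [xE ckx kxs]] := (is_derive1_caratheodory _ _ _).1 (hx s).
have [ky [yE cky kys]] := (is_derive1_caratheodory _ _ _).1 (hy s).
exists kx, ky; split => //; split=> q.
  by rewrite -xE xs subr0.
by rewrite -yE ys subr0.
Qed.

Let uv_pos s : r s = 0 -> 0 < u s ^+ 2 + v s ^+ 2.
Proof.
move=> rs; have := rg_energy reg s; rewrite -/(r s) rs mulr0 => h.
have : 0 < 2 * n ^+ 2 * (u s ^+ 2 + v s ^+ 2) by lra.
by rewrite pmulr_rgt0// mulr_gt0// exprn_gt0.
Qed.

Let isolated s : exists2 d : R, 0 < d & forall q, q != s -> `|q - s| < d -> r q != 0.
Proof.
have [rs|rs] := eqVneq (r s) 0.
  have [kx [ky [ckx cky kxs kys [xE yE]]]] := slopes rs.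
  have cm : {for s, continuous (fun q => kx q ^+ 2 + ky q ^+ 2)} by ct.
  have ms : 0 < kx s ^+ 2 + ky s ^+ 2 by rewrite kxs kys; exact: uv_pos.
  have [d d0 hd] := (ctP _ _).1 cm _ ms.
  exists d => // q qs qd; rewrite /r xE yE !exprMn -mulrDl mulf_neq0//.
    by have := hd _ qd; rewrite ltr_distl => /andP[h _]; rewrite gt_eqF//; lra.
  by rewrite expf_neq0// subr_eq0.
have [d d0 hd] := (nearRP _ _).1 (near_neq0 (@cr s) rs).
by exists d => // q _; exact: hd.
Qed.

Lemma regular_t_incr s q : s < q -> t s < t q.
Proof.
apply: (@strict_mono_isolated _ t (fun s => r s / n) ctt) => p.
have [d d0 hd] := isolated p; exists d => // p' ne /(hd p' ne) rp; split; first exact: ht.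
by rewrite divr_gt0// lt_neqAle eq_sym rp r0.
Qed.

Let t1 := rg_t1 reg.
Lemma regular_homeo : circle_homeo_lift t.
Proof. exact (lift_homeo ctt t1 regular_t_incr). Qed.

Let tau := inverse t.
Let tauK s : tau (t s) = s. Proof. exact (inverseK regular_t_incr s). Qed.
Let tauKV w : t (tau w) = w. Proof. exact (inverseKV ctt t1 regular_t_incr w). Qed.
Let ctau : continuous tau. Proof. exact (inverse_cont ctt t1 regular_t_incr). Qed.
Let tau1 w : tau (w + 1) = tau w + 1. Proof. exact (inverse1 ctt t1 regular_t_incr w). Qed.
Let crtau : continuous (fun w => r (tau w)).
Proof. by move=> w; exact: (@ctcomp R R R tau r w (@ctau w) (@cr (tau w))). Qed.
Let tau_inj w w' : tau w = tau w' -> w = w'.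
Proof. by move=> h; rewrite -(tauKV w) h tauKV. Qed.

Let htau w : r (tau w) != 0 -> HD tau w (n / r (tau w)).
Proof.
move=> rw; apply: HDeq.
  apply: (inverse_HD ctt t1 regular_t_incr) (ht (tau w)).
  by rewrite mulf_neq0// invr_eq0.
by rewrite -/(r (tau w)); field; rewrite rw.
Qed.

Let isolated' w : exists2 d : R, 0 < d & forall q, q != w -> `|q - w| < d -> r (tau q) != 0.
Proof.
have [d d0 hd] := isolated (tau w).
have [d' d'0 hd'] := (ctP _ _).1 (@ctau w) _ d0.
exists d' => // q qw /hd' h; apply: hd => //.
by apply: contra_neq qw; exact: tau_inj.
Qed.

Lemma regular_inverse_HD w : x (inverse t w) ^+ 2 + y (inverse t w) ^+ 2 != 0 ->
  HD (inverse t) w (n / (x (inverse t w) ^+ 2 + y (inverse t w) ^+ 2)).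
Proof. exact: htau. Qed.

Lemma regular_isolated w : exists2 d : R, 0 < d & forall w', w' != w -> `|w' - w| < d ->
  x (inverse t w') ^+ 2 + y (inverse t w') ^+ 2 != 0.
Proof. exact: isolated'. Qed.

Definition regular_orbit w : plane R := csqr (x (tau w), y (tau w)).
Let q := regular_orbit.

Let qE w : (q w != 0) = (r (tau w) != 0).
Proof. by rewrite /q /regular_orbit csqr_eq0. Qed.
Let enq w : enorm (q w) = r (tau w).
Proof. by rewrite /q /regular_orbit enorm_csqr. Qed.

(* The velocity 2 n z' / conj z, which is 0 at collisions. *)
Let V1 s := 2 * n * (x s * u s - y s * v s) / r s.
Let V2 s := 2 * n * (x s * v s + y s * u s) / r s.

Let comp_HD (g : R -> R) d w : r (tau w) != 0 -> HD g (tau w) d ->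
  HD (fun w => g (tau w)) w (d * (n / r (tau w))).
Proof. by move=> rw hg; exact: HDcomp hg (htau rw). Qed.

Let q_HD w : r (tau w) != 0 ->
  HD (fun w => (q w).1) w (V1 (tau w)) /\ HD (fun w => (q w).2) w (V2 (tau w)).
Proof.
move=> rw; split.
- apply: HDeq; first apply: (comp_HD (g := fun s => x s * x s - y s * y s) rw); first by der.
  by rewrite /V1; field; rewrite rw.
- apply: HDeq; first apply: (comp_HD (g := fun s => x s * y s + y s * x s) rw); first by der.
  by rewrite /V2; field; rewrite rw.
Qed.

Let q_derive w : r (tau w) != 0 ->
  derivable q w 1 /\ q^`()%classic w = (V1 (tau w), V2 (tau w)).
Proof. by move=> rw; have [h1 h2] := q_HD rw; exact: HD_curve h1 h2. Qed.

Let a1 s := (dotA A (t s) (csqr (x s, y s))).1.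
Let a2 s := (dotA A (t s) (csqr (x s, y s))).2.
Let b s := magnetic A (t s) (csqr (x s, y s)).

Let eE s : r s != 0 -> e s = (2 * n ^+ 2 * (u s ^+ 2 + v s ^+ 2) - 1) / r s.
Proof. by move=> rs; rewrite (rg_energy reg) -/(r s) mulfK. Qed.

(** Off the collisions the energy identity expresses [e] through z and z'; the equation for q then
    is a rational identity. *)
Let V_HD w : r (tau w) != 0 -> let s := tau w in
  HD (fun w => V1 (tau w)) w (b s * V2 s - a1 s - (x s * x s - y s * y s) / r s ^+ 3) /\
  HD (fun w => V2 (tau w)) w (- b s * V1 s - a2 s - (x s * y s + y s * x s) / r s ^+ 3).
Proof.
move=> rw s.
have dr : HD r s (2 * (x s * u s + y s * v s)) by rewrite /r; der; ring.
have h1 := hu s; have h2 := hv s.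
rewrite -/(r s) -/(b s) -/(a1 s) -/(a2 s) in h1 h2.
have rs : x s ^+ 2 + y s ^+ 2 != 0 := rw.
have Es : e s = (2 * n ^+ 2 * (u s ^+ 2 + v s ^+ 2) - 1) / (x s ^+ 2 + y s ^+ 2) := eE rw.
split; apply: HDeq.
- by apply: (comp_HD (g := V1) rw); rewrite /V1; der.
- rewrite -/s -/(b s) -/(a1 s) -/(a2 s) Es /V2 /r.
  move: (b s) (a1 s) (a2 s) (x s) (y s) (u s) (v s) rs => B A1 A2 X Y U V rs.
  by field; rewrite rs nN.
- by apply: (comp_HD (g := V2) rw); rewrite /V2; der.
- rewrite -/s -/(b s) -/(a1 s) -/(a2 s) Es /V1 /r.
  move: (b s) (a1 s) (a2 s) (x s) (y s) (u s) (v s) rs => B A1 A2 X Y U V rs.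
  by field; rewrite rs nN.
Qed.

Let orbit_ode w : q w != 0 ->
  [/\ derivable q w 1, derivable q^`()%classic w 1 &
      q^`()^`()%classic w = - magnetic A w (q w) *: imul (q^`()%classic w)
                  - dotA A w (q w) - (enorm (q w) ^+ 3)^-1 *: q w].
Proof.
rewrite qE => rw; have [dq qd] := q_derive rw.
have [d d0 hd] := (nearRP _ _).1 (near_neq0 (@crtau w) rw).
have [h1 h2] := V_HD rw.
have E w' : `|w' - w| < d -> q^`()%classic w' = (V1 (tau w'), V2 (tau w')).
  by move=> /hd rw'; exact: (q_derive rw').2.
have k1 : HD (fun w => (q^`()%classic w).1) w
    (b (tau w) * V2 (tau w) - a1 (tau w) - (x (tau w) * x (tau w) - y (tau w) * y (tau w)) / r (tau w) ^+ 3).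
  by apply: HD_near h1; apply/nearRP; exists d => // w' /E ->.
have k2 : HD (fun w => (q^`()%classic w).2) w
    (- b (tau w) * V1 (tau w) - a2 (tau w) - (x (tau w) * y (tau w) + y (tau w) * x (tau w)) / r (tau w) ^+ 3).
  by apply: HD_near h2; apply/nearRP; exists d => // w' /E ->.
have [dq' ->] := HD_curve k1 k2.
split; [exact: dq|exact: dq'|].
rewrite qd enq /b /a1 /a2 tauKV -/(regular_orbit w) -/(q w) /imul /=.
rewrite [dotA A w (q w)]surjective_pairing.
congr (_, _) => /=.
- by rewrite /q /regular_orbit /csqr /GRing.scale /=; ring.
- by rewrite /q /regular_orbit /csqr /GRing.scale /=; ring.
Qed.

Let speed s := 4 * n ^+ 2 * (u s ^+ 2 + v s ^+ 2) / r s.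
Let VV s : V1 s ^+ 2 + V2 s ^+ 2 = speed s.
Proof.
have [rs|rs] := eqVneq (r s) 0; first by rewrite /V1 /V2 /speed rs invr0 !mulr0; ring.
by move: rs; rewrite /V1 /V2 /speed /r => rs; field; rewrite rs.
Qed.

Let ct_off (g : R -> R) w : r (tau w) != 0 -> {for tau w, continuous g} ->
  {for w, continuous (fun w => g (tau w))}.
Proof. by move=> _ cg; apply: (@ctcomp R R R tau g w (@ctau w) cg). Qed.

Let cV1 s : r s != 0 -> {for s, continuous V1}.
Proof. by move=> rs; rewrite /V1; ct. Qed.
Let cV2 s : r s != 0 -> {for s, continuous V2}.
Proof. by move=> rs; rewrite /V2; ct. Qed.
Let cspeed s : r s != 0 -> {for s, continuous speed}.
Proof. by move=> rs; rewrite /speed; ct. Qed.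

Let off_measurable (g : R -> R) : (forall s, r s != 0 -> {for s, continuous g}) ->
  (forall s, r s = 0 -> g s = 0) -> measurable_fun [set: R] (fun w => g (tau w)).
Proof.
move=> cg g0; apply: (measurable_off crtau) => w rw; last exact: g0.
exact: ct_off rw (cg _ rw).
Qed.

Let mV1 : measurable_fun [set: R] (fun w => V1 (tau w)).
Proof. by apply: off_measurable cV1 _ => s; rewrite /V1 => ->; rewrite invr0 mulr0. Qed.
Let mV2 : measurable_fun [set: R] (fun w => V2 (tau w)).
Proof. by apply: off_measurable cV2 _ => s; rewrite /V2 => ->; rewrite invr0 mulr0. Qed.
Let mspeed : measurable_fun [set: R] (fun w => speed (tau w)).
Proof. by apply: off_measurable cspeed _ => s; rewrite /speed => ->; rewrite invr0 mulr0. Qed.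

Let speed0 s : 0 <= speed s.
Proof. by rewrite -VV addr_ge0 ?sqr_ge0. Qed.

(* The primitive of 4 n |z'|^2 composed with tau dominates. *)
Let dominated (g : R -> R) : measurable_fun [set: R] (fun w => g (tau w)) ->
  (forall s, `|g s| <= speed s + 1) -> locint (fun w => g (tau w)).
Proof.
move=> mg gs; apply: (dominated_locint mg) => w.
have [d d0 hd] := isolated' w; exists d; split => //.
pose m s := 4 * n * (u s ^+ 2 + v s ^+ 2).
have cm : continuous m by move=> s; rewrite /m; ct.
have cp : continuous (prim m) by exact: prim_cont.
exists (fun w => prim m (tau w) + w), (fun w => speed (tau w) + 1); split.
  move=> w' _; apply: (@ctD _ _ (fun w => prim m (tau w)) (fun w => w)); last exact: cvg_id.
  exact: (@ctcomp R R R tau (prim m) w' (@ctau w') (@cp (tau w'))).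
move=> w' ne /(hd w' ne) rw; split; last exact: gs.
- apply: HDeq; first apply: (@HDD _ (fun w => prim m (tau w)) (fun w => w)).
  + by apply: (comp_HD rw); exact: prim_HD.
  + exact: HDid.
  + by rewrite /m /speed; field.
- apply: (@ctD _ _ (fun w => speed (tau w)) (fun=> 1)); last exact: ctc.
  exact: ct_off rw (cspeed rw).
Qed.

Let Vle s : `|V1 s| <= speed s + 1 /\ `|V2 s| <= speed s + 1.
Proof.
have h := VV s; have h1 := sqr_ge0 (V1 s); have h2 := sqr_ge0 (V2 s).
rewrite -(real_normK (num_real (V1 s))) -(real_normK (num_real (V2 s))) in h h1 h2.
have k1 := normr_ge0 (V1 s); have k2 := normr_ge0 (V2 s).
have l1 := sqr_ge0 (`|V1 s| - 1); have l2 := sqr_ge0 (`|V2 s| - 1).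
by split; nra.
Qed.

Let lV1 : locint (fun w => V1 (tau w)).
Proof. by apply: dominated => // s; exact: (Vle s).1. Qed.
Let lV2 : locint (fun w => V2 (tau w)).
Proof. by apply: dominated => // s; exact: (Vle s).2. Qed.
Let lspeed : locint (fun w => speed (tau w)).
Proof. by apply: dominated => // s; rewrite ger0_norm//; lra. Qed.

Let cq1 : continuous (fun w => (q w).1).
Proof.
move=> w; apply: (@ctcomp R R R tau (fun s => x s * x s - y s * y s) w (@ctau w)).
by ct.
Qed.
Let cq2 : continuous (fun w => (q w).2).
Proof.
move=> w; apply: (@ctcomp R R R tau (fun s => x s * y s + y s * x s) w (@ctau w)).
by ct.
Qed.

(** [F] minus the integral of [g] is continuous and has derivative 0 off the isolated collisions. *)
Let primitive (F g : R -> R) : continuous F -> locint g ->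
  (forall w, r (tau w) != 0 -> {for w, continuous g}) ->
  (forall w, r (tau w) != 0 -> HD F w (g w)) ->
  forall a c, a <= c -> F c - F a = \int[mu]_(t in `[a, c]) g t.
Proof.
move=> cF lg cg hF a c ac.
have := @HD0_const_isolated _ (fun w => F w - oriented_int 0 w g).
move=> /(_ _ _ a c) E; rewrite -oint_le// -oint_sub//.
suff H : F a - oriented_int 0 a g = F c - oriented_int 0 c g by lra.
apply: E.
  move=> w; apply: (@ctD _ _ F (fun w => - oriented_int 0 w g)); first exact: cF.
  by apply: ctN; exact: oint_cont.
move=> w; have [d d0 hd] := isolated' w; exists d => // w' ne /(hd w' ne) rw.
apply: HDeq; first apply: (@HDD _ F (fun w => - oriented_int 0 w g)).
- exact: hF rw.
- by apply: (@HDN _ (fun w => oriented_int 0 w g)); apply: oint_HD => //; exact: cg.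
- by rewrite subrr.
Qed.

Let uv_twist (sg : bool) : (forall s, x (s + 1) = (-1) ^+ sg * x s /\ y (s + 1) = (-1) ^+ sg * y s) ->
  forall s, u (s + 1) = (-1) ^+ sg * u s /\ v (s + 1) = (-1) ^+ sg * v s.
Proof.
move=> h s; split.
  by apply: (deriv_twist hx) => s'; exact: (h s').1.
by apply: (deriv_twist hy) => s'; exact: (h s').2.
Qed.

(** The sign of the loop drops out of every even expression in z and z', such as the orbit, its
    velocity and its direction. *)
Let even_periodic (T : Type) (g : R -> R -> R -> R -> T) s :
  (forall p p' k k', g (- p) (- p') (- k) (- k') = g p p' k k') ->
  g (x (s + 1)) (y (s + 1)) (u (s + 1)) (v (s + 1)) = g (x s) (y s) (u s) (v s).
Proof.
move=> ge; have [sg h] := rg_sg reg.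
have [-> ->] := h s; have [-> ->] := uv_twist h s.
by case: (sg); rewrite ?expr0 ?expr1 ?mul1r ?mulN1r.
Qed.

Let q_per : periodic q 1.
Proof.
move=> w; rewrite /q /regular_orbit tau1.
apply: (@even_periodic _ (fun p p' _ _ => csqr (p, p'))) => p p' _ _.
by rewrite /csqr /= !mulrNN.
Qed.

Let W12_orbit : W12_loop Q q.
Proof.
split; [exact: q_per|by move=> w; exact: rg_Q reg _|].
exists (fun w => (V1 (tau w), V2 (tau w))); split.
- move=> w; rewrite tau1 /V1 /V2 /r.
  apply: (@even_periodic _ (fun p p' k k' => (2 * n * (p * k - p' * k') / (p ^+ 2 + p' ^+ 2),
    2 * n * (p * k' + p' * k) / (p ^+ 2 + p' ^+ 2)))) => p p' k k'.
  by rewrite !mulrNN !sqrrN.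
- by split; [exact: mV1|exact: mV2].
- have -> : (fun w => enorm (V1 (tau w), V2 (tau w)) ^+ 2) = (fun w => speed (tau w)).
    by apply/funext => w; rewrite enorm_sqr VV.
  exact: lspeed.
- move=> a c ac; rewrite [q c]surjective_pairing [q a]surjective_pairing.
  congr (_, _) => /=.
    apply: (primitive cq1 lV1) => // w rw; first exact: ct_off rw (cV1 rw).
    exact: (q_HD rw).1.
  apply: (primitive cq2 lV2) => // w rw; first exact: ct_off rw (cV2 rw).
  exact: (q_HD rw).2.
Qed.

Let finite_collisions : finite_set (`[0, 1[%classic `&` q @^-1` [set 0]).
Proof.
apply: sub_finite_set (@isolated_finite _ (fun w => r (tau w) = 0) 0 1 _) => [w []|w].
  rewrite /= !in_itv /= => /andP[w0 w1] qw; split; first by rewrite w0 ltW.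
  by apply/eqP; rewrite -[_ == _]negbK -qE qw eqxx.
have [d d0 hd] := isolated' w; exists d => // s ne /(hd s ne) rs E.
by rewrite E eqxx in rs.
Qed.

(** At a collision the direction is z' / conj(z'), the limit of z / conj(z) at a simple zero. It is
    the same from both sides because the slope enters quadratically. *)
Let al1 s := if r s == 0 then (u s ^+ 2 - v s ^+ 2) / (u s ^+ 2 + v s ^+ 2)
             else (x s * x s - y s * y s) / r s.
Let al2 s := if r s == 0 then 2 * (u s * v s) / (u s ^+ 2 + v s ^+ 2)
             else (x s * y s + y s * x s) / r s.

Let near_off s : r s != 0 -> \near s, r s != 0.
Proof. exact: (near_neq0 (@cr s)). Qed.

Let cal s : {for s, continuous al1} /\ {for s, continuous al2}.
Proof.
have [rs|rs] := eqVneq (r s) 0; last first.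
  split.
    apply: (@ct_near _ _ (fun s => (x s * x s - y s * y s) / r s)); last by ct.
    by apply: filterS (near_off rs) => s' rs'; rewrite /al1 (negbTE rs').
  apply: (@ct_near _ _ (fun s => (x s * y s + y s * x s) / r s)); last by ct.
  by apply: filterS (near_off rs) => s' rs'; rewrite /al2 (negbTE rs').
have [kx [ky [ckx cky kxs kys [xE yE]]]] := slopes rs.
have ms : kx s ^+ 2 + ky s ^+ 2 != 0 by rewrite kxs kys gt_eqF//; exact: uv_pos.
have [d d0 hd] := isolated s.
have off s' : s' != s -> `|s' - s| < d -> [/\ r s' != 0,
    r s' = (kx s' ^+ 2 + ky s' ^+ 2) * (s' - s) ^+ 2 & s' - s != 0].
  by move=> ne h; split; [exact: hd|rewrite /r xE yE; ring|rewrite subr_eq0].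
split.
  apply: (@ct_near _ _ (fun s => (kx s ^+ 2 - ky s ^+ 2) / (kx s ^+ 2 + ky s ^+ 2))); last by ct.
  apply/nearRP; exists d => // s' s's; rewrite /al1.
  have [->|ne] := eqVneq s' s; first by rewrite rs eqxx kxs kys.
  have [rs' E h] := off s' ne s's; rewrite (negbTE rs') E xE yE.
  move: rs'; rewrite E mulf_eq0 negb_or => /andP[m0 _].
  by field; rewrite h m0.
apply: (@ct_near _ _ (fun s => 2 * (kx s * ky s) / (kx s ^+ 2 + ky s ^+ 2))); last by ct.
apply/nearRP; exists d => // s' s's; rewrite /al2.
have [->|ne] := eqVneq s' s; first by rewrite rs eqxx kxs kys.
have [rs' E h] := off s' ne s's; rewrite (negbTE rs') E xE yE.
move: rs'; rewrite E mulf_eq0 negb_or => /andP[m0 _].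
by field; rewrite h m0.
Qed.

(** The angular momentum of the orbit divided by 2 n. The term e z is central, so the derivative has
    the factor [r]; thus D / r is continuous, and beta = 2 n (D / r) i alpha. *)
Let D s := x s * v s - y s * u s.
Let K s := (- 2 * n * b s * (x s * u s + y s * v s)
            - (x s ^+ 2 - y s ^+ 2) * a2 s + 2 * (x s * y s) * a1 s) / (2 * n ^+ 2).

Let D_HD s : HD D s (r s * K s).
Proof. by rewrite /D; der; rewrite -/(b s) -/(a1 s) -/(a2 s) /r /K; field. Qed.

Let cK : continuous K.
Proof.
have ct0 := @ck_cont _ 0%N.
have cx' : ck 0 x := cx. have cy' : ck 0 y := cy. have ct' : ck 0 t := ctt.
have cq1' : ck 0 (fun s => x s * x s - y s * y s).
  by apply: ckD; [exact: ckM|apply: ckN; exact: ckM].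
have cq2' : ck 0 (fun s => x s * y s + y s * x s) by apply: ckD; exact: ckM.
have F F : F = At \/ F = Ax \/ F = Ay ->
    ck 0 (fun s => (F (t s) (csqr (x s, y s))).1) /\ ck 0 (fun s => (F (t s) (csqr (x s, y s))).2).
  by move=> FE; exact: (fd_ck fd FE (rg_Q reg) ct' cq1' cq2').
have [K1 K2] := F At (or_introl erefl).
have [_ K3] := F Ax (or_intror (or_introl erefl)).
have [K4 _] := F Ay (or_intror (or_intror erefl)).
have ca1 : continuous a1.
  have -> : a1 = (fun s => (At (t s) (csqr (x s, y s))).1).
    by apply/funext => s; rewrite /a1 (fd_dotA fd) //; exact: rg_Q reg _.
  by [].
have ca2 : continuous a2.
  have -> : a2 = (fun s => (At (t s) (csqr (x s, y s))).2).
    by apply/funext => s; rewrite /a2 (fd_dotA fd) //; exact: rg_Q reg _.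
  by [].
have cb : continuous b.
  have -> : b = (fun s => (Ax (t s) (csqr (x s, y s))).2 - (Ay (t s) (csqr (x s, y s))).1).
    by apply/funext => s; rewrite /b (fd_magnetic fd) //; exact: rg_Q reg _.
  by apply: (@ckD _ 0 (fun s => (Ax (t s) (csqr (x s, y s))).2)) => //; exact: ckN.
by move=> s; rewrite /K; ct.
Qed.

Let G s := D s / r s.

Let cG : continuous G.
Proof.
move=> s; have [rs|rs] := eqVneq (r s) 0; last first.
  have cD : {for s, continuous D} by exact: HD_cont (D_HD s).
  by rewrite /G; ct.
have [kx [ky [ckx cky kxs kys [xE yE]]]] := slopes rs.
have cm : {for s, continuous (fun s => kx s ^+ 2 + ky s ^+ 2)} by ct.
have ms : 0 < kx s ^+ 2 + ky s ^+ 2 by rewrite kxs kys; exact: uv_pos.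
have rE p : r p = (kx p ^+ 2 + ky p ^+ 2) * (p - s) ^+ 2 by rewrite /r xE yE; ring.
have Ds : D s = 0 by have [xs ys] := rz rs; rewrite /D xs ys !mul0r subrr.
exact (double_zero_ratio cm ms rE r0 D_HD Ds (@cK s)).
Qed.

Let alE s : al1 s ^+ 2 + al2 s ^+ 2 = 1.
Proof.
rewrite /al1 /al2; case: (eqVneq (r s) 0) => [rs|].
  by have := uv_pos rs; rewrite lt_neqAle eq_sym => /andP[m0 _]; field; rewrite m0.
by rewrite /r => rs; field; rewrite rs.
Qed.

Let al_HD s : r s != 0 -> HD al1 s (- 2 * D s / r s * al2 s) /\ HD al2 s (2 * D s / r s * al1 s).
Proof.
move=> rs; have h := near_off rs; split.
  apply: (@HD_near _ (fun s => (x s * x s - y s * y s) / r s)).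
    by apply: filterS h => s' rs'; rewrite /al1 (negbTE rs').
  have rs' : x s ^+ 2 + y s ^+ 2 != 0 := rs.
  by rewrite /r; der; first exact: rs'; rewrite /al2 (negbTE rs) /D /r; field; rewrite rs'.
apply: (@HD_near _ (fun s => (x s * y s + y s * x s) / r s)).
  by apply: filterS h => s' rs'; rewrite /al2 (negbTE rs').
have rs' : x s ^+ 2 + y s ^+ 2 != 0 := rs.
by rewrite /r; der; first exact: rs'; rewrite /al1 (negbTE rs) /D /r; field; rewrite rs'.
Qed.

Let alpha w : plane R := (al1 (tau w), al2 (tau w)).
Let beta w : plane R := (- (2 * n) * G (tau w) * al2 (tau w), 2 * n * G (tau w) * al1 (tau w)).

Let collision_orbit : collision_loop Q q.
Proof.
split; [exact: W12_orbit|exact: finite_collisions|].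
exists alpha, (fun w => e (tau w)), beta; split.
- split.
  + move=> w; refine (@ctpair _ _ _ (fun w => al1 (tau w)) (fun w => al2 (tau w)) w _ _).
      exact: (@ctcomp R R R tau al1 w (@ctau w) (cal (tau w)).1).
    exact: (@ctcomp R R R tau al2 w (@ctau w) (cal (tau w)).2).
  + by move=> w; exact: (@ctcomp R R R tau e w (@ctau w) (@ce (tau w))).
  + move=> w; have cG1 := @cG (tau w); have [ca1 ca2] := cal (tau w).
    refine (@ctpair _ _ _ (fun w => - (2 * n) * G (tau w) * al2 (tau w)) (fun w => 2 * n * G (tau w) * al1 (tau w)) w _ _).
      by apply: (@ctcomp R R R tau (fun s => - (2 * n) * G s * al2 s) w (@ctau w)); ct.
    by apply: (@ctcomp R R R tau (fun s => 2 * n * G s * al1 s) w (@ctau w)); ct.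
- have alp w : alpha (w + 1) = alpha w.
    rewrite /alpha tau1 /al1 /al2 /r.
    apply: (@even_periodic _ (fun p p' k k' =>
     (if p ^+ 2 + p' ^+ 2 == 0 then (k ^+ 2 - k' ^+ 2) / (k ^+ 2 + k' ^+ 2)
       else (p * p - p' * p') / (p ^+ 2 + p' ^+ 2),
      if p ^+ 2 + p' ^+ 2 == 0 then 2 * (k * k') / (k ^+ 2 + k' ^+ 2)
       else (p * p' + p' * p) / (p ^+ 2 + p' ^+ 2)))) => p p' k k'.
    by rewrite !mulrNN !sqrrN.
  split; first exact: alp.
    by move=> w; rewrite tau1; exact: rg_e1 reg _.
  move=> w; have := alp w; rewrite /alpha /beta => -[-> ->].
  suff -> : G (tau (w + 1)) = G (tau w) by [].
  rewrite tau1 /G /D /r.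
  apply: (@even_periodic _ (fun p p' k k' => (p * k' - p' * k) / (p ^+ 2 + p' ^+ 2))) => p p' k k'.
  by rewrite !mulrNN !sqrrN.
- split; first by move=> w; rewrite /enorm /edot /alpha /= -!expr2 alE sqrtr1.
  move=> w qw; rewrite /beta /G.
  have -> : r (tau w) = 0 by apply/eqP; rewrite -[_ == _]negbK -qE qw eqxx.
  by rewrite invr0 !mulr0 !mul0r.
- move=> w; rewrite qE => rw; rewrite enq /alpha /al1 /al2 (negbTE rw).
  by congr (_, _); rewrite /GRing.scale /= mulrC.
- apply: aeW => w; rewrite qE => rw.
  have [dq qd] := q_derive rw; have [k1 k2] := al_HD rw.
  have [da ad] : derivable alpha w 1 /\ alpha^`()%classic w =
     (- 2 * D (tau w) / r (tau w) * al2 (tau w) * (n / r (tau w)), 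
      2 * D (tau w) / r (tau w) * al1 (tau w) * (n / r (tau w))).
    by apply: HD_curve; [exact: comp_HD rw k1|exact: comp_HD rw k2].
  split; [exact: dq|exact: da| |].
  + rewrite qd enq enorm_sqr /= VV /speed eE//; field; exact: rw.
  + rewrite ad enq /beta /G; congr (_, _); rewrite /GRing.scale /=; field; exact: rw.
Qed.

Lemma regular_CollS : CollS Q A q.
Proof. by split; [exact: collision_orbit|move=> w; exact: orbit_ode]. Qed.

Lemma regular_inverse : [/\ continuous (inverse t), cancel t (inverse t),
  cancel (inverse t) t & forall w, inverse t (w + 1) = inverse t w + 1].
Proof. by split; [exact: ctau|exact: tauK|exact: tauKV|exact: tau1]. Qed.

Lemma regular_nz s : 0 < x s ^+ 2 + y s ^+ 2 + (u s ^+ 2 + v s ^+ 2).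
Proof.
have [rs|rs] := eqVneq (r s) 0; first by rewrite ltr_wpDl ?r0//; exact: uv_pos.
by rewrite ltr_pwDl ?addr_ge0 ?sqr_ge0// lt_neqAle eq_sym rs r0.
Qed.

End collision.

(** * Injectivity *)

Section injectivity.
Context {R : realType}.
Implicit Types (s w a b c d : R).

Lemma csqr_inj a b c d : csqr (a, b) = csqr (c, d) ->
  exists sg : bool, c = (-1) ^+ sg * a /\ d = (-1) ^+ sg * b.
Proof.
move=> h; have E : a ^+ 2 + b ^+ 2 = c ^+ 2 + d ^+ 2 by rewrite -!enorm_csqr h.
move: h; rewrite /csqr /= => -[E1 E2].
have E3 : (c - a) * (c + a) = 0 by rewrite -subr_sqr; lra.
have E4 : (d - b) * (d + b) = 0 by rewrite -subr_sqr; lra.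
have E5 : c * d = a * b by lra.
move/eqP: E3; rewrite mulf_eq0 subr_eq0 addr_eq0 => /orP[/eqP ca|/eqP ca].
  have [a0|a0] := eqVneq a 0.
    move/eqP: E4; rewrite mulf_eq0 subr_eq0 addr_eq0 => /orP[/eqP ->|/eqP ->].
      by exists false; rewrite ca !mul1r.
    by exists true; rewrite ca a0 mulr0 mulN1r.
  exists false; rewrite ca !mul1r; split => //.
  by apply: (mulfI a0); rewrite -E5 ca.
have [a0|a0] := eqVneq a 0.
  move/eqP: E4; rewrite mulf_eq0 subr_eq0 addr_eq0 => /orP[/eqP ->|/eqP ->].
    by exists false; rewrite ca a0 oppr0 !mul1r.
  by exists true; rewrite ca !mulN1r.
exists true; rewrite ca !mulN1r; split => //.
by apply: (mulfI a0); rewrite mulrN -E5 ca mulNr opprK.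
Qed.

Lemma cmul_eq0 a b c d : a ^+ 2 + b ^+ 2 != 0 ->
  a * c - b * d = 0 -> a * d + b * c = 0 -> c = 0 /\ d = 0.
Proof.
move=> ab E1 E2; split; apply: (mulfI ab); rewrite mulr0.
  by transitivity (a * (a * c - b * d) + b * (a * d + b * c)); [ring|rewrite E1 E2; ring].
by transitivity (a * (a * d + b * c) - b * (a * c - b * d)); [ring|rewrite E1 E2; ring].
Qed.

Lemma nonvanishing_sign (S : R -> R) : continuous S -> (forall s, S s != 0) ->
  0 < S 0 -> forall s, 0 < S s.
Proof.
move=> cS S0 S00 s; rewrite ltNge; apply/negP => Ss.
have K a b : a <= b -> Num.min (S a) (S b) <= 0 <= Num.max (S a) (S b) -> False.
  move=> ab h; have [c _ Ec] := IVT ab (continuous_subspaceT cS) h.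
  by have := S0 c; rewrite Ec eqxx.
have [h|h] := leP 0 s.
  by apply: (K 0 s h); rewrite ge_min le_max Ss (ltW S00) orbT.
by apply: (K s 0 (ltW h)); rewrite ge_min le_max Ss (ltW S00) orbT.
Qed.

Section loops.
Variables (x y u v du dv x' y' u' v' du' dv' : R -> R).
Hypotheses (hx : forall s, HD x s (u s)) (hy : forall s, HD y s (v s)).
Hypotheses (hu : forall s, HD u s (du s)) (hv : forall s, HD v s (dv s)).
Hypotheses (hx' : forall s, HD x' s (u' s)) (hy' : forall s, HD y' s (v' s)).
Hypotheses (hu' : forall s, HD u' s (du' s)) (hv' : forall s, HD v' s (dv' s)).
Hypothesis nz : forall s, 0 < x s ^+ 2 + y s ^+ 2 + (u s ^+ 2 + v s ^+ 2).
Hypothesis E : forall s, csqr (x s, y s) = csqr (x' s, y' s).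

(** At every [s] the two curves agree up to sign together with their derivatives: off the zeros of z
    this follows from z z', at a zero from z'^2. The sign is constant because the inner product [S]
    of the two curves in R^4 is continuous and vanishes nowhere. *)
Lemma csqr_loop_inj : exists sg : bool, forall s, x' s = (-1) ^+ sg * x s /\ y' s = (-1) ^+ sg * y s.
Proof.
have D1 s : x s * u s - y s * v s = x' s * u' s - y' s * v' s.
  have h1 : HD (fun s => (csqr (x s, y s)).1) s (2 * (x s * u s - y s * v s)).
    by rewrite /csqr /=; der; ring.
  have h2 : HD (fun s => (csqr (x s, y s)).1) s (2 * (x' s * u' s - y' s * v' s)).
    by under eq_fun do rewrite E; rewrite /csqr /=; der; ring.
  by have := HD_uniq h1 h2; lra.
have D2 s : x s * v s + y s * u s = x' s * v' s + y' s * u' s.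
  have h1 : HD (fun s => (csqr (x s, y s)).2) s (2 * (x s * v s + y s * u s)).
    by rewrite /csqr /=; der; ring.
  have h2 : HD (fun s => (csqr (x s, y s)).2) s (2 * (x' s * v' s + y' s * u' s)).
    by under eq_fun do rewrite E; rewrite /csqr /=; der; ring.
  by have := HD_uniq h1 h2; lra.
(* At a zero of z the second derivative drops out of (z z')', which leaves z'^2. *)
have D0 s : x s = 0 -> y s = 0 -> csqr (u s, v s) = csqr (u' s, v' s).
  move=> xs ys; have [sg [xs' ys']] := csqr_inj (E s).
  rewrite xs mulr0 in xs'; rewrite ys mulr0 in ys'.
  rewrite /csqr /=; congr (_, _).
    have k1 : HD (fun s => x s * u s - y s * v s) s (u s * u s - v s * v s).
      by der; rewrite xs ys; ring.
    have k2 : HD (fun s => x s * u s - y s * v s) s (u' s * u' s - v' s * v' s).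
      by under eq_fun do rewrite D1; der; rewrite xs' ys'; ring.
    exact: HD_uniq k1 k2.
  have k1 : HD (fun s => x s * v s + y s * u s) s (u s * v s + v s * u s).
    by der; rewrite xs ys; ring.
  have k2 : HD (fun s => x s * v s + y s * u s) s (u' s * v' s + v' s * u' s).
    by under eq_fun do rewrite D2; der; rewrite xs' ys'; ring.
  exact: HD_uniq k1 k2.
have P s : exists sg : bool, (x' s = (-1) ^+ sg * x s /\ y' s = (-1) ^+ sg * y s) /\
    (u' s = (-1) ^+ sg * u s /\ v' s = (-1) ^+ sg * v s).
  have [sg [xs' ys']] := csqr_inj (E s).
  have [rs|rs] := eqVneq (x s ^+ 2 + y s ^+ 2) 0.
    have [xs ys] := sqrD_eq0 rs; have [sg' h] := csqr_inj (D0 s xs ys).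
    by exists sg'; rewrite xs' ys' xs ys !mulr0.
  exists sg; split => //.
  have [E1 E2] := @cmul_eq0 (x s) (y s) ((-1) ^+ sg * u' s - u s) ((-1) ^+ sg * v' s - v s) rs
    ltac:(have := D1 s; rewrite xs' ys'; lra) ltac:(have := D2 s; rewrite xs' ys'; lra).
  by split; [have -> : u s = (-1) ^+ sg * u' s by lra|have -> : v s = (-1) ^+ sg * v' s by lra];
    case: (sg); rewrite ?expr0 ?expr1 ?mul1r ?mulN1r ?opprK.
have cx := HD_continuous hx.
have cy := HD_continuous hy.
have cu := HD_continuous hu.
have cv := HD_continuous hv.
have cx' := HD_continuous hx'.
have cy' := HD_continuous hy'.
have cu' := HD_continuous hu'.
have cv' := HD_continuous hv'.
pose S s := x s * x' s + y s * y' s + (u s * u' s + v s * v' s).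
have cS : continuous S by move=> s; rewrite /S; ct.
have SE s (sg : bool) : x' s = (-1) ^+ sg * x s /\ y' s = (-1) ^+ sg * y s ->
    u' s = (-1) ^+ sg * u s /\ v' s = (-1) ^+ sg * v s ->
    S s = (-1) ^+ sg * (x s ^+ 2 + y s ^+ 2 + (u s ^+ 2 + v s ^+ 2)).
  by move=> [h1 h2] [h3 h4]; rewrite /S h1 h2 h3 h4; ring.
have [sg [h0 h0']] := P 0.
exists sg => s; have [sg' [h1 h1']] := P s.
suff -> : sg = sg' by [].
have N1 := nz 0; have N2 := nz s.
have S0 s' : (-1) ^+ sg * S s' != 0.
  have [k [k1 k2]] := P s'; rewrite (SE _ _ k1 k2) !mulf_neq0 ?signr_eq0//.
  by rewrite gt_eqF//; exact: nz.
have := @nonvanishing_sign (fun s => (-1) ^+ sg * S s) _ S0 _ s.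
rewrite (SE _ _ h0 h0') (SE _ _ h1 h1') !mulrA -!signr_addb addbb mul1r.
move=> /(_ _ N1); rewrite pmulr_lgt0//.
case: (sg) (sg') => -[] //= h; exfalso.
all: suff : (0 < -1 :> R) by rewrite ltr0N1.
all: by rewrite -[ltRHS](expr1 (-1)); apply: h => s'; ct.
Qed.
End loops.

Variables (Q : set (plane R)) (A : R -> plane R -> plane R).
Variables (n n' : R) (t x y u v e t' x' y' u' v' e' : R -> R).
Hypotheses (reg : regular Q A n t x y u v e) (reg' : regular Q A n' t' x' y' u' v' e').
Hypothesis orbitE : forall w, regular_orbit t x y w = regular_orbit t' x' y' w.

Lemma same_time s : t s = t' s.
Proof.
have [ct1 tK tKV t1] := regular_inverse reg.
have [ct1' tK' tKV' t1'] := regular_inverse reg'.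
have n0 := rg_n reg; have n0' := rg_n reg'.
have nN : n != 0 by rewrite gt_eqF. have nN' : n' != 0 by rewrite gt_eqF.
have rE w : x' (inverse t' w) ^+ 2 + y' (inverse t' w) ^+ 2 = x (inverse t w) ^+ 2 + y (inverse t w) ^+ 2.
  by have := congr1 enorm (orbitE w); rewrite /regular_orbit !enorm_csqr => ->.
have G a b : inverse t a / n - inverse t' a / n' = inverse t b / n - inverse t' b / n'.
  apply: (@HD0_const_isolated _ (fun w => inverse t w / n - inverse t' w / n')) => w; first by ct.
  have [d d0 hd] := regular_isolated reg w; exists d => // w' ne /(hd w' ne) rw.
  have h1 := regular_inverse_HD reg rw.
  have rw' := rw; rewrite -rE in rw'.
  have h2 := regular_inverse_HD reg' rw'.
  by der; rewrite rE; field; rewrite rw nN nN'.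
have i0 : inverse t 0 = 0 by rewrite -{1}(rg_t0 reg) tK.
have i0' : inverse t' 0 = 0 by rewrite -{1}(rg_t0 reg') tK'.
(* Both inverse times advance by 1 over one period, so [G] between 0 and 1 reads 1 / n = 1 / n'. *)
have nn : n = n'.
  have := G 1 0; rewrite -(add0r 1) t1 t1' i0 i0' !add0r !mul0r subrr => /eqP.
  by rewrite subr_eq0 !div1r => /eqP/invr_inj.
have E w : inverse t w = inverse t' w.
  have := G w 0; rewrite i0 i0' !mul0r subrr nn => /eqP; rewrite subr_eq0 => /eqP.
  by apply: mulIf; rewrite invr_eq0.
by rewrite -[in RHS](tK s) E tKV'.
Qed.

Lemma same_loop : exists sg : bool, forall s, x' s = (-1) ^+ sg * x s /\ y' s = (-1) ^+ sg * y s.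
Proof.
have [ct1 tK tKV t1] := regular_inverse reg.
have [ct1' tK' tKV' t1'] := regular_inverse reg'.
have E s : csqr (x s, y s) = csqr (x' s, y' s).
  have h := orbitE (t s); rewrite /regular_orbit (tK s) (same_time s) (tK' s) in h; exact: h.
exact: (csqr_loop_inj (rg_x reg) (rg_y reg) (rg_u reg) (rg_v reg)
  (rg_x reg') (rg_y reg') (rg_u reg') (rg_v reg') (regular_nz reg) E).
Qed.

End injectivity.

(** * Regularization of collision orbits *)

Section squareroots.
Context {R : realType}.
Implicit Types (s a b c d : R).

Lemma csqr_surj a b : exists c d, csqr (c, d) = (a, b).
Proof.
pose p := Num.sqrt (a ^+ 2 + b ^+ 2).
have p2 : p ^+ 2 = a ^+ 2 + b ^+ 2 by rewrite sqr_sqrtr// addr_ge0 ?sqr_ge0.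
have p0 : 0 <= p by exact: sqrtr_ge0.
have b0 := sqr_ge0 b.
have [pa pa'] : 0 <= p + a /\ 0 <= p - a by split; nra.
pose c := Num.sqrt ((p + a) / 2); pose d := Num.sqrt ((p - a) / 2).
have c2 : c * c = (p + a) / 2 by rewrite -expr2 sqr_sqrtr//; lra.
have d2 : d * d = (p - a) / 2 by rewrite -expr2 sqr_sqrtr//; lra.
have cd : (2 * (c * d)) ^+ 2 = b ^+ 2.
  transitivity (4 * ((c * c) * (d * d))); first by ring.
  by rewrite c2 d2; lra.
have cd0 : 0 <= 2 * (c * d) by rewrite !mulr_ge0// sqrtr_ge0.
have [b0'|b0'] := leP 0 b.
  have E : 2 * (c * d) = b.
    by apply/eqP; rewrite -(@eqrXn2 _ 2)// cd.
  by exists c, d; rewrite /csqr /=; congr (_, _); lra.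
have E : 2 * (c * d) = - b.
  by apply/eqP; rewrite -(@eqrXn2 _ 2)// ?cd ?sqrrN//; lra.
by exists c, (- d); rewrite /csqr /=; congr (_, _); lra.
Qed.

(* g = exp of the primitive of m' / (2 m). *)
Lemma csqr_lift (m1 m2 d1 d2 : R -> R) :
  (forall s, HD m1 s (d1 s)) -> (forall s, HD m2 s (d2 s)) ->
  continuous d1 -> continuous d2 -> (forall s, m1 s ^+ 2 + m2 s ^+ 2 != 0) ->
  exists g1 g2 : R -> R,
    let la s := (m1 s * d1 s + m2 s * d2 s) / (2 * (m1 s ^+ 2 + m2 s ^+ 2)) in
    let lb s := (m1 s * d2 s - m2 s * d1 s) / (2 * (m1 s ^+ 2 + m2 s ^+ 2)) in
  [/\ forall s, HD g1 s (la s * g1 s - lb s * g2 s),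
      forall s, HD g2 s (la s * g2 s + lb s * g1 s) &
      forall s, csqr (g1 s, g2 s) = (m1 s, m2 s)].
Proof.
move=> h1 h2 cd1 cd2 m0.
have [c1 [c2 c12]] := csqr_surj (m1 0) (m2 0).
pose la s := (m1 s * d1 s + m2 s * d2 s) / (2 * (m1 s ^+ 2 + m2 s ^+ 2)).
pose lb s := (m1 s * d2 s - m2 s * d1 s) / (2 * (m1 s ^+ 2 + m2 s ^+ 2)).
have cm1 := HD_continuous h1.
have cm2 := HD_continuous h2.
have m0' s : 2 * (m1 s ^+ 2 + m2 s ^+ 2) != 0 by rewrite mulf_neq0.
have cla : continuous la by move=> s; have := m0' s => ?; rewrite /la; ct.
have clb : continuous lb by move=> s; have := m0' s => ?; rewrite /lb; ct.
pose E s := expR (prim la s); pose T s := prim lb s.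
have hE s : HD E s (E s * la s) by apply: HD_exp; exact: prim_HD.
have hT s : HD T s (lb s) by exact: prim_HD.
pose g1 s := E s * (c1 * cos (T s) - c2 * sin (T s)).
pose g2 s := E s * (c1 * sin (T s) + c2 * cos (T s)).
have hg1 s : HD g1 s (la s * g1 s - lb s * g2 s) by rewrite /g1; der; rewrite /g2; ring.
have hg2 s : HD g2 s (la s * g2 s + lb s * g1 s) by rewrite /g2; der; rewrite /g1; ring.
exists g1, g2; split => // s.
(* F1 + i F2 is g^2 / m, which is constant and equals 1 at 0. *)
pose rho s := m1 s ^+ 2 + m2 s ^+ 2.
pose F1 s := ((g1 s * g1 s - g2 s * g2 s) * m1 s + 2 * (g1 s * g2 s) * m2 s) / rho s.
pose F2 s := (2 * (g1 s * g2 s) * m1 s - (g1 s * g1 s - g2 s * g2 s) * m2 s) / rho s.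
have hF1 s' : HD F1 s' 0.
  rewrite /F1 /rho; der; first exact: m0.
  by rewrite /la /lb; field; rewrite m0.
have hF2 s' : HD F2 s' 0.
  rewrite /F2 /rho; der; first exact: m0.
  by rewrite /la /lb; field; rewrite m0.
have g10 : g1 0 = c1 by rewrite /g1 /E /T !prim0 expR0 cos0 sin0; ring.
have g20 : g2 0 = c2 by rewrite /g2 /E /T !prim0 expR0 cos0 sin0; ring.
move: c12; rewrite /csqr /= => -[e1 e2].
have F10 : F1 s = 1.
  rewrite (HD0_const s 0 hF1) /F1 /rho g10 g20 e1.
  have -> : 2 * (c1 * c2) = m2 0 by lra.
  by rewrite -!expr2 divff.
have F20 : F2 s = 0.
  rewrite (HD0_const s 0 hF2) /F2 /rho g10 g20 e1.
  have -> : 2 * (c1 * c2) = m2 0 by lra.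
  by rewrite (mulrC (m2 0)) subrr mul0r.
move: F10 F20; rewrite /F1 /F2 /rho; move: (m0 s) => m0s.
move: (g1 s) (g2 s) (m1 s) (m2 s) m0s => G1 G2 M1 M2 m0s k1 k2.
have k1' : (G1 * G1 - G2 * G2) * M1 + 2 * (G1 * G2) * M2 = M1 ^+ 2 + M2 ^+ 2.
  by have := congr1 (fun z => z * (M1 ^+ 2 + M2 ^+ 2)) k1; rewrite mul1r mulfVK.
have k2' : 2 * (G1 * G2) * M1 - (G1 * G1 - G2 * G2) * M2 = 0.
  by have := congr1 (fun z => z * (M1 ^+ 2 + M2 ^+ 2)) k2; rewrite mul0r mulfVK.
have [] := @cmul_eq0 _ M1 (- M2) (G1 * G1 - G2 * G2 - M1) (G1 * G2 + G2 * G1 - M2).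
- by rewrite sqrrN.
- by lra.
- by lra.
by move=> z1 z2; congr (_, _); lra.
Qed.

Lemma squeeze_zero (g c : R -> R) s : (forall q, g q ^+ 2 <= c q) ->
  {for s, continuous c} -> c s = 0 -> {for s, continuous g}.
Proof.
move=> gc cc c0.
have gs : g s = 0.
  by apply/eqP; rewrite -sqrf_eq0 eq_le sqr_ge0 andbT -c0.
apply/ctP => e e0; have [d d0 hd] := (ctP _ _).1 cc _ (exprn_gt0 2 e0).
exists d => // q /hd; rewrite c0 gs !subr0 => h.
rewrite -(@ltr_pXn2r _ 2)// ?nnegrE ?(ltW e0)// real_normK ?num_real//.
by apply: le_lt_trans (gc q) _; apply: le_lt_trans (ler_norm _) h.
Qed.

End squareroots.

(** * The regularizing time and the square roots of radius and direction *)

Section regularization.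
Context {R : realType}.
Implicit Types (s t d : R).

(* A collision orbit q with velocity p, moving in the magnetic field b and the
   force field - a. *)
Record collision_system (q1 q2 p1 p2 r e al1 al2 a1 a2 b : R -> R) : Prop := CollisionSystem {
  cs_r : forall t, r t = Num.sqrt (q1 t ^+ 2 + q2 t ^+ 2);
  cs_cq1 : continuous q1;
  cs_cq2 : continuous q2;
  cs_ce : continuous e;
  cs_cal1 : continuous al1;
  cs_cal2 : continuous al2;
  cs_cG : continuous (fun t => (q1 t * p2 t - q2 t * p1 t) / r t);
  cs_ca1 : continuous a1;
  cs_ca2 : continuous a2;
  cs_cb : continuous b;
  cs_iso : forall t, exists2 d : R, 0 < d & forall s, s != t -> `|s - t| < d -> r s != 0;
  cs_q1 : forall t, r t != 0 -> HD q1 t (p1 t);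
  cs_q2 : forall t, r t != 0 -> HD q2 t (p2 t);
  cs_p1 : forall t, r t != 0 -> HD p1 t (b t * p2 t - a1 t - q1 t / r t ^+ 3);
  cs_p2 : forall t, r t != 0 -> HD p2 t (- b t * p1 t - a2 t - q2 t / r t ^+ 3);
  cs_al1 : forall t, q1 t = r t * al1 t;
  cs_al2 : forall t, q2 t = r t * al2 t;
  cs_norm : forall t, al1 t ^+ 2 + al2 t ^+ 2 = 1;
  cs_energy : forall t, r t != 0 -> e t = (p1 t ^+ 2 + p2 t ^+ 2) / 2 - (r t)^-1;
  cs_per : forall t, [/\ q1 (t + 1) = q1 t, q2 (t + 1) = q2 t, p1 (t + 1) = p1 t & p2 (t + 1) = p2 t];
  cs_per' : forall t, [/\ e (t + 1) = e t, a1 (t + 1) = a1 t, a2 (t + 1) = a2 t & b (t + 1) = b t]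
}.

Variables (q1 q2 p1 p2 r e al1 al2 a1 a2 b : R -> R).
Hypothesis cs : collision_system q1 q2 p1 p2 r e al1 al2 a1 a2 b.

Let cq1 := cs_cq1 cs. Let cq2 := cs_cq2 cs. Let ce := cs_ce cs.
Let ca1 := cs_ca1 cs. Let ca2 := cs_ca2 cs. Let cb := cs_cb cs.
Let cal1 := cs_cal1 cs. Let cal2 := cs_cal2 cs.
Let hq1 := cs_q1 cs. Let hq2 := cs_q2 cs.
Let hp1 := cs_p1 cs. Let hp2 := cs_p2 cs.
Let alE1 := cs_al1 cs. Let alE2 := cs_al2 cs.
Let rE := cs_r cs.

Let r2 t : r t ^+ 2 = q1 t ^+ 2 + q2 t ^+ 2.
Proof. by rewrite rE sqr_sqrtr// addr_ge0 ?sqr_ge0. Qed.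
Let r0 t : 0 <= r t. Proof. by rewrite rE sqrtr_ge0. Qed.
Let cr : continuous r.
Proof.
have -> : r = (fun t => Num.sqrt (q1 t ^+ 2 + q2 t ^+ 2)) by apply/funext.
by move=> t; ct.
Qed.

Definition momentum t := q1 t * p2 t - q2 t * p1 t.
Definition radial t := q1 t * p1 t + q2 t * p2 t.
Notation L := momentum.
Notation w := radial.
Let G t := L t / r t.
Let cG : continuous G. Proof. exact: cs_cG cs. Qed.

Let rz t : r t = 0 -> q1 t = 0 /\ q2 t = 0.
Proof. by move=> rt; rewrite alE1 alE2 rt !mul0r. Qed.

Let rG t : r t * G t = L t.
Proof.
have [rt|rt] := eqVneq (r t) 0; last by rewrite /G mulrC mulfVK.
by have [z1 z2] := rz rt; rewrite rt /momentum z1 z2; ring.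
Qed.

Let energy_all t : w t ^+ 2 + L t ^+ 2 = 2 * e t * r t ^+ 2 + 2 * r t.
Proof.
have [rt|rt] := eqVneq (r t) 0.
  by have [z1 z2] := rz rt; rewrite rt /momentum /radial z1 z2; ring.
transitivity ((q1 t ^+ 2 + q2 t ^+ 2) * (p1 t ^+ 2 + p2 t ^+ 2)).
  by rewrite /radial /momentum; ring.
by rewrite -r2 (cs_energy cs rt); field.
Qed.

Let cbd : continuous (fun t => 2 * e t * r t ^+ 2 + 2 * r t). Proof. by move=> t; ct. Qed.

(** At a collision the velocity is unbounded, but w^2 <= 2 e r^2 + 2 r by [energy_all]. *)
Let cw : continuous w.
Proof.
move=> t; have [rt|rt] := eqVneq (r t) 0.
  apply: (@squeeze_zero _ w (fun t => 2 * e t * r t ^+ 2 + 2 * r t) t) => [q||].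
  - by rewrite -energy_all lerDl sqr_ge0.
  - exact (@cbd t).
  - by rewrite rt; ring.
have c1 := HD_cont (hp1 rt); have c2 := HD_cont (hp2 rt).
by rewrite /radial; ct.
Qed.

Let cL : continuous L.
Proof.
have -> : L = (fun t => r t * G t) by apply/funext => t; rewrite rG.
by move=> t; ct.
Qed.

Let hr t : r t != 0 -> HD r t (w t / r t).
Proof.
move=> rt; have h1 := hq1 rt; have h2 := hq2 rt.
have rt0 : 0 < q1 t ^+ 2 + q2 t ^+ 2 by rewrite -r2 exprn_even_gt0.
apply: (@HD_near _ (fun t => Num.sqrt (q1 t ^+ 2 + q2 t ^+ 2))).
  by apply/nearRP; exists 1 => // s _; rewrite rE.
der; first exact: rt0.
by rewrite -rE /radial; field.
Qed.

(** The continuous part of w' = |p|^2 + <q, p'>: by the energy |p|^2 = 2 e + 2 / r, and the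
    attraction contributes - 1 / r. *)
Let K t := 2 * e t - (q1 t * a1 t + q2 t * a2 t) + b t * L t.
Let cK : continuous K. Proof. by move=> t; rewrite /K; ct. Qed.

Let hw t : r t != 0 -> HD w t ((r t)^-1 + K t).
Proof.
move=> rt; have h1 := hq1 rt; have h2 := hq2 rt; have h3 := hp1 rt; have h4 := hp2 rt.
rewrite /radial; der; rewrite /K (cs_energy cs rt) /momentum.
have E : q2 t ^+ 2 = r t ^+ 2 - q1 t ^+ 2 by rewrite r2; ring.
transitivity (p1 t ^+ 2 + p2 t ^+ 2 - (q1 t * a1 t + q2 t * a2 t)
  + b t * (q1 t * p2 t - q2 t * p1 t) - (q1 t ^+ 2 + q2 t ^+ 2) / r t ^+ 3); first by field.
by rewrite -r2; field.
Qed.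

Let near_off t : r t != 0 -> \near t, r t != 0.
Proof. exact: (near_neq0 (@cr t)). Qed.

Let he t : r t != 0 -> HD e t (- (p1 t * a1 t + p2 t * a2 t)).
Proof.
move=> rt; have h1 := hr rt; have h3 := hp1 rt; have h4 := hp2 rt.
apply: (@HD_near _ (fun t => (p1 t ^+ 2 + p2 t ^+ 2) / 2 - (r t)^-1)).
  by apply: filterS (near_off rt) => s rs; rewrite (cs_energy cs rs).
by der; first exact: rt; rewrite /radial; field.
Qed.

Let KL t := - b t * w t - (q1 t * a2 t - q2 t * a1 t).
Let cKL : continuous KL. Proof. by move=> t; rewrite /KL; ct. Qed.

Let hL t : r t != 0 -> HD L t (KL t).
Proof.
move=> rt; have h1 := hq1 rt; have h2 := hq2 rt; have h3 := hp1 rt; have h4 := hp2 rt.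
by rewrite /momentum; der; rewrite /KL /radial; ring.
Qed.

(** Radial and tangential parts: r p = w alpha + L i alpha. The right-hand side is continuous and
    replaces r p in formulas that have to make sense at a collision, such as [e1]. *)
Let pal t : r t != 0 -> r t * p1 t = w t * al1 t - L t * al2 t /\ r t * p2 t = w t * al2 t + L t * al1 t.
Proof.
move=> rt.
have E1 : al1 t = q1 t / r t by rewrite alE1 mulrC mulKf.
have E2 : al2 t = q2 t / r t by rewrite alE2 mulrC mulKf.
rewrite E1 E2 /radial /momentum; split; apply: (mulIf rt).
  by transitivity (p1 t * r t ^+ 2); [ring|rewrite r2; field].
by transitivity (p2 t * r t ^+ 2); [ring|rewrite r2; field].
Qed.

Let hal t : r t != 0 -> HD al1 t (- (L t * al2 t) / r t ^+ 2) /\ HD al2 t (L t * al1 t / r t ^+ 2).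
Proof.
move=> rt; have h1 := hq1 rt; have h2 := hq2 rt; have h3 := hr rt.
have [e1 e2] := pal rt.
have P1 : p1 t = (w t * al1 t - L t * al2 t) / r t by rewrite -e1 mulrC mulKf.
have P2 : p2 t = (w t * al2 t + L t * al1 t) / r t by rewrite -e2 mulrC mulKf.
split.
  apply: (@HD_near _ (fun t => q1 t / r t)).
    by apply: filterS (near_off rt) => s rs; rewrite alE1 mulrC mulKf.
  by der; first exact: rt; rewrite P1 alE1; field.
apply: (@HD_near _ (fun t => q2 t / r t)).
  by apply: filterS (near_off rt) => s rs; rewrite alE2 mulrC mulKf.
by der; first exact: rt; rewrite P2 alE2; field.
Qed.

(* An explicit primitive of 1 / r, continuous through the collisions. *)
Let P t := w t - prim K t - w 0.
Let hP t : r t != 0 -> HD P t (r t)^-1.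
Proof.
by move=> rt; have h1 := hw rt; have h2 := prim_HD t cK; rewrite /P; der; ring.
Qed.
Let cP : continuous P.
Proof. by move=> t; have c := prim_cont cK; rewrite /P; ct. Qed.
Let w1 t : w (t + 1) = w t.
Proof. by have [h1 h2 h3 h4] := cs_per cs t; rewrite /radial h1 h2 h3 h4. Qed.
Let L1 t : L (t + 1) = L t.
Proof. by have [h1 h2 h3 h4] := cs_per cs t; rewrite /momentum h1 h2 h3 h4. Qed.
Let P1 t : P (t + 1) = P t + P 1.
Proof.
rewrite /P w1 (periodic_prim t cK).
  by rewrite -[w 1](congr1 w (add0r 1)) w1; ring.
move=> s; have [h1 h2 _ _] := cs_per cs s; have [h3 h4 h5 h6] := cs_per' cs s.
by rewrite /K L1 h1 h2 h3 h4 h5 h6.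
Qed.
Let P_mono s t : s < t -> P s < P t.
Proof.
apply: (@strict_mono_isolated _ P (fun t => (r t)^-1) cP) => t'.
have [d d0 hd] := cs_iso cs t'; exists d => // s' ne /(hd s' ne) rs.
by split; [exact: hP|rewrite invr_gt0 lt_neqAle eq_sym rs r0].
Qed.
Let P0 : P 0 = 0. Proof. by rewrite /P prim0; ring. Qed.
Let P10 : 0 < P 1. Proof. by rewrite -P0; exact: P_mono. Qed.

(** The scale for which n P advances by 1 over one period. It becomes the squared norm of the loop,
    because t' = r / n. *)
Definition period_norm : R := (P 1)^-1.
Let n := period_norm.
Let n0 : 0 < n. Proof. by rewrite invr_gt0. Qed.
Let nN : n != 0. Proof. by rewrite gt_eqF. Qed.
Let tau t := n * P t.
Let ctau : continuous tau. Proof. by move=> t; rewrite /tau; ct. Qed.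
Let tau1 t : tau (t + 1) = tau t + 1.
Proof. by rewrite /tau P1 mulrDr /n /period_norm mulVf// gt_eqF. Qed.
Let tau_mono s t : s < t -> tau s < tau t.
Proof. by move=> /P_mono h; rewrite /tau ltr_pM2l. Qed.

Let t := inverse tau.
Let ctt : continuous t. Proof. exact (inverse_cont ctau tau1 tau_mono). Qed.
Let tK s : t (tau s) = s. Proof. exact (inverseK tau_mono s). Qed.
Let tKV s : tau (t s) = s. Proof. exact (inverseKV ctau tau1 tau_mono s). Qed.
Let t1 s : t (s + 1) = t s + 1. Proof. exact (inverse1 ctau tau1 tau_mono s). Qed.
Let t0 : t 0 = 0. Proof. by rewrite -[RHS]tK /tau P0 mulr0. Qed.
Let t_inj s s' : t s = t s' -> s = s'.
Proof. by move=> h; rewrite -(tKV s) h tKV. Qed.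

Let isolated s : exists2 d : R, 0 < d & forall s', s' != s -> `|s' - s| < d -> r (t s') != 0.
Proof.
have [d d0 hd] := cs_iso cs (t s).
have [d' d'0 hd'] := (ctP _ _).1 (@ctt s) _ d0.
by exists d' => // s' ne /hd' h; apply: hd => //; apply: contra_neq ne; exact: t_inj.
Qed.

Let extend (F g : R -> R) : continuous F -> continuous g ->
  (forall s, r (t s) != 0 -> HD F s (g s)) -> forall s, HD F s (g s).
Proof.
move=> cF cg h s; apply: HD_lim; [|exact: cF|exact: cg].
by have [d d0 hd] := isolated s; exists d => // s' ne /(hd s' ne); exact: h.
Qed.

Let ctc_ (F : R -> R) : continuous F -> continuous (fun s => F (t s)).
Proof. by move=> cF s; exact: (@ctcomp R R R t F s (@ctt s) (cF (t s))). Qed.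
Let cr' := ctc_ cr. Let ce' := ctc_ ce. Let cw' := ctc_ cw. Let cL' := ctc_ cL.
Let cG' := ctc_ cG. Let ca1' := ctc_ ca1. Let ca2' := ctc_ ca2. Let cb' := ctc_ cb.
Let cal1' := ctc_ cal1. Let cal2' := ctc_ cal2. Let cK' := ctc_ cK. Let cKL' := ctc_ cKL.

(** At a collision [tau] has infinite slope. The inverse function theorem is applied off the
    collisions, and [extend] supplies the slope 0 there. *)
Let ht s : HD t s (r (t s) / n).
Proof.
apply: (extend (F := t) (g := fun s => r (t s) / n)); [exact: ctt|by move=> s'; ct|] => s' rs.
have h : HD tau (inverse tau s') (n / r (t s')).
  by have h1 := hP rs; rewrite /tau; der; ring.
have nr : n / r (t s') != 0 := mulf_neq0 nN (invr_neq0 rs).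
by rewrite -invf_div; exact (inverse_HD ctau tau1 tau_mono nr h).
Qed.

Let comp (F : R -> R) s d : HD F (t s) d -> HD (fun s => F (t s)) s (d * (r (t s) / n)).
Proof. by move=> h; exact: HDcomp h (ht s). Qed.

Let hrs s : HD (fun s => r (t s)) s (w (t s) / n).
Proof.
apply: (extend (F := fun s => r (t s)) (g := fun s => w (t s) / n)) => [||s' rs].
- exact: cr'.
- by move=> s'; ct.
- by apply: HDeq (comp (hr rs)) _; field; rewrite nN.
Qed.

Let hws s : HD (fun s => w (t s)) s ((1 + r (t s) * K (t s)) / n).
Proof.
apply: (extend (F := fun s => w (t s)) (g := fun s => (1 + r (t s) * K (t s)) / n)) => [||s' rs].
- exact: cw'.
- by move=> s'; ct.
- by apply: HDeq (comp (hw rs)) _; field; rewrite nN.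
Qed.

Let e1 s := - ((w (t s) * al1 (t s) - L (t s) * al2 (t s)) * a1 (t s) +
               (w (t s) * al2 (t s) + L (t s) * al1 (t s)) * a2 (t s)) / n.
Let ce1 : continuous e1. Proof. by move=> s; rewrite /e1; ct. Qed.

Let hes s : HD (fun s => e (t s)) s (e1 s).
Proof.
apply: (extend (F := fun s => e (t s)) (g := e1)) => [||s' rs].
- exact: ce'.
- exact: ce1.
- apply: HDeq (comp (he rs)) _; rewrite /e1.
  by have [<- <-] := pal rs; field.
Qed.

Let hals s : HD (fun s => al1 (t s)) s (- (G (t s) / n * al2 (t s))) /\
             HD (fun s => al2 (t s)) s (G (t s) / n * al1 (t s)).
Proof.
split.
  apply: (extend (F := fun s => al1 (t s)) (g := fun s => - (G (t s) / n * al2 (t s)))) => [||s' rs].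
  - exact: cal1'.
  - by move=> s'; ct.
  - by apply: HDeq (comp (hal rs).1) _; rewrite /G; field; rewrite rs nN.
apply: (extend (F := fun s => al2 (t s)) (g := fun s => G (t s) / n * al1 (t s))) => [||s' rs].
- exact: cal2'.
- by move=> s'; ct.
- by apply: HDeq (comp (hal rs).2) _; rewrite /G; field; rewrite rs nN.
Qed.

Let k s := (2 * e (t s) * r (t s) + 2 - L (t s) * G (t s)) / (4 * n ^+ 2).
Let ck_ : continuous k. Proof. by move=> s; rewrite /k; ct. Qed.

Let kr s : 4 * n ^+ 2 * (k s * r (t s)) = w (t s) ^+ 2.
Proof.
transitivity (2 * e (t s) * r (t s) ^+ 2 + 2 * r (t s) - L (t s) * (r (t s) * G (t s))).
  by rewrite /k; field.
by rewrite rG -energy_all; ring.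
Qed.

Let k0 s : 0 <= k s /\ r (t s) + k s != 0.
Proof.
have [rs|rs] := eqVneq (r (t s)) 0.
  have Ls : L (t s) = 0 by rewrite -rG rs mul0r.
  have ks : 0 < k s by rewrite /k rs Ls mulr0 mul0r add0r subr0 divr_gt0// mulr_gt0// exprn_gt0.
  by split; [exact: ltW|rewrite rs add0r gt_eqF].
have rs0 : 0 < r (t s) by rewrite lt_neqAle eq_sym rs r0.
have k0 : 0 <= k s.
  have : 0 <= 4 * n ^+ 2 * (k s * r (t s)) by rewrite kr sqr_ge0.
  by rewrite pmulr_rge0 ?mulr_gt0 ?exprn_gt0// pmulr_lge0.
by split; rewrite // gt_eqF// ltr_wpDr.
Qed.

(** Off the collisions L G = L^2 / r, whose derivative 2 G L' - G^2 r' contains only functions that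
    are continuous everywhere. *)
Let k1 s := (2 * e1 s * r (t s) + 2 * e (t s) * (w (t s) / n)
   - (2 * G (t s) * (KL (t s) * (r (t s) / n)) - G (t s) ^+ 2 * (w (t s) / n))) / (4 * n ^+ 2).
Let ck1 : continuous k1. Proof. by move=> s; rewrite /k1; ct. Qed.

Let near_off' s : r (t s) != 0 -> \near s, r (t s) != 0.
Proof. exact: (near_neq0 (@cr' s)). Qed.

Let hk s : HD k s (k1 s).
Proof.
apply: (extend (F := k) (g := k1)) => [||s' rs]; [exact: ck_|exact: ck1|].
have h1 := hes s'; have h2 := hrs s'; have h3 := comp (hL rs).
apply: (@HD_near _ (fun s => (2 * e (t s) * r (t s) + 2 - L (t s) ^+ 2 / r (t s)) / (4 * n ^+ 2))).
  by apply: filterS (near_off' rs) => s'' rs'; rewrite /k /G mulrA.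
by der; first exact: rs; rewrite /k1 /G; field; rewrite rs nN.
Qed.

(* The square root zeta of r, with a sign changing at each collision. *)
Let radial_lift : exists ze xi : R -> R, [/\ continuous xi, forall s, HD ze s (xi s),
  forall s, ze s ^+ 2 = r (t s), forall s, xi s ^+ 2 = k s &
  forall s, 2 * (ze s * xi s) = w (t s) / n].
Proof.
pose m1 s := r (t s) - k s; pose m2 s := w (t s) / n.
pose d1 s := w (t s) / n - k1 s; pose d2 s := (1 + r (t s) * K (t s)) / n / n.
have hm1 s : HD m1 s (d1 s).
  by have h1 := hrs s; have h2 := hk s; rewrite /m1; der.
have hm2 s : HD m2 s (d2 s).
  by have h1 := hws s; rewrite /m2; der; rewrite /d2; field.
have cd1 : continuous d1 by move=> s; rewrite /d1; ct.
have cd2 : continuous d2 by move=> s; rewrite /d2; ct.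
(* By [kr] the modulus of m1 + i m2 is r + k, which [k0] shows to be nonzero. *)
have E s : m1 s ^+ 2 + m2 s ^+ 2 = (r (t s) + k s) ^+ 2.
  by rewrite /m1 /m2 expr_div_n -kr; field.
have [|ze [xi [hze hxi sq]]] := csqr_lift hm1 hm2 cd1 cd2.
  by move=> s; rewrite E expf_neq0//; exact: (k0 s).2.
have cze := HD_continuous hze.
have cxi := HD_continuous hxi.
have sq1 s : ze s ^+ 2 - xi s ^+ 2 = m1 s by have := sq s; rewrite /csqr /= => -[<- _]; ring.
have sq2 s : 2 * (ze s * xi s) = m2 s by have := sq s; rewrite /csqr /= => -[_ <-]; ring.
have sq3 s : ze s ^+ 2 + xi s ^+ 2 = r (t s) + k s.
  apply/eqP; rewrite -(@eqrXn2 _ 2)// ?addr_ge0 ?sqr_ge0 ?r0 ?(k0 s).1//.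
  by rewrite -E -sq1 -sq2; apply/eqP; ring.
have ze2 s : ze s ^+ 2 = r (t s) by have := sq1 s; have := sq3 s; rewrite /m1; lra.
have xi2 s : xi s ^+ 2 = k s by have := sq1 s; have := sq3 s; rewrite /m1; lra.
(* Off the collisions 2 ze ze' = w / n = 2 ze xi, and [ze] can be cancelled. *)
exists ze, xi; split => //; apply: (extend (F := ze) (g := xi)); [exact: cze|exact: cxi|].
move=> s rs; have zs : ze s != 0 by rewrite -sqrf_eq0 ze2.
have [d h] : exists d, HD ze s d by eexists; exact: hze.
clear hze.
suff -> : xi s = d by [].
have h1 : HD (fun s => r (t s)) s (2 * (ze s * d)).
  under eq_fun do rewrite -ze2.
  by der; ring.
have := HD_uniq h1 (hrs s); rewrite -/(m2 s) -sq2 => h2.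
by apply: (mulfI zs); lra.
Qed.

(** Since |alpha| = 1, the quotient alpha' / (2 alpha) is purely imaginary: the square root turns
    with half the angular speed of alpha and keeps norm 1. *)
Let angular_lift : exists g1 g2 : R -> R, [/\ forall s, HD g1 s (- (G (t s) / (2 * n) * g2 s)),
  forall s, HD g2 s (G (t s) / (2 * n) * g1 s),
  forall s, g1 s ^+ 2 - g2 s ^+ 2 = al1 (t s) /\ 2 * (g1 s * g2 s) = al2 (t s) &
  forall s, g1 s ^+ 2 + g2 s ^+ 2 = 1].
Proof.
have cd1 : continuous (fun s => - (G (t s) / n * al2 (t s))) by move=> s; ct.
have cd2 : continuous (fun s => G (t s) / n * al1 (t s)) by move=> s; ct.
have [|g1 [g2 [h1 h2 sq]]] := csqr_lift (fun s => (hals s).1) (fun s => (hals s).2) cd1 cd2.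
  by move=> s; rewrite (cs_norm cs) oner_eq0.
have la s : (al1 (t s) * - (G (t s) / n * al2 (t s)) + al2 (t s) * (G (t s) / n * al1 (t s))) /
   (2 * (al1 (t s) ^+ 2 + al2 (t s) ^+ 2)) = 0.
  by rewrite (cs_norm cs); field.
have lb s : (al1 (t s) * (G (t s) / n * al1 (t s)) - al2 (t s) * - (G (t s) / n * al2 (t s))) /
   (2 * (al1 (t s) ^+ 2 + al2 (t s) ^+ 2)) = G (t s) / (2 * n).
  transitivity (G (t s) / n * (al1 (t s) ^+ 2 + al2 (t s) ^+ 2) / (2 * (al1 (t s) ^+ 2 + al2 (t s) ^+ 2))).
    by congr (_ / _); ring.
  by rewrite (cs_norm cs); field.
exists g1, g2; split => s.
- by apply: HDeq (h1 s) _; rewrite la lb; ring.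
- by apply: HDeq (h2 s) _; rewrite la lb; ring.
- by have := sq s; rewrite /csqr /= => -[<- <-]; split; ring.
- rewrite -enorm_csqr sq /enorm /edot /= -!expr2 (cs_norm cs).
  by rewrite sqrtr1.
Qed.

Variables (Q : set (plane R)) (A : R -> plane R -> plane R).
Hypothesis Qq : forall s, Q (q1 s, q2 s).
Hypothesis a1E : forall s, a1 s = (dotA A s (q1 s, q2 s)).1.
Hypothesis a2E : forall s, a2 s = (dotA A s (q1 s, q2 s)).2.
Hypothesis bE : forall s, b s = magnetic A s (q1 s, q2 s).

Lemma collision_regular : exists (n : R) (t x y u v e : R -> R),
  regular Q A n t x y u v e /\ forall s, regular_orbit t x y s = (q1 s, q2 s).
Proof.
have [ze [xi [cxi hze ze2 xi2 zx]]] := radial_lift.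
have [g1 [g2 [hg1 hg2 ga gn]]] := angular_lift.
have cze := HD_continuous hze.
have cg1 := HD_continuous hg1.
have cg2 := HD_continuous hg2.
pose h s := G (t s) / (2 * n).
pose x s := ze s * g1 s; pose y s := ze s * g2 s.
pose u s := xi s * g1 s - ze s * h s * g2 s.
pose v s := xi s * g2 s + ze s * h s * g1 s.
have ch : continuous h by move=> s; rewrite /h; ct.
have hx s : HD x s (u s) by rewrite /x; der; rewrite /u /h; ring.
have hy s : HD y s (v s) by rewrite /y; der; rewrite /v /h; ring.
have cx := HD_continuous hx.
have cy := HD_continuous hy.
have cu : continuous u by move=> s; rewrite /u; ct.
have cv : continuous v by move=> s; rewrite /v; ct.
have xy2 s : x s ^+ 2 + y s ^+ 2 = r (t s).
  by rewrite -ze2 -[RHS]mulr1 -(gn s) /x /y; ring.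
have qE s : csqr (x s, y s) = (q1 (t s), q2 (t s)).
  have [e1_ e2_] := ga s; rewrite alE1 alE2 -ze2 -e1_ -e2_ /csqr /x /y /=.
  by congr (_, _); ring.
have zh s : ze s ^+ 2 * h s = L (t s) / (2 * n) by rewrite ze2 /h mulrA rG.
have zu s : x s * u s - y s * v s = (w (t s) * al1 (t s) - L (t s) * al2 (t s)) / (2 * n).
  have [e1_ e2_] := ga s.
  transitivity (ze s * xi s * (g1 s ^+ 2 - g2 s ^+ 2) - ze s ^+ 2 * h s * (2 * (g1 s * g2 s))).
    by rewrite /x /y /u /v; ring.
  rewrite e1_ e2_ zh; have -> : ze s * xi s = w (t s) / n / 2 by have := zx s; lra.
  by field.
have zv s : x s * v s + y s * u s = (w (t s) * al2 (t s) + L (t s) * al1 (t s)) / (2 * n).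
  have [e1_ e2_] := ga s.
  transitivity (ze s * xi s * (2 * (g1 s * g2 s)) + ze s ^+ 2 * h s * (g1 s ^+ 2 - g2 s ^+ 2)).
    by rewrite /x /y /u /v; ring.
  rewrite e1_ e2_ zh; have -> : ze s * xi s = w (t s) / n / 2 by have := zx s; lra.
  by field.
have uv2 s : 2 * n ^+ 2 * (u s ^+ 2 + v s ^+ 2) - 1 = e (t s) * (x s ^+ 2 + y s ^+ 2).
  have -> : u s ^+ 2 + v s ^+ 2 = k s + L (t s) * G (t s) / (4 * n ^+ 2).
    transitivity ((xi s ^+ 2 + ze s ^+ 2 * h s * h s) * (g1 s ^+ 2 + g2 s ^+ 2)).
      by rewrite /u /v; ring.
    by rewrite gn xi2 zh /h; field.
  by rewrite xy2 /k; field.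
have pE s : r (t s) != 0 -> p1 (t s) = 2 * n * (x s * u s - y s * v s) / r (t s) /\
    p2 (t s) = 2 * n * (x s * v s + y s * u s) / r (t s).
  move=> rs; have [E1 E2] := pal rs; split; apply: (mulfI rs).
    by rewrite E1 zu; field; rewrite rs nN.
  by rewrite E2 zv; field; rewrite rs nN.
pose FU s := (e (t s) * x s + 2 * n * (x s ^+ 2 + y s ^+ 2) * b (t s) * v s
  - (x s ^+ 2 + y s ^+ 2) * (x s * a1 (t s) + y s * a2 (t s))) / (2 * n ^+ 2).
pose FV s := (e (t s) * y s - 2 * n * (x s ^+ 2 + y s ^+ 2) * b (t s) * u s
  - (x s ^+ 2 + y s ^+ 2) * (x s * a2 (t s) - y s * a1 (t s))) / (2 * n ^+ 2).
have off s : r (t s) != 0 -> [/\ x s ^+ 2 + y s ^+ 2 != 0,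
   e (t s) = (2 * n ^+ 2 * (u s ^+ 2 + v s ^+ 2) - 1) / (x s ^+ 2 + y s ^+ 2),
   q1 (t s) = x s * x s - y s * y s & q2 (t s) = x s * y s + y s * x s].
  move=> rs; split; first by rewrite xy2.
  - by rewrite uv2 mulfK// xy2.
  - by have [-> _] := qE s.
  - by have [_ ->] := qE s.
have hu s : HD u s (FU s).
  apply: (extend (F := u) (g := FU)) => [||s' rs]; [exact: cu|by move=> s'; rewrite /FU; ct|].
  have h1 := comp (hp1 rs); have h2 := comp (hp2 rs).
  (* Off the collisions z' = p conj(z) / (2 n), so the equation for [p] yields that for z''. *)
  apply: (@HD_near _ (fun s => (p1 (t s) * x s + p2 (t s) * y s) / (2 * n))).
    apply: filterS (near_off' rs) => s'' rs'; have [-> ->] := pE s'' rs'.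
    rewrite -xy2 in rs' *; move: (x s'') (y s'') (u s'') (v s'') rs' => X Y U V rs'.
    by field; rewrite rs' nN.
  have [rs' Es Q1 Q2] := off _ rs; have [Ep1 Ep2] := pE _ rs.
  der; rewrite /FU Ep1 Ep2 Q1 Q2 -xy2 Es.
  move: (b (t s')) (a1 (t s')) (a2 (t s')) (x s') (y s') (u s') (v s') rs' => B A1 A2 X Y U V rs'.
  by field; rewrite rs' nN.
have hv s : HD v s (FV s).
  apply: (extend (F := v) (g := FV)) => [||s' rs]; [exact: cv|by move=> s'; rewrite /FV; ct|].
  have h1 := comp (hp1 rs); have h2 := comp (hp2 rs).
  apply: (@HD_near _ (fun s => (p2 (t s) * x s - p1 (t s) * y s) / (2 * n))).
    apply: filterS (near_off' rs) => s'' rs'; have [-> ->] := pE s'' rs'.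
    rewrite -xy2 in rs' *; move: (x s'') (y s'') (u s'') (v s'') rs' => X Y U V rs'.
    by field; rewrite rs' nN.
  have [rs' Es Q1 Q2] := off _ rs; have [Ep1 Ep2] := pE _ rs.
  der; rewrite /FV Ep1 Ep2 Q1 Q2 -xy2 Es.
  move: (b (t s')) (a1 (t s')) (a2 (t s')) (x s') (y s') (u s') (v s') rs' => B A1 A2 X Y U V rs'.
  by field; rewrite rs' nN.
have nz s : 0 < x s ^+ 2 + y s ^+ 2 + (u s ^+ 2 + v s ^+ 2).
  have p0 : 0 <= x s ^+ 2 + y s ^+ 2 by rewrite addr_ge0 ?sqr_ge0.
  have q0 : 0 <= u s ^+ 2 + v s ^+ 2 by rewrite addr_ge0 ?sqr_ge0.
  rewrite lt_neqAle addr_ge0// andbT eq_sym paddr_eq0//.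
  apply/negP => /andP[/eqP E1 /eqP E2]; have := uv2 s; rewrite E1 E2 !mulr0 sub0r.
  by move/eqP; rewrite oppr_eq0 oner_eq0.
have per s : csqr (x s, y s) = csqr (x (s + 1), y (s + 1)).
  by rewrite !qE t1; have [-> -> _ _] := cs_per cs (t s).
have sg := csqr_loop_inj hx hy hu hv (fun s => HD_shift (hx (s + 1))) (fun s => HD_shift (hy (s + 1)))
  (fun s => HD_shift (hu (s + 1))) (fun s => HD_shift (hv (s + 1))) nz per.
have reg : regular Q A n t x y u v (fun s => e (t s)).
  split.
  - exact: n0.
  - by move=> s; rewrite qE.
  - by move=> s; rewrite xy2; exact: ht.
  - exact: hx.
  - exact: hy.
  - by move=> s; rewrite qE -bE -a1E -a2E; exact: hu.
  - by move=> s; rewrite qE -bE -a1E -a2E; exact: hv.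
  - move=> s; rewrite qE -a1E -a2E zu zv; apply: HDeq (hes s) _.
    by rewrite /e1; field.
  - exact: uv2.
  - exact: t0.
  - exact: t1.
  - by move=> s; rewrite t1; have [-> _ _ _] := cs_per' cs (t s).
  - exact: sg.
exists n, t, x, y, u, v, (fun s => e (t s)); split; first exact: reg.
by have [_ _ tKV' _] := regular_inverse reg => s; rewrite /regular_orbit qE tKV'.
Qed.

End regularization.

(** * Weak derivatives, almost everywhere identities and isolated zeros *)

Section weak.
Context {R : realType}.
Notation mu := (@lebesgue_measure R).
Implicit Types (s t d a b : R).

(** The integrability of [g] is given on [0, 1] only, so [g] is cut off outside, and the continuous
    [H] agrees with [F] on [0, 1]. The end points are handled by periodicity. *)
Lemma periodic_primitive_cont (g F : R -> R) : mu.-integrable `[0, 1] (EFin \o g) ->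
  (forall a b, a <= b -> F b - F a = \int[mu]_(t in `[a, b]) g t) ->
  (forall t, F (t + 1) = F t) -> continuous F.
Proof.
move=> ig FE F1.
pose g0 := g \_ `[0, 1].
have lg : locint g0.
  move=> a b; apply: (@integrableS _ _ _ mu setT) => //.
  have -> : EFin \o g0 = (EFin \o g) \_ `[0, 1] by rewrite restrict_EFin.
  exact: (integrable_mkcond _ _).1.
pose H s := F 0 + oriented_int 0 s g0.
have cH : continuous H.
  by move=> s; have c := oint_cont lg; rewrite /H; ct.
have FH s : 0 <= s <= 1 -> F s = H s.
  move=> /andP[s0 s1]; rewrite /H oint_le// -[LHS](subrK (F 0)) FE// addrC; congr (_ + _).
  apply: Rint_ext => s' /andP[h1 h2]; rewrite /g0 patchE ifT// inE /= in_itv /= h1.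
  exact: le_trans h2 s1.
have F01 : F 1 = F 0 by rewrite -(F1 0) add0r.
apply: periodic_ind => [s /ctP h|s /ctP h|t t01].
- apply/ctP => e /h[d d0 hd]; exists d => // s' ss'.
  have := hd (s' - 1); rewrite -F1 subrK -(F1 s); apply.
  by rewrite (_ : _ - _ = s' - (s + 1))//; ring.
- apply/ctP => e /h[d d0 hd]; exists d => // s' ss'.
  have := hd (s' + 1); rewrite !F1; apply.
  by rewrite (_ : _ - _ = s' - s)//; ring.
apply/ctP => e e0; have e2 : 0 < e / 2 by lra.
have [d1 d10 hd1] := (ctP _ _).1 (@cH t) _ e2.
have [d2 d20 hd2] := (ctP _ _).1 (@cH 0) _ e2.
have [d3 d30 hd3] := (ctP _ _).1 (@cH 1) _ e2.
(* A point [s] beyond one end of [0, 1] is translated to the other end, so the continuity of [H] at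
   0 and at 1 is used besides that at [t]. *)
exists (Num.min (Num.min 1 d1) (Num.min d2 d3)); first by rewrite !lt_min ltr01 d10 d20.
move=> s; rewrite !lt_min => /andP[/andP[s1 sd1] /andP[sd2 sd3]].
move: t01 => /andP[t0 t1]; have := s1; rewrite ltr_distl => /andP[s3 s4].
have [s0|s0] := ltP s 0.
  have a1 := hd3 (s + 1); have a2 := hd1 0.
  rewrite -!FH ?F1 ?F01 in a1 a2; [|lra..].
  have b1 : `|s + 1 - 1| < d3 by move: sd3; rewrite addrK !ltr_norml; lra.
  have b2 : `|0 - t| < d1 by move: sd1; rewrite !ltr_norml; lra.
  have {}a1 := a1 b1; have {}a2 := a2 b2.
  by rewrite (_ : F s - F t = (F s - F 0) + (F 0 - F t)); [have := ler_normD (F s - F 0) (F 0 - F t); lra|ring].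
have [s2|s2] := ltP 1 s; last first.
  by have := hd1 s sd1; rewrite -!FH; lra.
have a1 := hd2 (s - 1); have a2 := hd1 1.
rewrite -!FH ?F01 in a1 a2; [|lra..].
have b1 : `|s - 1 - 0| < d2 by move: sd2; rewrite subr0 !ltr_norml; lra.
have b2 : `|1 - t| < d1 by move: sd1; rewrite !ltr_norml; lra.
have {}a1 := a1 b1; have {}a2 := a2 b2.
have Fs : F (s - 1) = F s by rewrite -F1 subrK.
rewrite Fs in a1.
by rewrite (_ : F s - F t = (F s - F 0) + (F 0 - F t)); [have := ler_normD (F s - F 0) (F 0 - F t); lra|ring].
Qed.

Lemma ae_dense (P : R -> Prop) : {ae mu, forall t, P t} ->
  forall t d, 0 < d -> exists2 s, `|s - t| < d & P s.
Proof.
move=> [N [mN N0 sub]] t d d0; apply: contrapT => no.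
have sN : `]t - d, t + d[%classic `<=` N.
  move=> s /=; rewrite in_itv /= => st; apply: sub => /= Ps; apply: no; exists s => //.
  by rewrite ltr_distl.
have h : (mu `](t - d)%R, (t + d)%R[%classic <= mu N)%E.
  by apply: le_measure; rewrite ?inE //; exact: measurable_itv.
move: h; rewrite N0 lebesgue_measure_itv /= lte_fin ifT; last by lra.
by rewrite -EFinB lee_fin; lra.
Qed.

Lemma dense_zero (F : R -> R) t : {for t, continuous F} ->
  (forall d, 0 < d -> exists2 s, `|s - t| < d & F s = 0) -> F t = 0.
Proof.
move=> /ctP cF h; apply/eqP/negPn/negP => Ft.
have Ft0 : 0 < `|F t| by rewrite normr_gt0.
have [d /h[s sd Fs] hd] := cF _ Ft0.
by have := hd s sd; rewrite Fs sub0r normrN ltxx.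
Qed.

Lemma periodic_isolated (P : R -> Prop) : (forall t, P (t + 1) <-> P t) ->
  finite_set (`[0, 1[%classic `&` P) ->
  forall t, exists2 d : R, 0 < d & forall s, s != t -> `|s - t| < d -> ~ P s.
Proof.
move=> P1 fin; apply: periodic_ind => [t [d d0 hd]|t [d d0 hd]|t t01].
- exists d => // s st sd Ps; apply: (hd (s - 1)); last by rewrite -P1 subrK.
    by rewrite subr_eq.
  by rewrite (_ : _ - _ = s - (t + 1))//; ring.
- exists d => // s st sd Ps; apply: (hd (s + 1)); last by rewrite P1.
    by apply: contra_neq st => /addIr.
  by rewrite (_ : _ - _ = s - t)//; ring.
pose F := `[0, 1[%classic `&` P.
(* The translates of [F] by -1, 0 and 1 contain all points of [P] at distance less than 1 from [t];
   a finite set without [t] is closed. *)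
pose S := F `|` (+%R^~ 1) @` F `|` (+%R^~ (- 1)) @` F.
have fS : finite_set S by rewrite !finite_setU; split; [split|] => //; exact: finite_image.
have cS : closed (S `\ t) by apply: compact_closed; [exact: Rhausdorff|apply: finite_compact; exact: finite_setD].
have oS : open (~` (S `\ t)) := closed_openC cS.
have nS : nbhs t (~` (S `\ t)).
  by apply: open_nbhs_nbhs; split => //=; move=> [_]; apply.
have [d d0 hd] := (nearRP _ _).1 nS.
exists (Num.min d 1); first by rewrite lt_min d0 ltr01.
move=> s st; rewrite lt_min => /andP[sd s1] Ps; apply: (hd s sd); split; last by apply/eqP.
rewrite ltr_norml in s1.
have [s0|s0] := ltP s 0.
  right; exists (s + 1); last by rewrite addrK.
  by split; [rewrite /= in_itv /=; lra|rewrite P1].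
have [s2|s2] := leP 1 s; last by left; left; split => //=; rewrite in_itv /= s0 s2.
have [s3|s3] := ltP (s - 1) 1.
  left; right; exists (s - 1); last by rewrite subrK.
  by split; [rewrite /= in_itv /=; lra|rewrite -P1 subrK].
by lra.
Qed.

End weak.

Section extraction.
Context {R : realType}.
Notation mu := (@lebesgue_measure R).
Implicit Types (s t d a b : R).
Variables (Q : set (plane R)) (A At Ax Ay : R -> plane R -> plane R).
Variables (f fx fy : plane R -> R).
Hypothesis fd : field_data Q A f At Ax Ay fx fy.
Variable q : R -> plane R.
Hypothesis qS : CollS Q A q.

Let q1 t := (q t).1.
Let q2 t := (q t).2.
Let p1 t := (q^`()%classic t).1.
Let p2 t := (q^`()%classic t).2.
Let r t := enorm (q t).
Let a1 t := (dotA A t (q1 t, q2 t)).1.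
Let a2 t := (dotA A t (q1 t, q2 t)).2.
Let b t := magnetic A t (q1 t, q2 t).

Let rE t : r t = Num.sqrt (q1 t ^+ 2 + q2 t ^+ 2).
Proof. by rewrite /r /enorm /edot -!expr2. Qed.
Let qE t : q t = (q1 t, q2 t). Proof. exact: surjective_pairing. Qed.

Let qr t : (q t == 0) = (r t == 0).
Proof.
rewrite rE sqrtr_eq0 le_eqVlt ltNge addr_ge0 ?sqr_ge0// orbF.
rewrite paddr_eq0 ?sqr_ge0// !sqrf_eq0.
by rewrite /q1 /q2; case: (q t).
Qed.

Let q_per t : q (t + 1) = q t. Proof. by case: qS => -[[+ _ _] _ _] _; exact. Qed.
Let Qq t : Q (q1 t, q2 t).
Proof. by rewrite -qE; case: qS => -[[_ + _] _ _] _; exact. Qed.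

Let cq : continuous q1 /\ continuous q2.
Proof.
case: qS => -[[_ _ [v [_ [m1 m2] iv Ev]]] _ _] _.
(* Square integrability on [0, 1] implies integrability, through the bound |v_i| <= |v|^2 + 1 for
   the components. *)
have int (g : R -> R) : measurable_fun [set: R] g -> (forall t, `|g t| <= enorm (v t) ^+ 2 + 1) ->
    mu.-integrable `[0, 1] (EFin \o g).
  move=> mg gv.
  have i1 : mu.-integrable `[0, 1] (EFin \o (fun t => enorm (v t) ^+ 2 + 1)).
    pose F1 := EFin \o (fun t => enorm (v t) ^+ 2); pose F2 := EFin \o (fun _ : R => 1 : R).
    have i0 : mu.-integrable `[0, 1] F2 by apply: cont_locint => t; exact: ctc.
    have -> : EFin \o (fun t => enorm (v t) ^+ 2 + 1) = (F1 \+ F2)%E.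
      by apply/funext => t; rewrite /= EFinD.
    by apply: integrableD.
  apply: (le_integrable _ _ _ i1) => //.
    by apply/measurable_EFinP; exact: measurable_funS mg.
  by move=> t _; rewrite /= lee_fin [leRHS]ger0_norm ?gv// addr_ge0// sqr_ge0.
have gv1 t : `|(v t).1| <= enorm (v t) ^+ 2 + 1.
  rewrite enorm_sqr -(real_normK (num_real (v t).1)).
  have := sqr_ge0 (v t).2; have := sqr_ge0 (`|(v t).1| - 1); have := normr_ge0 (v t).1.
  by move: (`|(v t).1|) ((v t).2) => X Y *; nra.
have gv2 t : `|(v t).2| <= enorm (v t) ^+ 2 + 1.
  rewrite enorm_sqr -(real_normK (num_real (v t).2)).
  have := sqr_ge0 (v t).1; have := sqr_ge0 (`|(v t).2| - 1); have := normr_ge0 (v t).2.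
  by move: (`|(v t).2|) ((v t).1) => X Y *; nra.
split.
  apply: (periodic_primitive_cont (int _ m1 gv1)) => [c d cd|t].
    by have := congr1 fst (Ev c d cd).
  by rewrite /q1 q_per.
apply: (periodic_primitive_cont (int _ m2 gv2)) => [c d cd|t].
  by have := congr1 snd (Ev c d cd).
by rewrite /q2 q_per.
Qed.
Let cq1 := cq.1.
Let cq2 := cq.2.

Let iso t : exists2 d : R, 0 < d & forall s, s != t -> `|s - t| < d -> r s != 0.
Proof.
case: qS => -[_ fin _] _.
have [|d d0 hd] := @periodic_isolated R (q @^-1` [set 0]) _ fin t.
  by move=> s; rewrite /= q_per.
by exists d => // s st sd; rewrite -qr; apply/eqP; exact: hd s st sd.
Qed.

Let cr : continuous r.
Proof.
have -> : r = (fun t => Num.sqrt (q1 t ^+ 2 + q2 t ^+ 2)) by apply/funext.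
by move=> t; ct.
Qed.
Let r0 t : 0 <= r t. Proof. by rewrite rE sqrtr_ge0. Qed.

Let near_off t : r t != 0 -> \near t, r t != 0.
Proof. exact: (near_neq0 (@cr t)). Qed.

Let hq t : r t != 0 -> HD q1 t (p1 t) /\ HD q2 t (p2 t).
Proof. by rewrite -qr => /(qS.2 t)[dq _ _]; exact: curve_HD dq. Qed.

Let hp t : r t != 0 -> HD p1 t (b t * p2 t - a1 t - q1 t / r t ^+ 3) /\
  HD p2 t (- b t * p1 t - a2 t - q2 t / r t ^+ 3).
Proof.
rewrite -qr => /(qS.2 t)[_ dq E]; have [h1 h2] := curve_HD dq.
split; [apply: HDeq h1 _|apply: HDeq h2 _]; rewrite E /b /a1 /a2 -qE /imul /= /GRing.scale /=.
  by rewrite -/(p2 t) -/(r t) -/(q1 t); move: (p2 t) => P; ring.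
by rewrite -/(p1 t) -/(r t) -/(q2 t); move: (p1 t) => P; ring.
Qed.

(** An identity that holds almost everywhere holds at points arbitrarily near [t]. The equation of
    motion makes the velocity continuous off the collisions, so the identities for e and beta hold
    at every such point. *)
Let dense (P : R -> Prop) t (F : R -> R) : {ae mu, forall t, P t} -> r t != 0 ->
  {for t, continuous F} -> (forall s, r s != 0 -> P s -> F s = 0) -> F t = 0.
Proof.
move=> aeP rt cF h; apply: (dense_zero cF) => d d0.
have [d' d'0 hd'] := (nearRP _ _).1 (near_off rt).
have dd : 0 < Num.min d d' by rewrite lt_min d0.
have [s + Ps] := ae_dense aeP t dd; rewrite lt_min => /andP[sd sd'].
by exists s => //; apply: h => //; exact: hd'.
Qed.

Lemma CollS_system : exists e al1 al2,
  collision_system q1 q2 p1 p2 r e al1 al2 a1 a2 b.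
Proof.
case: (qS) => -[_ _ [al [e [be [[cal ce cbe] [pal pe pbe] [nal be0] alE id]]]]] _.
have cal1 s : {for s, continuous (fun t => (al t).1)} := ct_fst (@cal s).
have cal2 s : {for s, continuous (fun t => (al t).2)} := ct_snd (@cal s).
have cbe1 s : {for s, continuous (fun t => (be t).1)} := ct_fst (@cbe s).
have cbe2 s : {for s, continuous (fun t => (be t).2)} := ct_snd (@cbe s).
pose al1 t := (al t).1; pose al2 t := (al t).2.
have alr t : r t != 0 -> al1 t = q1 t / r t /\ al2 t = q2 t / r t.
  rewrite -qr => qt; rewrite /al1 /al2 alE// /GRing.scale /= -/(r t).
  by split; rewrite mulrC.
have norm t : al1 t ^+ 2 + al2 t ^+ 2 = 1.
  by rewrite /al1 /al2 -enorm_sqr nal expr1n.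
have rz t : r t = 0 -> q1 t = 0 /\ q2 t = 0.
  by move=> /eqP; rewrite -qr => /eqP q0; rewrite /q1 /q2 q0.
have r2 t : r t ^+ 2 = q1 t ^+ 2 + q2 t ^+ 2.
  by rewrite rE sqr_sqrtr// addr_ge0 ?sqr_ge0.
have energy t : r t != 0 -> e t = (p1 t ^+ 2 + p2 t ^+ 2) / 2 - (r t)^-1.
  move=> rt; have c1 := HD_cont (hp rt).1; have c2 := HD_cont (hp rt).2; have c3 := @cr t.
  apply/eqP; rewrite -subr_eq0; apply/eqP.
  apply: (@dense _ t (fun t => e t - ((p1 t ^+ 2 + p2 t ^+ 2) / 2 - (r t)^-1)) id rt).
    by have c4 := @ce t; ct.
  move=> s rs; rewrite qr => /(_ rs)[_ _ -> _]; rewrite enorm_sqr -/(r s) -/(p1 s) -/(p2 s).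
  by field.
have hr t : r t != 0 -> HD r t ((q1 t * p1 t + q2 t * p2 t) / r t).
  move=> rt; have [h1 h2] := hq rt.
  have rt0 : 0 < q1 t ^+ 2 + q2 t ^+ 2 by rewrite -r2 exprn_even_gt0.
  apply: (@HD_near _ (fun t => Num.sqrt (q1 t ^+ 2 + q2 t ^+ 2))).
    by apply/nearRP; exists 1 => // s _; rewrite rE.
  by der; first exact: rt0; rewrite -rE; field.
have hal t : r t != 0 ->
    HD al1 t (- (q1 t * p2 t - q2 t * p1 t) * q2 t / r t ^+ 3) /\
    HD al2 t ((q1 t * p2 t - q2 t * p1 t) * q1 t / r t ^+ 3).
  move=> rt; have [h1 h2] := hq rt; have h3 := hr t rt; split.
    apply: (@HD_near _ (fun t => q1 t / r t)).
      by apply: filterS (near_off rt) => s /alr[-> _].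
    der; first exact: rt.
    transitivity ((p1 t * r t ^+ 2 - q1 t * (q1 t * p1 t + q2 t * p2 t)) / r t ^+ 3); first by field.
    by rewrite r2; congr (_ / _); ring.
  apply: (@HD_near _ (fun t => q2 t / r t)).
    by apply: filterS (near_off rt) => s /alr[_ ->].
  der; first exact: rt.
  transitivity ((p2 t * r t ^+ 2 - q2 t * (q1 t * p1 t + q2 t * p2 t)) / r t ^+ 3); first by field.
  by rewrite r2; congr (_ / _); ring.
(* L / r is the component of beta along i alpha, and both sides vanish at a collision. This is how
   the continuity of beta enters: it gives that of L / r through the collisions. *)
have GE t : (q1 t * p2 t - q2 t * p1 t) / r t = (be t).2 * al1 t - (be t).1 * al2 t.
  have [rt|rt] := eqVneq (r t) 0.
    by rewrite be0 ?mul0r ?subrr ?rt ?invr0 ?mulr0//; apply/eqP; rewrite qr rt.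
  have c1 := HD_cont (hp rt).1; have c2 := HD_cont (hp rt).2; have c3 := @cr t.
  have c4 := HD_cont (hal t rt).1; have c5 := HD_cont (hal t rt).2.
  apply/eqP; rewrite -subr_eq0; apply/eqP.
  apply: (@dense _ t (fun t => (q1 t * p2 t - q2 t * p1 t) / r t - ((be t).2 * al1 t - (be t).1 * al2 t)) id rt).
    by ct.
  move=> s rs; rewrite qr => /(_ rs)[_ da _ ->]; have [h1 h2] := curve_HD da.
  rewrite /= /GRing.scale /= -/(r s) (HD_uniq h1 (hal s rs).1) (HD_uniq h2 (hal s rs).2).
  have [-> ->] := alr s rs.
  transitivity ((q1 s * p2 s - q2 s * p1 s) / r s - (q1 s * p2 s - q2 s * p1 s) * (q1 s ^+ 2 + q2 s ^+ 2) / r s ^+ 3).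
    by field.
  by rewrite -r2; field.
have cf (F : R -> plane R -> plane R) : F = At \/ F = Ax \/ F = Ay ->
    continuous (fun s => (F s (q1 s, q2 s)).1) /\ continuous (fun s => (F s (q1 s, q2 s)).2).
  move=> FE; have ck1 : ck 0 q1 := cq1. have ck2 : ck 0 q2 := cq2.
  exact: (fd_ck fd FE Qq (@ckid R 0) ck1 ck2).
have [K1 K2] := cf At (or_introl erefl).
have [_ K3] := cf Ax (or_intror (or_introl erefl)).
have [K4 _] := cf Ay (or_intror (or_intror erefl)).
have q1t t : (q1 (t + 1), q2 (t + 1)) = (q1 t, q2 t) by rewrite -!qE q_per.
have dper t : q^`()%classic (t + 1) = q^`()%classic t.
  rewrite /derive1.
  have -> : (fun h : R => h^-1 *: (q (h + (t + 1)) - q (t + 1))) = (fun h => h^-1 *: (q (h + t) - q t)).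
    by apply/funext => h; rewrite addrA !q_per.
  by [].
exists e, al1, al2; split.
- exact: rE.
- exact: cq1.
- exact: cq2.
- exact: ce.
- exact cal1.
- exact cal2.
- have -> : (fun t => (q1 t * p2 t - q2 t * p1 t) / r t) =
      (fun t => (be t).2 * al1 t - (be t).1 * al2 t) by exact/funext.
  have c1 s : {for s, continuous al1} := cal1 s.
  have c2 s : {for s, continuous al2} := cal2 s.
  by move=> t; ct.
- have -> : a1 = (fun s => (At s (q1 s, q2 s)).1).
    by apply/funext => s; rewrite /a1 (fd_dotA fd s (Qq s)).
  exact: K1.
- have -> : a2 = (fun s => (At s (q1 s, q2 s)).2).
    by apply/funext => s; rewrite /a2 (fd_dotA fd s (Qq s)).
  exact: K2.
- have -> : b = (fun s => (Ax s (q1 s, q2 s)).2 - (Ay s (q1 s, q2 s)).1).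
    by apply/funext => s; rewrite /b (fd_magnetic fd s (Qq s)).
  by move=> t; ct.
- exact: iso.
- by move=> t rt; exact: (hq rt).1.
- by move=> t rt; exact: (hq rt).2.
- by move=> t rt; exact: (hp rt).1.
- by move=> t rt; exact: (hp rt).2.
- move=> t; have [rt|rt] := eqVneq (r t) 0; first by rewrite (rz t rt).1 rt mul0r.
  by rewrite (alr t rt).1 mulrC mulfVK.
- move=> t; have [rt|rt] := eqVneq (r t) 0; first by rewrite (rz t rt).2 rt mul0r.
  by rewrite (alr t rt).2 mulrC mulfVK.
- exact: norm.
- exact: energy.
- by move=> t; rewrite /q1 /q2 /p1 /p2 dper q_per.
- move=> t; rewrite /a1 /a2 /b q1t; split; first exact: pe.
  + by rewrite (fd_dotA1 fd t (Qq t)).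
  + by rewrite (fd_dotA1 fd t (Qq t)).
  + by rewrite (fd_magnetic1 fd t (Qq t)).
Qed.

Lemma CollS_regular : exists (n : R) (t x y u v e : R -> R),
  regular Q A n t x y u v e /\ regular_orbit t x y = q.
Proof.
have [e [al1 [al2 cs]]] := CollS_system.
have [n [t [x [y [u [v [e' [reg E]]]]]]]] := @collision_regular _ _ _ _ _ _ _ _ _ _ _ _ cs Q A Qq
  (fun=> erefl) (fun=> erefl) (fun=> erefl).
exists n, t, x, y, u, v, e'; split; first exact: reg.
by apply/funext => s; rewrite E qE.
Qed.

End extraction.

(** * Passage to the quotient by the sign *)

Lemma time_repar_opp (R : realType) (z : R -> plane R) : time_repar (\- z) = time_repar z.
Proof.
have E s : enorm ((\- z) s) = enorm (z s) by rewrite /enorm /edot /= !mulrNN.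
apply/funext => s; rewrite /time_repar /L2norm /L2dot; congr (_ * _).
  congr ((_ ^+ _)^-1); congr Num.sqrt; apply: Rint_ext => s' _.
  by rewrite /edot /= !mulrNN.
by apply: oint_ext => s'; rewrite E.
Qed.

Lemma rescale_square_opp (R : realType) (z : R -> plane R) :
  rescale_square (\- z) = rescale_square z.
Proof.
apply/funext => t; rewrite /rescale_square /time_repar_inv time_repar_opp.
by rewrite /csqr /= !mulrNN.
Qed.

Theorem theorem1 (R : realType) (Q : set (plane R))
    (A : R -> plane R -> plane R) (f : plane R -> R)
    (openQ : open Q) (Q0 : Q 0) (tpA : twisted_periodic Q A f) :
  (forall z, critical Q A f z -> circle_homeo_lift (time_repar z)) /\
  exists rs : set (R -> plane R) -> (R -> plane R),
    (forall z, critical Q A f z -> rs (sign_class z) = rescale_square z) /\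
    set_bij (CritB Q A f) (CollS Q A) rs.
Proof.
have [At [Ax [Ay [fx [fy fd]]]]] := field_dataP openQ tpA.
have orbit z n u v e : regular Q A n (time_repar z) (fun s => (z s).1) (fun s => (z s).2) u v e ->
    rescale_square z = regular_orbit (time_repar z) (fun s => (z s).1) (fun s => (z s).2).
  by move=> _; apply/funext => t; rewrite /rescale_square /regular_orbit -surjective_pairing.
split.
  by move=> z /(critical_regular openQ fd)[n [u [v [e reg]]]]; exact: regular_homeo reg.
(* [xget] picks a representative of the class; [rescale_square_opp] makes the value independent of
   the choice. *)
pose rs (S : set (R -> plane R)) := rescale_square (xget (cst 0) S).
have rsE z : rs (sign_class z) = rescale_square z.
  rewrite /rs; case: xgetP => [z' _ [->//|->]|/(_ z)]; first exact: rescale_square_opp.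
  by case; left.
exists rs; split; first by move=> z _; exact: rsE.
split.
- move=> _ [z cz <-]; rewrite rsE.
  have [n [u [v [e reg]]]] := critical_regular openQ fd cz.
  by rewrite (orbit z n u v e reg); exact (regular_CollS fd reg).
- move=> _ _ /set_mem[z cz <-] /set_mem[z' cz' <-]; rewrite !rsE => E.
  have [n [u [v [e reg]]]] := critical_regular openQ fd cz.
  have [n' [u' [v' [e' reg']]]] := critical_regular openQ fd cz'.
  have [|sg h] := same_loop reg reg'.
    by move=> w; have := congr1 (fun q => q w) E; rewrite (orbit _ _ _ _ _ reg) (orbit _ _ _ _ _ reg').
  have zE : z' = if sg then \- z else z.
    apply/funext => s; have [h1 h2] := h s.
    rewrite [z' s]surjective_pairing h1 h2; case: (sg); rewrite ?expr0 ?expr1 ?mul1r ?mulN1r //.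
    by rewrite -surjective_pairing.
  rewrite zE; case: (sg) => //; apply/seteqP; split => w [] ->; rewrite /sign_class /=.
  + by right; apply/funext => s; rewrite /= opprK.
  + by left.
  + by right.
  + by left; apply/funext => s; rewrite /= opprK.
- move=> q qS; have [n [t [x [y [u [v [e [reg qE]]]]]]]] := CollS_regular fd qS.
  pose z s := (x s, y s).
  exists (sign_class z); first by exists z => //; exact (regular_critical openQ fd reg).
  rewrite rsE -qE; apply/funext => s.
  by rewrite /rescale_square /time_repar_inv (reg_time reg (z := z)).
Qed.
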